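(* Let $(A,[\,,\,]_A,a)$ be a Lie algebroid of rank $m$ over a smooth manifold $M$, equipped with a Nambu structure $\Pi\in\Gamma(\Lambda^nA)$ of order $n\le m$. Assume that $A$ is orientable as a vector bundle, and that $\Gamma A^\ast$ is locally spanned by elements of the form $d_Af$, $f\in C^\infty(M)$. For an orientation form $\nu\in\Gamma(\Lambda^mA^\ast)$ let $\widetilde{\mathcal M}_\Pi^\nu\in\Gamma(\Lambda^{n-1}A)$ be the multisection determined by $\mathcal L_{\Pi(d_Af_1\wedge\cdots\wedge d_Af_{n-1})}\nu=\langle\widetilde{\mathcal M}_\Pi^\nu,d_Af_1\wedge\cdots\wedge d_Af_{n-1}\rangle\,\nu$ for all $f_1,\dots,f_{n-1}\in C^\infty(M)$. Then: (1) The mapping $\mathcal M_\Pi^\nu\colon\Gamma(\Lambda^{n-1}A^\ast)\to C^\infty(M)$, $\alpha\mapsto\iota_\alpha\widetilde{\mathcal M}_\Pi^\nu$, is a $1$-cocycle in the cohomology complex (with trivial coefficients) of the Leibniz algebroid $(\mathscr A=\Lambda^{n-1}A^\ast,\ll\,,\gg_\ast,a\circ\Pi_{n-1})$. (2) The cohomology class $\mathcal M_\Pi=[\mathcal M_\Pi^\nu]\in\mathcal HL^1(\mathscr A)$ does not depend on the chosen orientation form $\nu$.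
   Context: $M$ is a smooth paracompact manifold; $(A,[\,,\,]_A,a)$ is a Lie algebroid over $M$ with anchor $a\colon A\to TM$; $d_A\colon\Gamma(\Lambda^kA^\ast)\to\Gamma(\Lambda^{k+1}A^\ast)$ is the Lie algebroid differential with trivial coefficients (so $d_Af(X)=a(X)f$), and $\mathcal L_X$ ($X\in\Gamma A$) is the Lie derivative on $\Gamma(\Lambda^\bullet A^\ast)$. $[\,,\,]_A$ also denotes the Schouten bracket on $\Gamma(\Lambda^\bullet A)$; in particular $[X,Y_1\wedge\cdots\wedge Y_k]_A=\sum_iY_1\wedge\cdots\wedge[X,Y_i]_A\wedge\cdots\wedge Y_k$ for $X,Y_i\in\Gamma A$. The pairing is $\langle\phi_1\wedge\cdots\wedge\phi_k,X_1\wedge\cdots\wedge X_k\rangle=\det(\phi_i(X_j))$. Contractions: for $\phi\in\Gamma(\Lambda^iA^\ast)$ and $\xi\in\Gamma(\Lambda^{k}A)$, $\iota_\phi\xi\in\Gamma(\Lambda^{k-i}A)$ is defined by $\langle\psi,\iota_\phi\xi\rangle=\langle\phi\wedge\psi,\xi\rangle$ for all $\psi\in\Gamma(\Lambda^{k-i}A^\ast)$; for $X\in\Gamma A$, $\iota_X$ is the usual interior multiplication on $\Gamma(\Lambda^\bullet A^\ast)$. Write $\Pi\alpha=\Pi(\alpha):=\iota_\alpha\Pi$ and let $\Pi_k\colon\Lambda^kA^\ast\to\Lambda^{n-k}A$, $\Pi_k(\alpha)=\iota_\alpha\Pi$. Nambu structure of order $n$: a section $\Pi\in\Gamma(\Lambda^nA)$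 with $[\Pi\alpha,\Pi]_A\beta=-\Pi(\iota_{\Pi\beta}d_A\alpha)$ for all $\alpha,\beta\in\Gamma(\Lambda^{n-1}A^\ast)$, where $[\Pi\alpha,\Pi]_A\beta:=\iota_\beta[\Pi\alpha,\Pi]_A$. Orientation form: a nowhere vanishing section $\nu\in\Gamma(\Lambda^mA^\ast)$, representing the orientation. Under the stated hypotheses, the map $(f_1,\dots,f_{n-1})\mapsto\mathcal M^\nu(f_1,\dots,f_{n-1})$ defined by $\mathcal L_{\Pi(d_Af_1\wedge\cdots\wedge d_Af_{n-1})}\nu=\mathcal M^\nu(f_1,\dots,f_{n-1})\nu$ is alternating, satisfies the Leibniz rule in each argument, and is induced by a unique $\widetilde{\mathcal M}_\Pi^\nu\in\Gamma(\Lambda^{n-1}A)$. Leibniz algebroid $\mathscr A$: the vector bundle $\Lambda^{n-1}A^\ast$ with anchor $a\circ\Pi_{n-1}$ and (not necessarily antisymmetric) bracket $\ll\alpha,\beta\gg_\ast=\mathcal L_{\Pi\alpha}\beta-\iota_{\Pi\beta}d_A\alpha$ on sections; it satisfies $\ll\alpha,f\beta\gg_\ast=f\ll\alpha,\beta\gg_\ast+(a(\Pi\alpha)f)\beta$ and the left Leibniz identity. Its cohomology $\mathcal HL^\bullet(\mathscr A)$ is that of the complex with $C^0=C^\infty(M)$ and $C^k$ the $\mathbb R$-multilinear maps $\phi\colon\Gamma(\mathscr A)^k\to C^\infty(M)$, with $d_{\mathscr A}\phi(\alpha_1,\dots,\alpha_{k+1})=\sum_{r}(-1)^{r+1}a(\Pi\alpha_r)\big(\phi(\dots,\widehat{\alpha_r},\dots)\big)+\sum_{r<s}(-1)^r\phi(\alpha_1,\dots,\widehat{\alpha_r},\dots,\ll\alpha_r,\alpha_s\gg_\ast,\dots,\alpha_{k+1})$,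 the bracket being in the position of $\alpha_s$. In particular $(d_{\mathscr A}f)(\alpha)=a(\Pi\alpha)f$. *)

(* Defs.v *)
From HB Require Import structures.
From mathcomp Require Import all_boot all_order all_algebra all_fingroup.
From mathcomp Require Import boolp classical_sets functions cardinality.
From mathcomp Require Import reals topology normedtype derive.

Set Implicit Arguments.
Unset Strict Implicit.
Unset Printing Implicit Defensive.

Import Order.TTheory GRing.Theory Num.Theory.
Import numFieldNormedType.Exports.

Local Open Scope classical_set_scope.
Local Open Scope ring_scope.

(** * Multilinear algebra on a finite-dimensional real vector space

   An element of [Lambda^k V^*] is an alternating [k]-linear form on [V], and
   an element of [Lambda^k V] is an alternating [k]-linear form on [V^*]; thus
   [xi (phi_1, ..., phi_k)] is the pairing
   [<phi_1 /\ ... /\ phi_k, xi>], and [X_1 /\ ... /\ X_k] is the function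
   [(phi_i) |-> det (phi_i (X_j))]. *)

Definition dualv (R : realType) (V : vectType R) : vectType R := 'Hom(V, R^o).

Definition kform (R : realType) (V : vectType R) (k : nat) : Type :=
  ('I_k -> V) -> R.

Definition kvec (R : realType) (V : vectType R) (k : nat) : Type :=
  kform (dualv V) k.

Definition alternating (R : realType) (V : vectType R) (k : nat)
    (f : kform V k) : Prop :=
  (forall (i : 'I_k) (v : 'I_k -> V) (c : R) (u w : V),
     f [eta v with i |-> c *: u + w] =
     c * f [eta v with i |-> u] + f [eta v with i |-> w]) /\
  (forall (i j : 'I_k) (v : 'I_k -> V), i != j -> v i = v j -> f v = 0).

Definition basis_vec (R : realType) (V : vectType R)
    (a : 'I_(\dim {:V})) : V := tnth (vbasis {:V}) a.

Definition basis_cov (R : realType) (V : vectType R)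
    (a : 'I_(\dim {:V})) : dualv V :=
  linfun (coord (vbasis {:V}) a : V -> R^o).

(* The canonical identification of [V^**] with [V]. *)
Definition vec_of (R : realType) (V : vectType R) (xi : kvec V 1) : V :=
  \sum_a xi (fun _ => basis_cov a) *: basis_vec a.

(* The sum runs over all index tuples instead of the increasing ones, whence
   the factor [1/k!]. *)
Definition pairing (R : realType) (V : vectType R) (k : nat)
    (phi : kform V k) (xi : kvec V k) : R :=
  (k`!%:R)^-1 * \sum_(J : {ffun 'I_k -> 'I_(\dim {:V})})
     phi (fun j => basis_vec (J j)) * xi (fun j => basis_cov (J j)).

Definition wedge (R : realType) (V : vectType R) (p q : nat)
    (phi : kform V p) (psi : kform V q) : kform V (p + q) :=
  fun v => (p`!%:R * q`!%:R)^-1 *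
    \sum_(s : 'S_(p + q)) (-1) ^+ s *
      phi (fun i => v (s (lshift q i))) * psi (fun j => v (s (rshift p j))).

(* [psi_1 /\ ... /\ psi_k] for covectors [psi_i]. *)
Definition wedge_cov (R : realType) (V : vectType R) (k : nat)
    (psi : 'I_k -> dualv V) : kform V k :=
  fun v => \det (\matrix_(i < k, j < k) (psi i (v j) : R)).

(* [iota_phi xi], i.e. [<psi, iota_phi xi> = <phi /\ psi, xi>]. *)
Definition contract (R : realType) (V : vectType R) (p q : nat)
    (phi : kform V p) (xi : kvec V (p + q)) : kvec V q :=
  fun psi => pairing (wedge phi (wedge_cov psi)) xi.

Definition interior (R : realType) (V : vectType R) (k : nat)
    (X : V) (omega : kform V k.+1) : kform V k :=
  fun v => omega (fun j => if unlift ord0 j is Some i then v i else X).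

(** * Smooth manifolds *)

(* [C^k] regularity on an open subset [U] of [R^d]. *)
Fixpoint Ck_on (R : realType) (d k : nat) (U : set 'rV[R]_d)
    (f : 'rV[R]_d -> R) : Prop :=
  match k with
  | 0 => forall x, U x -> {for x, continuous f}
  | k'.+1 => (forall x, U x -> differentiable f x) /\
             (forall v : 'rV[R]_d, Ck_on k' U (fun x => 'D_v f x))
  end.

Definition Cinfty_on (R : realType) (d : nat) (U : set 'rV[R]_d)
    (f : 'rV[R]_d -> R) : Prop :=
  forall k, Ck_on k U f.

Definition paracompact (T : topologicalType) : Prop :=
  forall C : set (set T),
    (forall U, C U -> open U) -> (forall x, exists2 U, C U & U x) ->
  exists D : set (set T),
    [/\ forall V, D V -> open V,
        forall x, exists2 V, D V & V x,
        forall V, D V -> exists2 U, C U & V `<=` U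
      & forall x : T, exists2 W, nbhs x W &
          finite_set [set V | D V /\ V `&` W !=set0]].

Record manifold (R : realType) (d : nat) := Manifold {
  mcarrier :> topologicalType;
  m_hausdorff : hausdorff_space mcarrier;
  m_paracompact : paracompact mcarrier;
  chart_index : Type;
  chart_dom : chart_index -> set mcarrier;
  chart : chart_index -> mcarrier -> 'rV[R]_d;
  chart_inv : chart_index -> 'rV[R]_d -> mcarrier;
  chart_dom_open : forall i, open (chart_dom i);
  chart_cover : forall x, exists i, chart_dom i x;
  chartK : forall i x, chart_dom i x -> chart_inv i (chart i x) = x;
  chart_img_open : forall i, open (chart i @` chart_dom i);
  chart_continuous : forall i x, chart_dom i x ->
    {for x, continuous (chart i)};
  chart_inv_continuous : forall i y, (chart i @` chart_dom i) y ->
    {for y, continuous (chart_inv i)};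
  chart_transition : forall i j (a : 'I_d),
    Cinfty_on (chart i @` (chart_dom i `&` chart_dom j))
      (fun y => chart j (chart_inv i y) ord0 a) }.

(* [C^infty] regularity on an open subset [U] of [M]; the values of [f]
   outside [U] are irrelevant. *)
Definition smooth_on (R : realType) (d : nat) (M : manifold R d) (U : set M)
    (f : M -> R) : Prop :=
  forall i : chart_index M,
    Cinfty_on (chart i @` (chart_dom i `&` U)) (fun y => f (chart_inv i y)).

Definition smooth (R : realType) (d : nat) (M : manifold R d) (f : M -> R) :
  Prop := smooth_on setT f.

(* [T_x M] as the space of derivations at [x] of [C^infty(M)]; the values on
   functions that are not smooth are irrelevant. *)
Definition tangent_at (R : realType) (d : nat) (M : manifold R d) (x : M)
    (D : (M -> R) -> R) : Prop :=
  (forall (c : R) (f g : M -> R), smooth f -> smooth g ->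
     D (fun y => c * f y + g y) = c * D f + D g) /\
  (forall f g : M -> R, smooth f -> smooth g ->
     D (fun y => f y * g y) = D f * g x + f x * D g).

(** * Vector bundles *)

(* A local trivialisation over the open set [frame_dom i] is given by the
   corresponding local frame; [frame_transition] says that the transition
   matrices are smooth. *)
Record vbundle (R : realType) (d : nat) (M : manifold R d) (m : nat) :=
  Vbundle {
  fib : M -> vectType R;
  frame_index : Type;
  frame_dom : frame_index -> set M;
  frame : frame_index -> forall x : M, m.-tuple (fib x);
  frame_dom_open : forall i, open (frame_dom i);
  frame_cover : forall x, exists i, frame_dom i x;
  frame_basis : forall i x, frame_dom i x ->
    basis_of {:fib x} (frame i x);
  frame_transition : forall i j (a b : 'I_m),
    smooth_on (frame_dom i `&` frame_dom j)
      (fun x => coord (frame i x) a (tnth (frame j x) b)) }.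

(* Arbitrary sections; regularity is a separate predicate. *)
Definition sec (R : realType) (d : nat) (M : manifold R d) (m : nat)
    (E : vbundle M m) : Type := forall x : M, fib E x.

Definition smooth_sec_on (R : realType) (d : nat) (M : manifold R d) (m : nat)
    (E : vbundle M m) (U : set M) (s : sec E) : Prop :=
  forall (i : frame_index E) (a : 'I_m),
    smooth_on (frame_dom i `&` U) (fun x => coord (frame i x) a (s x)).

Definition smooth_sec (R : realType) (d : nat) (M : manifold R d) (m : nat)
    (E : vbundle M m) (s : sec E) : Prop := smooth_sec_on setT s.

(* Sections of [E^*], [Lambda^k E^*] and [Lambda^k E]. *)

Definition cosec (R : realType) (d : nat) (M : manifold R d) (m : nat)
    (E : vbundle M m) : Type := forall x : M, dualv (fib E x).

Definition smooth_cosec_on (R : realType) (d : nat) (M : manifold R d)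
    (m : nat) (E : vbundle M m) (U : set M) (phi : cosec E) : Prop :=
  forall (i : frame_index E) (a : 'I_m),
    smooth_on (frame_dom i `&` U) (fun x => phi x (tnth (frame i x) a)).

Definition smooth_cosec (R : realType) (d : nat) (M : manifold R d) (m : nat)
    (E : vbundle M m) (phi : cosec E) : Prop := smooth_cosec_on setT phi.

Definition lform (R : realType) (d : nat) (M : manifold R d) (m : nat)
    (E : vbundle M m) (k : nat) : Type := forall x : M, kform (fib E x) k.

Definition smooth_form (R : realType) (d : nat) (M : manifold R d) (m : nat)
    (E : vbundle M m) (k : nat) (alpha : lform E k) : Prop :=
  (forall x, alternating (alpha x)) /\
  (forall (i : frame_index E) (J : 'I_k -> 'I_m),
     smooth_on (frame_dom i)
       (fun x => alpha x (fun j => tnth (frame i x) (J j)))).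

Definition multivec (R : realType) (d : nat) (M : manifold R d) (m : nat)
    (E : vbundle M m) (k : nat) : Type := forall x : M, kvec (fib E x) k.

Definition coframe (R : realType) (d : nat) (M : manifold R d) (m : nat)
    (E : vbundle M m) (i : frame_index E) (x : M) (a : 'I_m) :
    dualv (fib E x) :=
  linfun (coord (frame i x) a : fib E x -> R^o).

Definition smooth_multivec (R : realType) (d : nat) (M : manifold R d)
    (m : nat) (E : vbundle M m) (k : nat) (xi : multivec E k) : Prop :=
  (forall x, alternating (xi x)) /\
  (forall (i : frame_index E) (J : 'I_k -> 'I_m),
     smooth_on (frame_dom i) (fun x => xi x (fun j => coframe i x (J j)))).

(* A global smooth section with prescribed value at [x]. One always exists;
   the tensorial expressions below do not depend on the choice. *)
Definition ext (R : realType) (d : nat) (M : manifold R d) (m : nat)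
    (E : vbundle M m) (x : M) (v : fib E x) : sec E :=
  xget (fun=> 0) ([set s | smooth_sec (s : sec E) /\ s x = v]
                    : set {classic sec E}).

Definition ext_cov (R : realType) (d : nat) (M : manifold R d) (m : nat)
    (E : vbundle M m) (x : M) (c : dualv (fib E x)) : cosec E :=
  xget (fun=> 0) ([set s | smooth_cosec (s : cosec E) /\ s x = c]
                    : set {classic cosec E}).

(** * Lie algebroids *)

(* The anchor is written as [anchor x v f], the derivative of [f] along the
   tangent vector [a(v)] at [x]. The bracket is only meaningful on smooth
   sections. *)
Record lie_algebroid (R : realType) (d : nat) (M : manifold R d) (m : nat) :=
  LieAlgebroid {
  la_bundle :> vbundle M m;
  anchor : forall x : M, fib la_bundle x -> (M -> R) -> R;
  bracket : sec la_bundle -> sec la_bundle -> sec la_bundle;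
  anchor_tangent : forall x (v : fib la_bundle x), tangent_at x (anchor v);
  anchor_linear : forall x (c : R) (u v : fib la_bundle x) (f : M -> R),
    smooth f -> anchor (c *: u + v) f = c * anchor u f + anchor v f;
  anchor_smooth : forall (X : sec la_bundle) (f : M -> R),
    smooth_sec X -> smooth f -> smooth (fun x => anchor (X x) f);
  bracket_smooth : forall X Y : sec la_bundle,
    smooth_sec X -> smooth_sec Y -> smooth_sec (bracket X Y);
  bracket_linear : forall (c : R) (X Y Z : sec la_bundle),
    smooth_sec X -> smooth_sec Y -> smooth_sec Z ->
    forall x, bracket (fun y => c *: X y + Y y) Z x =
      c *: bracket X Z x + bracket Y Z x;
  bracket_anti : forall X Y : sec la_bundle,
    smooth_sec X -> smooth_sec Y -> forall x, bracket X Y x = - bracket Y X x;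
  bracket_jacobi : forall X Y Z : sec la_bundle,
    smooth_sec X -> smooth_sec Y -> smooth_sec Z ->
    forall x, bracket X (bracket Y Z) x + bracket Y (bracket Z X) x +
      bracket Z (bracket X Y) x = 0;
  bracket_leibniz : forall (X Y : sec la_bundle) (f : M -> R),
    smooth_sec X -> smooth_sec Y -> smooth f ->
    forall x, bracket X (fun y => f y *: Y y) x =
      f x *: bracket X Y x + anchor (X x) f *: Y x;
  anchor_bracket : forall (X Y : sec la_bundle) (f : M -> R),
    smooth_sec X -> smooth_sec Y -> smooth f ->
    forall x, anchor (bracket X Y x) f =
      anchor (X x) (fun y => anchor (Y y) f) -
      anchor (Y x) (fun y => anchor (X y) f) }.

(* Differential of the Leibniz cochain complex with trivial coefficients,
   indices starting at [0]. On alternating cochains it agrees with the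
   Chevalley-Eilenberg differential: moving [br (X r) (X s)] from the front
   to the position of [X s] accounts for the sign [(-1)^(s-1)]. *)
Definition leibniz_diff (S T : Type) (R : realType)
    (act : S -> (T -> R) -> T -> R) (br : S -> S -> S) (k : nat)
    (phi : ('I_k -> S) -> T -> R) : ('I_k.+1 -> S) -> T -> R :=
  fun X x =>
    \sum_(r < k.+1) (-1) ^+ r * act (X r) (phi (fun i => X (lift r i))) x +
    \sum_(r < k.+1) \sum_(s < k.+1 | (r < s)%N) (-1) ^+ r.+1 *
      phi (fun i => if lift r i == s then br (X r) (X s) else X (lift r i)) x.

Section Calculus.
Context (R : realType) (d : nat) (M : manifold R d) (m : nat).
Context (A : lie_algebroid M m).

Definition along (X : sec A) (f : M -> R) : M -> R :=
  fun x => anchor (X x) f.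

(* [d_A f]. *)
Definition dfun (f : M -> R) : cosec A :=
  fun x => linfun ((fun v => anchor v f) : fib A x -> R^o).

Definition dform (k : nat) (alpha : lform A k) : lform A k.+1 :=
  fun x v => leibniz_diff along (@bracket _ _ _ _ A)
    (fun (X : 'I_k -> sec A) y => alpha y (fun i => X i y))
    (fun i => ext (v i)) x.

Definition lie_form (X : sec A) (k : nat) (alpha : lform A k) : lform A k :=
  fun x v =>
    along X (fun y => alpha y (fun i => ext (v i) y)) x -
    \sum_(i < k) alpha x [eta v with i |-> bracket X (ext (v i)) x].

Definition lie_cosec (X : sec A) (phi : cosec A) : cosec A :=
  fun x => linfun ((fun v => along X (fun y => phi y (ext v y)) x -
                             phi x (bracket X (ext v) x)) : fib A x -> R^o).

(* The Schouten bracket [[X, xi]] of a section [X] of [A] with a multisection,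
   i.e. the derivation of [Gamma(Lambda A)] extending [[X, -]]: since
   [a(X) <phi, Y> = <L_X phi, Y> + <phi, [X, Y]>], it is dual to the Lie
   derivative of covectors. *)
Definition schouten (X : sec A) (k : nat) (xi : multivec A k) :
    multivec A k :=
  fun x c =>
    along X (fun y => xi y (fun i => ext_cov (c i) y)) x -
    \sum_(i < k) xi x [eta c with i |-> lie_cosec X (ext_cov (c i)) x].

Definition interior_form (k : nat) (X : sec A) (omega : lform A k.+1) :
    lform A k := fun x => interior (X x) (omega x).

(* [Pi alpha = iota_alpha Pi], as a section of [A]. *)
Definition sharp (p : nat) (Pi : multivec A (p + 1)) (alpha : lform A p) :
    sec A := fun x => vec_of (contract (alpha x) (Pi x)).

(* The order of [Pi] is [n = p + 1]. *)
Definition nambu (p : nat) (Pi : multivec A (p + 1)) : Prop :=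
  smooth_multivec Pi /\
  forall alpha beta : lform A p, smooth_form alpha -> smooth_form beta ->
  forall x, sharp (schouten (sharp Pi alpha) Pi) beta x =
    - sharp Pi (interior_form (sharp Pi beta) (dform alpha)) x.

Definition orientation_form (nu : lform A m) : Prop :=
  smooth_form nu /\ forall x, exists v, nu x v != 0.

Definition orientable : Prop := exists nu, orientation_form nu.

(* Every point has a neighbourhood [U] over which each section of [A^*] is a
   [C^infty(U)]-linear combination of sections [d_A f]. *)
Definition locally_spanned_by_exact : Prop :=
  forall x : M, exists U : set M, [/\ open U, U x &
    forall phi : cosec A, smooth_cosec_on U phi ->
    exists (r : nat) (f g : 'I_r -> M -> R),
      [/\ forall j, smooth (f j), forall j, smooth_on U (g j) &
        forall y, U y -> phi y = \sum_j g j y *: dfun (f j) y]].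

(* [Mt] is the multisection [M^nu_Pi] (with tilde) attached to [nu]. *)
Definition modular_multivec (p : nat) (Pi : multivec A (p + 1))
    (nu : lform A m) (Mt : multivec A p) : Prop :=
  smooth_multivec Mt /\
  forall f : 'I_p -> M -> R, (forall i, smooth (f i)) ->
  forall x v,
    lie_form (sharp Pi (fun y => wedge_cov (fun i => dfun (f i) y))) nu v =
    Mt x (fun i => dfun (f i) x) * nu x v.

(** * The Leibniz algebroid of a Nambu structure *)

Section NambuLeibniz.
Context (p : nat) (Pi : multivec A (p + 1)).

Definition nambu_bracket (alpha beta : lform A p) : lform A p :=
  fun x v => lie_form (sharp Pi alpha) beta v -
             interior_form (sharp Pi beta) (dform alpha) v.

(* [C^k] consists of the [phi] satisfying [is_cochain]; only the values on
   smooth forms are meaningful. *)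
Definition leibniz_map (k : nat) : Type := ('I_k -> lform A p) -> M -> R.

Definition is_cochain (k : nat) (phi : leibniz_map k) : Prop :=
  (forall alpha : 'I_k -> lform A p, (forall i, smooth_form (alpha i)) ->
     smooth (phi alpha)) /\
  (forall (i : 'I_k) (alpha : 'I_k -> lform A p) (c : R) (beta gamma : lform A p),
     (forall j, smooth_form (alpha j)) -> smooth_form beta ->
     smooth_form gamma -> forall x,
     phi [eta alpha with i |-> fun y v => c * beta y v + gamma y v] x =
     c * phi [eta alpha with i |-> beta] x +
     phi [eta alpha with i |-> gamma] x).

Definition d_leibniz (k : nat) (phi : leibniz_map k) : leibniz_map k.+1 :=
  leibniz_diff (fun alpha => along (sharp Pi alpha)) nambu_bracket phi.

Definition is_cocycle (k : nat) (phi : leibniz_map k) : Prop :=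
  is_cochain phi /\
  forall alpha : 'I_k.+1 -> lform A p, (forall i, smooth_form (alpha i)) ->
  forall x, d_leibniz phi alpha x = 0.

(* The class of a cocycle in [HL^(k+1)], as a coset of the coboundaries. *)
Definition coh_class (k : nat) (phi : leibniz_map k.+1) :
    set (leibniz_map k.+1) :=
  [set psi | is_cocycle psi /\
     exists2 theta : leibniz_map k, is_cochain theta &
       forall alpha : 'I_k.+1 -> lform A p, (forall i, smooth_form (alpha i)) ->
       forall x, psi alpha x - phi alpha x = d_leibniz theta alpha x].

End NambuLeibniz.

(* [alpha |-> iota_alpha Mt], as a [1]-cochain. *)
Definition modular_cochain (p : nat) (Mt : multivec A p) : leibniz_map p 1 :=
  fun alpha x => pairing (alpha ord0 x) (Mt x).

End Calculus.

(* Main.v *)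
(** Write [X_f = Pi (d f_1 /\ .. /\ d f_p)], [{f, u} = X_f u], and [mu f] for
    the divergence of [X_f] with respect to [nu].

    Existence: for an arbitrary [p]-form [alpha] consider the function
    [div (Pi alpha) - (-1)^p <d alpha, Pi>]. Its second term compensates the
    derivative in [div (h X) = h div X + X h], so that its value on
    [h d f_1 /\ .. /\ d f_p] is [h (mu f)]. As the forms
    [h d f_1 /\ .. /\ d f_p] span locally, the function is linear over the
    smooth functions and hence given by a multisection.

    Cocycle: it suffices to treat [alpha = h d f_1 /\ .. /\ d f_p] and
    [beta = k d g_1 /\ .. /\ d g_p], for which everything reduces to
      [X_f (mu g) - X_g (mu f) = \sum_j mu (g[j := {f, g_j}])] and
      [\sum_j {f, g_j} mu (g[j := h]) + \sum_j {g, f_j} mu (f[j := h]) = 0].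
    These are the divergences of
      [[X_f, X_g] = \sum_j X_(g[j := {f, g_j}])] and
      [\sum_j {f, g_j} X_(g[j := h]) + \sum_j {g, f_j} X_(f[j := h]) = 0],
    that is, of the Nambu condition for [alpha = d f_1 /\ .. /\ d f_p] and of
    its part that contains derivatives of [h].

    If [nu' = q nu], then the divergences differ by [X (ln |q|)]. *)

From HB Require Import structures.
Require Import Defs.
From mathcomp Require Import all_boot all_order all_algebra all_fingroup.
From mathcomp Require Import boolp classical_sets functions.
From mathcomp Require Import reals topology normedtype landau sequences derive
    realfun exp.
From mathcomp Require Import ring lra.

Set Implicit Arguments.
Unset Strict Implicit.
Unset Printing Implicit Defensive.

Import Order.TTheory GRing.Theory Num.Theory.
Import numFieldNormedType.Exports.

Local Open Scope classical_set_scope.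
Local Open Scope ring_scope.

(** * Smooth functions on open subsets of R^d *)

(** Spanning by exact sections is only a local hypothesis, whereas [dform], [lie_form] and
    [schouten] are defined through global extensions, and tangent vectors are abstract derivations
    of global functions. Bump functions bridge the gap: they show that derivations, brackets and the
    operators on forms see only germs. Hence [form_ind]: a statement at a point that is additive in
    a form and depends only on its germ may be checked on [h df_1 /\ .. /\ df_k]. A representation
    by such forms is not unique, so nothing can be defined through it; this is why the multisection
    is extracted from a function that makes sense on every form. Spanning also makes the anchor
    injective: a vector is determined by the derivatives of functions along it. This turns the Nambu
    condition, tested on functions, into identities between sections, whose divergence can then be
    taken. Derivations come without a chain rule; the derivative of the logarithm has to be won from
    the product rule and a power series. *)

Section CkCalculus.
Context (R : realType) (d : nat).
Implicit Types (U V : set 'rV[R]_d) (f g : 'rV[R]_d -> R) (k : nat).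

Lemma Ck_on_sub k U V f : V `<=` U -> Ck_on k U f -> Ck_on k V f.
Proof.
elim: k f => [|k IH] f VU /=; first by move=> Uf x /VU /Uf.
by case=> Uf Uf'; split=> [x /VU Ux|v]; [exact: Uf|exact: IH].
Qed.

Lemma Ck_onW k U f : Ck_on k.+1 U f -> Ck_on k U f.
Proof.
elim: k f => [|k IH] f.
  by case=> Uf _ x /Uf; exact: differentiable_continuous.
by case=> Uf Uf'; split=> // v; apply: IH.
Qed.

(** [Ck_on] asks for continuity and differentiability in the ambient space at each single point, so
    a covering by arbitrary sets suffices. *)
Lemma Ck_on_local k U f :
  (forall x, U x -> exists2 W, W x & Ck_on k W f) -> Ck_on k U f.
Proof.
elim: k f => [|k IH] f Wf.
  by move=> x /Wf [W Wx]; apply.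
split=> [x /Wf[W Wx [Wdf _]]|v]; first exact: Wdf.
by apply: IH => x /Wf[W Wx [_ Wf']]; exists W; last exact: Wf'.
Qed.

(** The difference [g - f] vanishes near [x], so it is its value at [x] plus the zero map plus a
    little-o; by uniqueness of the differential it is differentiable, and [g] is the sum of it and
    [f]. *)
Lemma near_eq_differentiable f g x :
  {near x, f =1 g} -> differentiable f x -> differentiable g x.
Proof.
move=> fg fx.
suff hd : differentiable (g - f) x.
  by rewrite -[g](subrK f); exact: differentiableD.
have z y : f y = g y -> (g - f) y = 0 by move=> fgy; rewrite !fctE fgy subrr.
have h0 : (g - f) \o shift x = cst ((g - f) x) + \0 +o_ (0 : 'rV[R]_d) id.
  apply/eqaddoE; rewrite addr0 (z x (nbhs_singleton fg)).
  rewrite -[LHS]add0r; congr (_ + _).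
  apply/eqoP => e e0.
  have : \forall y \near (0 : 'rV[R]_d), f (y + x) = g (y + x).
    by rewrite (near_shift x) /=; apply: filterS fg => y; rewrite /= sub0r subrK.
  apply: (@filterS _ (nbhs (0 : 'rV[R]_d))) => y /= /z ->.
  by rewrite normr0 mulr_ge0 // ltW.
have [c0 _] := dcst (0 : R) x.
by apply/diff_locallyP; rewrite (diff_unique c0 h0).
Unshelve. all: by end_near. Qed.

Lemma Ck_on_eq k U f g : open U -> (forall x, U x -> f x = g x) ->
  Ck_on k U f -> Ck_on k U g.
Proof.
move=> oU; elim: k f g => [|k IH] f g fg.
  move=> Uf x Ux; rewrite /prop_for /continuous_at -(fg x Ux).
  apply: cvg_trans (Uf x Ux); apply: (@near_eq_cvg _ _ (nbhs x)).
  by apply: (@filterS _ (nbhs x) _ U) => //; exact: open_nbhs_nbhs.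
have fgn x : U x -> \near x, f x = g x.
  by move=> Ux; apply: (@filterS _ (nbhs x) _ U) => //; exact: open_nbhs_nbhs.
case=> Uf Uf'; split=> [x Ux|v].
  exact: near_eq_differentiable (fgn x Ux) (Uf x Ux).
by apply: IH (Uf' v) => x /fgn fgx; exact: near_eq_derive.
Qed.

Lemma Ck_on_cst k U (c : R) : Ck_on k U (fun=> c).
Proof.
elim: k c => [|k IH] c /=; first by move=> x _; apply: cst_continuous.
split=> [x _|v]; first apply: differentiable_cst.
have -> : (fun x => 'D_v (fun=> c) x) = (fun=> 0 : R); last exact: IH.
by apply: funext => x; exact: derive_cst.
Qed.

Lemma Ck_onD k U f g : open U ->
  Ck_on k U f -> Ck_on k U g -> Ck_on k U (fun x => f x + g x).
Proof.
move=> oU; elim: k f g => [|k IH] f g.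
  by move=> Uf Ug x Ux; exact: (continuousD (Uf x Ux) (Ug x Ux)).
move=> [Uf Uf'] [Ug Ug']; split=> [x Ux|v].
  by exact: (differentiableD (Uf x Ux) (Ug x Ux)).
apply: Ck_on_eq oU _ (IH _ _ (Uf' v) (Ug' v)) => x Ux.
by rewrite (deriveD (diff_derivable (Uf x Ux)) (diff_derivable (Ug x Ux))).
Qed.

Lemma Ck_onM k U f g : open U ->
  Ck_on k U f -> Ck_on k U g -> Ck_on k U (fun x => f x * g x).
Proof.
move=> oU; elim: k f g => [|k IH] f g.
  by move=> Uf Ug x Ux; exact: (continuousM (Uf x Ux) (Ug x Ux)).
move=> Ukf Ukg; have [Uf Uf'] := Ukf; have [Ug Ug'] := Ukg.
split=> [x Ux|v].
  by exact: (differentiableM (Uf x Ux) (Ug x Ux)).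
apply: Ck_on_eq oU _ (Ck_onD oU (IH _ _ (Ck_onW Ukf) (Ug' v)) (IH _ _ (Ck_onW Ukg)
    (Uf' v))) => x Ux.
by rewrite (deriveM (diff_derivable (Uf x Ux)) (diff_derivable (Ug x Ux))).
Qed.

Lemma derive_comp1 (phi : R -> R) (dphi : R) f x v :
  differentiable f x -> is_derive (f x) 1 phi dphi ->
  differentiable (phi \o f) x /\ 'D_v (phi \o f) x = dphi * 'D_v f x.
Proof.
move=> fx [phifx <-].
have phid : differentiable phi (f x) by apply/derivable1_diffP.
have cd : differentiable (phi \o f) x by apply: differentiable_comp.
split=> //; rewrite !deriveE // diff_comp //=.
by rewrite -[X in 'd phi _ X]mulr1 -[_ * 1]/(_ *: _) linearZ /= mulrC.
Qed.

(* A set of functions closed under differentiation on [I] consists of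
   functions that are smooth on [I]. *)
Lemma Ck_on_comp (S : set (R -> R)) (I : set R) k U f :
  open U ->
  (forall phi, S phi -> exists2 dphi, S dphi &
     forall t, I t -> is_derive t 1 phi (dphi t)) ->
  (forall x, U x -> I (f x)) -> Ck_on k U f ->
  forall phi, S phi -> Ck_on k U (phi \o f).
Proof.
move=> oU clS UI; elim: k => [|k IH] Uf phi Sphi.
  have [dphi _ phid] := clS _ Sphi.
  move=> x Ux; apply: continuous_comp; first exact: Uf.
  have [+ _] := phid _ (UI _ Ux).
  by move/derivable1_diffP/differentiable_continuous.
have [dphi Sdphi phid] := clS _ Sphi.
have [Df Df'] := Uf; split=> [x Ux|v].
  by have [] := derive_comp1 0 (Df x Ux) (phid _ (UI _ Ux)).
apply: Ck_on_eq oU _ (Ck_onM oU (IH (Ck_onW Uf) _ Sdphi) (Df' v)) => x Ux.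
by have [_ ->] := derive_comp1 v (Df x Ux) (phid _ (UI _ Ux)).
Qed.

End CkCalculus.

(** * Functions flat at 0 *)

Section Flat.
Context (R : realType).
Implicit Types (P : {poly R}) (t u : R).

(** For [u > 1] the power only grows when its exponent is raised by one, and the exponential series
    dominates [u^(n+1) / (n+1)!]; for [u <= 1] the left side is at most 1. *)
Lemma exprn_le_expR n u : 0 < u -> u ^+ n <= n.+1`!%:R * 2 * expR u.
Proof.
move=> u0; have f1 : 1 <= n.+1`!%:R :> R by rewrite ler1n fact_gt0.
have f0 : 0 < n.+1`!%:R :> R by rewrite ltr0n fact_gt0.
have [u1|u1] := leP u 1.
  rewrite (@le_trans _ _ 1) ?exprn_ile1 ?(ltW u0) //.
  have := expR_ge1Dx u; set e := expR u => e1.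
  have : 1 * 1 <= n.+1`!%:R * e by apply: ler_pM => //; lra.
  nra.
apply: (@le_trans _ _ (u ^+ n.+1)); first by rewrite ler_weXn2l // ltW.
have := expR_ge1Dxn n (ltW u0).
rewrite -lerBrDl ler_pdivrMr // => /le_trans; apply.
have := expR_ge0 u; nra.
Qed.

Lemma poly_expR_bounded P :
  exists2 C, 0 <= C & forall u, 0 < u -> `|P.[u]| * expR (- u) <= C.
Proof.
exists (\sum_(i < size P) `|P`_i| * (i.+1`!%:R * 2)) => [|u u0].
  by apply: sumr_ge0 => i _; rewrite !mulr_ge0.
rewrite expRN ler_pdivrMr ?expR_gt0 // horner_coef mulr_suml.
apply: le_trans (ler_norm_sum _ _ _) _; apply: ler_sum => i _.
rewrite normrM -mulrA ler_wpM2l // ger0_norm ?exprn_ge0 ?(ltW u0) //.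
exact: exprn_le_expR.
Qed.

Definition flat P t : R := if 0 < t then P.[t^-1] * expR (- t^-1) else 0.

Lemma flat_bounded P : exists2 C, 0 <= C & forall t, `|flat P t| <= C * `|t|.
Proof.
(* The extra factor ['X] becomes [t^-1], which yields the factor [|t|] of the bound. *)
have [C C0 PC] := poly_expR_bounded ('X * P).
exists C => // t; rewrite /flat; case: ltP => [t0|_]; last first.
  by rewrite normr0 mulr_ge0.
have ti0 : 0 < t^-1 by rewrite invr_gt0.
have := PC _ ti0; rewrite hornerM hornerX !normrM (gtr0_norm ti0) (gtr0_norm t0).
rewrite (gtr0_norm (expR_gt0 _)) => /(ler_wpM2r (ltW t0)); apply: le_trans.
by rewrite le_eqVlt; apply/orP; left; apply/eqP; field; rewrite gt_eqF.
Qed.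

Lemma flat_cvg0 P : flat P t @[t --> (0 : R)^'] --> (0 : R).
Proof.
have [C C0 PC] := flat_bounded P.
apply: (@cvg_within_filter _ _ _ (nbhs (0 : R))).
apply/cvgrPdist_le => e e0; near=> t.
rewrite sub0r normrN (le_trans (PC t)) // (@le_trans _ _ ((C + 1) * `|t|)) //.
  by rewrite ler_wpM2r // lerDl.
rewrite -ler_pdivlMl; last by rewrite ltr_wpDl.
near: t; apply: (@nbhs0_le _ R^o); rewrite mulr_gt0 // invr_gt0 ltr_wpDl //.
Unshelve. all: by end_near. Qed.

(** With [s = 1/t], the derivative of [P(s) e^(-s)] in [t] is [s^2 (P(s) - P'(s)) e^(-s)]. *)
Definition dflat P : {poly R} := 'X ^+ 2 * (P - P^`()).

Lemma is_derive_flat P t : is_derive t 1 (flat P) (flat (dflat P) t).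
Proof.
have [t0|t0|->] := ltgtP t 0.
- have -> : flat (dflat P) t = 0 by rewrite /flat ltNge ltW.
  have dc : is_derive t (1 : R) (cst 0 : R -> R) 0 by exact: is_derive_cst.
  apply: (near_eq_is_derive _ dc).
  near=> y; rewrite /flat ltNge ltW //=; near: y.
  exact: lt_nbhsl.
- have tV : t != 0 by rewrite gt_eqF.
  have dV : is_derive t 1 (fun y : R => y^-1) (- t ^- 2).
    apply: is_derive_eq; first exact: is_deriveV.
    by rewrite /GRing.scale /= mulr1.
  have dP := is_derive1_comp (is_derive_poly P t^-1) dV.
  have dN : is_derive t 1 (fun y : R => - y^-1) (t ^- 2).
    by apply: is_derive_eq; rewrite opprK.
  have dE := @is_derive1_comp _ expR (fun y => - y^-1) t _ _ (is_derive_expR _) dN.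
  have dM := is_deriveM dP dE.
  apply: (@near_eq_is_derive _ _ _ ((horner P \o (fun y => y^-1)) * (expR \o (fun y
      => - y^-1)))).
    by near=> y; rewrite /flat ifT //; near: y; exact: lt_nbhsr.
  apply: is_derive_eq.
  rewrite /flat t0 /dflat /GRing.scale /= hornerM hornerXn hornerD hornerN; field.
  exact: tV.
- have f0 : flat (dflat P) 0 = 0 by rewrite /flat ltxx.
  have f00 : flat P 0 = 0 by rewrite /flat ltxx.
  (* At 0 the difference quotient of [flat P] is again a flat function, for the polynomial ['X * P],
     so it tends to 0. *)
  have E : (fun h : R => h^-1 *: (flat P (h *: 1 + 0) - flat P 0)) = flat ('X * P).
    apply: funext => h; rewrite f00 subr0 addr0 /flat /GRing.scale /= mulr1.
    case: ltP => _; last by rewrite mulr0.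
    by rewrite hornerM hornerX mulrA.
  have cv := flat_cvg0 ('X * P); rewrite -E in cv.
  by apply: DeriveDef; [apply/cvg_ex; exists 0|rewrite f0; exact: cvg_lim].
Unshelve. all: by end_near. Qed.

End Flat.

(** * Entire power series with coefficients of order 1/n! *)

Section Entire.
Context (R : realType).
Implicit Types (c : nat -> R) (t : R).

(** This bound forces convergence on the whole line and is inherited by the termwise derivative, so
    the sums of such series form a family closed under differentiation. *)
Definition exp_bounded c := exists C, forall n, `|c n| * n`!%:R <= C.

Lemma exp_bounded_diffs c : exp_bounded c -> exp_bounded (pseries_diffs c).
Proof.
case=> C cC; exists C => n; rewrite /pseries_diffs normrM ger0_norm //.
have -> : n.+1%:R * `|c n.+1| * n`!%:R = `|c n.+1| * n.+1`!%:R; last exact: cC.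
by rewrite factS natrM; ring.
Qed.

Lemma cvg_pseries_exp_bounded c t : exp_bounded c -> cvgn (pseries c t).
Proof.
case=> C cC; have C0 : 0 <= C by apply: le_trans (cC 0%N); rewrite mulr_ge0.
apply: normed_cvg.
apply: (@series_le_cvg _ _ (fun n => C * exp_coeff `|t| n)) => [n|n|n|] //=.
- by rewrite mulr_ge0 // divr_ge0 // exprn_ge0.
- have f0 : 0 < n`!%:R :> R by rewrite ltr0n fact_gt0.
  rewrite /exp_coeff /= normrM normrX mulrCA mulrC ler_wpM2l ?exprn_ge0 //.
  by rewrite ler_pdivlMr.
- have -> : (fun n => C * exp_coeff `|t| n) = C *: exp_coeff `|t| by [].
  exact: is_cvg_seriesZ (is_cvg_series_exp_coeff _).
Qed.

Lemma is_derive_exp_bounded c t : exp_bounded c ->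
  is_derive t 1 (fun x => limn (pseries c x)) (limn (pseries (pseries_diffs c) t)).
Proof.
move=> cb; have db := exp_bounded_diffs cb.
apply: (@pseries_snd_diffs _ _ (`|t| + 1)).
- exact: cvg_pseries_exp_bounded.
- exact: cvg_pseries_exp_bounded.
- exact/cvg_pseries_exp_bounded/exp_bounded_diffs.
- by rewrite (ger0_norm (_ : 0 <= `|t| + 1)) ?ltrDl ?addr_ge0.
Qed.

(** Taylor coefficients of [(e^t - 1) / t], with the singularity at 0 removed. *)
Definition expm1_coeff n : R := (n.+1`!%:R)^-1.

Lemma exp_bounded_expm1 : exp_bounded expm1_coeff.
Proof.
exists 1 => n; rewrite /expm1_coeff ger0_norm ?invr_ge0 //.
by rewrite mulrC ler_pdivrMr ?ltr0n ?fact_gt0 // mul1r ler_nat leq_fact.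
Qed.

Lemma expm1_coeffE t : t * limn (pseries expm1_coeff t) = expR t - 1.
Proof.
have c1 := cvg_pseries_exp_bounded (t := t) exp_bounded_expm1.
have c2 : series (exp_coeff t) n.+1 @[n --> \oo] --> expR t.
  by rewrite (cvg_shiftS (series (exp_coeff t))); exact: is_cvg_series_exp_coeff.
have c3 : t * pseries expm1_coeff t n @[n --> \oo] --> expR t - 1.
  have -> : (fun n => t * pseries expm1_coeff t n) =
            (fun n => series (exp_coeff t) n.+1 - 1).
    apply: funext => n; rewrite /pseries /series /= big_nat_recl //= /exp_coeff /=.
    rewrite expr0 fact0 divr1 [1 + _]addrC addrK mulr_sumr; apply: eq_bigr => i _.
    by rewrite /expm1_coeff exprS mulrCA mulrC -mulrA.
  by apply: cvgB c2 _; exact: cvg_cst.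
by rewrite -(cvg_lim _ c3) //; apply/esym/cvg_lim => //; exact: cvgMl_tmp.
Qed.

Lemma expm1_coeff0 : limn (pseries expm1_coeff 0) = 1.
Proof.
apply: cvg_lim => //; rewrite -(cvg_shiftS _).
have -> : (fun n => pseries expm1_coeff 0 n.+1) = (fun=> 1); last exact: cvg_cst.
apply: funext => n; rewrite /pseries /series /= big_nat_recl //= expr0 mulr1.
rewrite big1 ?addr0 /expm1_coeff ?invr1 // => i _.
by rewrite exprS mul0r mulr0.
Qed.

End Entire.

(** * Smooth functions on a manifold *)

Lemma is_derive_invX (R : realType) (c t : R) n : t != 0 ->
  is_derive t 1 (fun s => c * s ^- n) ((- c * n%:R) * t ^- n.+1).
Proof.
move=> t0; pose f (s : R) := s ^+ n; have tn : f t != 0 by rewrite expf_neq0.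
have df : derivable f t 1 by exact: exprn_derivable.
have Df : 'D_1 f t = n%:R * t ^+ n.-1.
  by rewrite exp_derive /GRing.scale /= mulr1.
have -> : (fun s => c * s ^- n) = c *: (fun s : R => (f s)^-1) by [].
apply: DeriveDef; first exact/derivableZ/derivableV.
rewrite deriveZ ?deriveV ?Df; [|by []..|exact: derivableV].
rewrite /f /GRing.scale /=; case: n {f tn df Df} => [|n].
  by rewrite !mulr0 !mul0r ?mulr0.
have u0 : t ^+ n != 0 by rewrite expf_neq0.
by rewrite (exprS t n.+1) (exprS t n); field; apply/andP.
Qed.

Lemma open_neq0 (R : realType) : open [set t : R | t != 0].
Proof.
have -> : [set t : R | t != 0] = ~` [set (0 : R)] by apply/seteqP; split=> t /= /eqP.
exact/closed_openC/closed_eq.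
Qed.

Section SmoothAt.
Context (R : realType) (d : nat) (M : manifold R d).
Implicit Types (U V W : set M) (f g : M -> R) (x y : M).

Lemma chart_image_open (i : chart_index M) U :
  open U -> open (chart i @` (chart_dom i `&` U)).
Proof.
move=> oU; rewrite openE => _ [x [ix Ux] <-].
have ox : nbhs (chart i x) (chart i @` chart_dom i).
  by apply: open_nbhs_nbhs; split; [exact: chart_img_open|exists x].
have cx := chart_inv_continuous (ex_intro2 _ _ x ix erefl).
have Ui : nbhs (chart_inv i (chart i x)) U.
  by rewrite (chartK ix); exact: open_nbhs_nbhs.
apply: filterS (filterI ox (cx _ Ui)) => _ [[y iy <-]] /=.
by rewrite (chartK iy) => Uy; exists y.
Qed.

Lemma smooth_on_sub U V f : V `<=` U -> smooth_on U f -> smooth_on V f.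
Proof.
move=> VU Uf i k; apply: Ck_on_sub (Uf i k) => _ [x [ix Vx] <-].
by exists x => //; split=> //; exact: VU.
Qed.

Lemma smooth_on_local U f :
  (forall x, U x -> exists2 W, W x & smooth_on W f) -> smooth_on U f.
Proof.
move=> Wf i k; apply: Ck_on_local => _ [x [ix Ux] <-].
have [W Wx fW] := Wf x Ux.
by exists (chart i @` (chart_dom i `&` W)); [exists x|exact: fW].
Qed.

(** Smoothness of the germ at [x]. Charts and frames are controlled only near a point, so the
    closure rules are proved in this form first. *)
Definition smooth_at x f := exists2 W, open_nbhs x W & smooth_on W f.

Lemma smooth_onP U f : open U ->
  (smooth_on U f <-> forall x, U x -> smooth_at x f).
Proof.
move=> oU; split=> [Uf x Ux|Uf]; first by exists U.
by apply: smooth_on_local => x /Uf[W [oW Wx] fW]; exists W.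
Qed.

Lemma smoothP f : smooth f <-> forall x, smooth_at x f.
Proof.
split=> [/(smooth_onP _ openT) fx x|fx]; first exact: fx.
by apply/(smooth_onP _ openT) => x _.
Qed.

Lemma smooth_on_eq U f g : open U -> (forall x, U x -> f x = g x) ->
  smooth_on U f -> smooth_on U g.
Proof.
move=> oU fg Uf i k; apply: Ck_on_eq (Uf i k); first exact: chart_image_open.
by move=> _ [x [ix Ux] <-]; rewrite (chartK ix) fg.
Qed.

Lemma smooth_at_eq x f g : (\near x, f x = g x) -> smooth_at x f -> smooth_at x g.
Proof.
rewrite /prop_near1 nbhsE => -[V [oV Vx] fg] [W [oW Wx] fW].
exists (W `&` V); first by split=> //; exact: openI.
apply: (@smooth_on_eq _ f) => [|y [_ /fg]//|]; first exact: openI.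
by apply: smooth_on_sub fW => y [].
Qed.

Lemma smooth_at_cst x (c : R) : smooth_at x (fun=> c).
Proof.
by exists setT => [|i k]; [split=> //; exact: openT|exact: Ck_on_cst].
Qed.

Lemma smooth_atI x f g : smooth_at x f -> smooth_at x g ->
  exists2 W, open_nbhs x W & smooth_on W f /\ smooth_on W g.
Proof.
case=> [W [oW Wx] fW] [V [oV Vx] fV]; exists (W `&` V).
  by split=> //; exact: openI.
by split; [apply: smooth_on_sub fW|apply: smooth_on_sub fV] => y [].
Qed.

Lemma smooth_atD x f g :
  smooth_at x f -> smooth_at x g -> smooth_at x (fun y => f y + g y).
Proof.
move=> fx gx; have [W oW [fW gW]] := smooth_atI fx gx; exists W => // i k.
by apply: Ck_onD; [exact/chart_image_open/oW.1|exact: fW|exact: gW].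
Qed.

Lemma smooth_atM x f g :
  smooth_at x f -> smooth_at x g -> smooth_at x (fun y => f y * g y).
Proof.
move=> fx gx; have [W oW [fW gW]] := smooth_atI fx gx; exists W => // i k.
by apply: Ck_onM; [exact/chart_image_open/oW.1|exact: fW|exact: gW].
Qed.

Lemma smooth_atZ x c f : smooth_at x f -> smooth_at x (fun y => c * f y).
Proof. exact: smooth_atM (smooth_at_cst _ _). Qed.

Lemma smooth_atN x f : smooth_at x f -> smooth_at x (fun y => - f y).
Proof.
move=> fx; rewrite (_ : (fun y => _) = fun y => -1 * f y); first exact: smooth_atZ.
by apply: funext => y; rewrite mulN1r.
Qed.

Lemma smooth_atB x f g :
  smooth_at x f -> smooth_at x g -> smooth_at x (fun y => f y - g y).
Proof. by move=> fx gx; exact: smooth_atD fx (smooth_atN gx). Qed.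

Lemma smooth_at_sum x (I : Type) (r : seq I) (P : pred I) (f : I -> M -> R) :
  (forall i, P i -> smooth_at x (f i)) ->
  smooth_at x (fun y => \sum_(i <- r | P i) f i y).
Proof.
move=> fx; elim: r => [|i r IH].
  by apply: smooth_at_eq (smooth_at_cst x 0); near=> y; rewrite big_nil.
case Pi : (P i); last by apply: smooth_at_eq IH; near=> y; rewrite big_cons Pi.
apply: smooth_at_eq (smooth_atD (fx i Pi) IH).
by near=> y; rewrite big_cons Pi.
Unshelve. all: by end_near. Qed.

Lemma smooth_at_prod x (I : Type) (r : seq I) (P : pred I) (f : I -> M -> R) :
  (forall i, P i -> smooth_at x (f i)) ->
  smooth_at x (fun y => \prod_(i <- r | P i) f i y).
Proof.
move=> fx; elim: r => [|i r IH].
  by apply: smooth_at_eq (smooth_at_cst x 1); near=> y; rewrite big_nil.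
case Pi : (P i); last by apply: smooth_at_eq IH; near=> y; rewrite big_cons Pi.
apply: smooth_at_eq (smooth_atM (fx i Pi) IH).
by near=> y; rewrite big_cons Pi.
Unshelve. all: by end_near. Qed.

Lemma smooth_at_continuous x f : smooth_at x f -> {for x, continuous f}.
Proof.
case=> W [oW Wx] fW; have [i ix] := chart_cover x.
have xi : (chart i @` (chart_dom i `&` W)) (chart i x) by exists x.
have c1 : {for chart i x, continuous (fun y : 'rV[R]_d => f (chart_inv i y))}.
  exact: (fW i 0%N _ xi).
have c2 : {for x, continuous ((fun y : 'rV[R]_d => f (chart_inv i y)) \o chart i)}.
  by apply: continuous_comp c1; exact: chart_continuous.
rewrite /prop_for /continuous_at -[in f x](chartK ix).
apply: cvg_trans c2; apply: (@near_eq_cvg _ _ (nbhs x)).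
apply: (@filterS _ (nbhs x) _ (chart_dom i)) => [y iy /=|].
  by rewrite (chartK iy).
by apply: open_nbhs_nbhs; split=> //; exact: chart_dom_open.
Qed.

(** The manifold version of [Ck_on_comp]; continuity of [f] keeps its values in the open set [I]
    near [x]. *)
Lemma smooth_at_comp (S : set (R -> R)) (I : set R) x f :
  open I ->
  (forall phi, S phi -> exists2 dphi, S dphi &
     forall t, I t -> is_derive t 1 phi (dphi t)) ->
  I (f x) -> smooth_at x f ->
  forall phi, S phi -> smooth_at x (fun y => phi (f y)).
Proof.
move=> oI clS Ifx fx phi Sphi; have [W [oW Wx] fW] := fx.
have : nbhs x (f @^-1` I).
  by apply: (smooth_at_continuous fx); exact: open_nbhs_nbhs.
rewrite nbhsE => -[V [oV Vx] VI].
exists (W `&` V) => [|i k]; first by split=> //; exact: openI.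
apply: (Ck_on_comp (S := S) (I := I)) => //.
- by apply: chart_image_open; exact: openI.
- by move=> _ [y [iy [_ Vy]] <-]; rewrite (chartK iy); exact: VI.
- exact: (smooth_on_sub (@subIsetl _ _ _) fW).
Qed.

Lemma smooth_atV x f : f x != 0 -> smooth_at x f -> smooth_at x (fun y => (f y)^-1).
Proof.
move=> fx0 fx.
(* The inverse alone is not closed under differentiation, but the family of all [c * t^-n] is; for
   the logarithm the same family is enlarged by [ln]. *)
apply: (@smooth_at_comp [set phi | exists (c : R) n, phi = fun t => c * t ^- n] [set
    t | t != 0] x f _ _ fx0 fx).
- exact: open_neq0.
- move=> _ [c [n ->]]; exists (fun t => (- c * n%:R) * t ^- n.+1).
    by exists (- c * n%:R), n.+1.
  by move=> t t0; exact: is_derive_invX.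
- by exists 1, 1%N; apply: funext => t; rewrite mul1r expr1.
Qed.

Lemma smooth_at_ln x f : 0 < f x -> smooth_at x f -> smooth_at x (fun y => ln (f y)).
Proof.
move=> fx0 fx.
apply: (@smooth_at_comp [set phi | phi = @ln R \/ exists (c : R) n, phi = fun t => c
    * t ^- n] [set t | 0 < t] x f _ _ fx0 fx); last by left.
- exact: open_gt.
- move=> _ [->|[c [n ->]]].
    exists (fun t => 1 * t ^- 1); first by right; exists 1, 1%N.
    by move=> t t0; rewrite mul1r expr1; exact: is_derive1_ln.
  exists (fun t => (- c * n%:R) * t ^- n.+1).
    by right; exists (- c * n%:R), n.+1.
  by move=> t t0; apply: is_derive_invX; rewrite gt_eqF.
Qed.

End SmoothAt.

(** * Bump functions *)

Section Bump.
Context (R : realType) (d : nat) (M : manifold R d).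
Implicit Types (U V W : set M) (f g : M -> R) (x y : M).

Definition flat_exp (t : R) := flat 1 t.

Lemma flat_exp_gt0 t : 0 < t -> 0 < flat_exp t.
Proof. by move=> t0; rewrite /flat_exp /flat t0 hornerC mul1r expR_gt0. Qed.

Lemma flat_exp_le0 t : t <= 0 -> flat_exp t = 0.
Proof. by move=> t0; rewrite /flat_exp /flat ltNge t0. Qed.

Lemma flat_exp_ge0 t : 0 <= flat_exp t.
Proof. by case: (leP t 0) => [/flat_exp_le0->//|/flat_exp_gt0/ltW]. Qed.

(** The standard smooth transition from 0 on [t <= 0] to 1 on [t >= 1]; the denominator is positive
    because [t] and [1 - t] are never both nonpositive. *)
Definition step (t : R) := flat_exp t / (flat_exp t + flat_exp (1 - t)).

Lemma step_den_gt0 t : 0 < flat_exp t + flat_exp (1 - t).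
Proof.
have [t0|t0] := leP t 0.
  by rewrite ltr_wpDl ?flat_exp_ge0 // flat_exp_gt0 //; lra.
by rewrite ltr_wpDr ?flat_exp_ge0 // flat_exp_gt0.
Qed.

Lemma step0 t : t <= 0 -> step t = 0.
Proof. by move=> t0; rewrite /step flat_exp_le0 // mul0r. Qed.

Lemma step1 t : 1 <= t -> step t = 1.
Proof.
move=> t1; have := step_den_gt0 t; rewrite /step (@flat_exp_le0 (1 - t)); last by lra.
by rewrite addr0 => /gt_eqF e0; rewrite divff ?e0.
Qed.

Lemma smooth_at_flat_exp x f : smooth_at x f -> smooth_at x (fun y => flat_exp (f y)).
Proof.
move=> fx.
apply: (@smooth_at_comp _ _ _ [set phi | exists P, phi = flat P] setT x f) => //.
- exact: openT.
- move=> _ [P ->]; exists (flat (dflat P)); first by exists (dflat P).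
  by move=> t _; exact: is_derive_flat.
- by exists 1.
Qed.

Lemma smooth_at_step x f : smooth_at x f -> smooth_at x (fun y => step (f y)).
Proof.
move=> fx; have f1 := smooth_at_flat_exp fx.
have f2 := smooth_at_flat_exp (smooth_atB (smooth_at_cst x 1) fx).
apply: smooth_atM => //; apply: smooth_atV; last exact: smooth_atD.
by rewrite gt_eqF ?step_den_gt0.
Qed.

(** For [r > 0], the argument [2 - 2 t / r] is at least 1 exactly when [t <= r / 2] and at most 0
    exactly when [t >= r]; the second factor is the mirror image. *)
Definition plateau (r t : R) := step (2 - 2 * t / r) * step (2 + 2 * t / r).

Lemma plateau1 (r t : R) : 0 < r -> `|t| <= r / 2 -> plateau r t = 1.
Proof.
move=> r0 tr; rewrite /plateau !step1 ?mul1r //.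
  have : - t / r <= 2^-1 by rewrite ler_pdivrMr //; have := ler_norm (- t); rewrite
      normrN; lra.
  lra.
have : t / r <= 2^-1 by rewrite ler_pdivrMr //; have := ler_norm t; lra.
lra.
Qed.

Lemma plateau0 (r t : R) : 0 < r -> r <= `|t| -> plateau r t = 0.
Proof.
move=> r0; rewrite /plateau; have [t0|t0] := ger0P t => tr.
  have t1 : 1 <= t / r by rewrite ler_pdivlMr ?mul1r.
  by rewrite (@step0 (2 - 2 * t / r)) ?mul0r //; lra.
have t1 : 1 <= - t / r by rewrite ler_pdivlMr ?mul1r.
by rewrite (@step0 (2 + 2 * t / r)) ?mulr0 //; lra.
Qed.

Lemma smooth_at_plateau r x f : smooth_at x f -> smooth_at x (fun y => plateau r (f y)).
Proof.
move=> fx; have gx : smooth_at x (fun y => 2 * f y / r).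
  exact: smooth_atM (smooth_atZ _ fx) (smooth_at_cst _ _).
apply: smooth_atM; apply: smooth_at_step.
  exact: smooth_atB (smooth_at_cst _ _) gx.
exact: smooth_atD (smooth_at_cst _ _) gx.
Qed.

Lemma smooth_at_chart (i : chart_index M) x a : chart_dom i x ->
  smooth_at x (fun y => chart i y ord0 a).
Proof.
move=> ix; exists (chart_dom i); first by split=> //; exact: chart_dom_open.
by move=> j; exact: chart_transition.
Qed.

(** The last clause puts the support of [b] inside [U], so that [b] times a function smooth only on
    [U] is globally smooth. The support is confined to the image [K] of a closed cube under an
    inverse chart: [K] is compact, hence closed because the manifold is Hausdorff. *)
Lemma exists_bump x U : open U -> U x -> exists b : M -> R,
  [/\ smooth b, (\near x, b x = 1) & forall y, ~ U y -> \near y, b y = 0].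
Proof.
move=> oU Ux; have [i ix] := chart_cover x.
have o1 : open (chart i @` (chart_dom i `&` U)) by exact: chart_image_open.
have : nbhs (chart i x) (chart i @` (chart_dom i `&` U)).
  by apply: open_nbhs_nbhs; split=> //; exists x.
move=> /nbhs_ballP [e /= e0 Be].
pose r := e / 2; have r0 : 0 < r by rewrite divr_gt0.
(* Half the radius keeps the closed cube inside the open ball; a cube fits the product of
   one-variable cutoffs [bf]. *)
pose B := [set z : 'rV[R]_d | forall a, `[chart i x ord0 a - r, chart i x ord0 a +
    r]%classic (z ord0 a)].
have {}Be z : B z -> (chart i @` (chart_dom i `&` U)) z.
  move=> Bz; apply: Be; split=> // k a; rewrite (ord1 k) /ball /=.
  have := Bz a; rewrite /= in_itv /= /r => /andP[z1 z2].
  by rewrite ltr_norml; apply/andP; split; lra.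
pose K := chart_inv i @` B.
have cK : closed K.
  apply: compact_closed; first exact: m_hausdorff.
  have cB : {in B, continuous (chart_inv i)}.
    move=> z /set_mem /Be [y [iy _] <-].
    by apply: chart_inv_continuous; exists y.
  apply: (continuous_compact (continuous_in_subspaceT cB)).
  apply: (@rV_compact R d (fun a => `[chart i x ord0 a - r, chart i x ord0 a +
      r]%classic)) => a.
  exact: segment_compact.
pose bf y := \prod_a plateau r (chart i y ord0 a - chart i x ord0 a).
pose b y := if pselect (chart_dom i y) then bf y else 0.
have b0 y : ~ K y -> b y = 0.
  move=> nKy; rewrite /b; case: pselect => // iy.
  have : ~ B (chart i y) by move=> By; apply: nKy; exists (chart i y) => //; rewrite
      (chartK iy).
  move=> /existsNP [a nBa]; rewrite /bf (bigD1 a) //= plateau0 ?mul0r //.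
  rewrite leNgt; apply/negP; rewrite ltr_norml => /andP[h1 h2]; apply: nBa.
  by rewrite /= in_itv /=; apply/andP; split; lra.
have KU y : K y -> U y /\ chart_dom i y.
  by case=> z /Be [y' [iy' Uy'] <-] <-; rewrite (chartK iy').
exists b; split.
(* Near a point of [K] the function is the coordinate product [bf]; near any other point it is 0, as
   the complement of [K] is open. *)
- apply/smoothP => y; have [Ky|nKy] := pselect (K y).
    have [_ iy] := KU y Ky.
    have py : smooth_at y bf.
      apply: smooth_at_prod => a _; apply: smooth_at_plateau.
      exact: smooth_atB (smooth_at_chart _ iy) (smooth_at_cst _ _).
    apply: smooth_at_eq py; apply: (@filterS _ (nbhs y) _ (chart_dom i)).
      by move=> z iz; rewrite /b; case: pselect.
    by apply: open_nbhs_nbhs; split=> //; exact: chart_dom_open.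
  apply: smooth_at_eq (smooth_at_cst _ 0).
  apply: (@filterS _ (nbhs y) _ (~` K)) => [z /b0 //|].
  by apply: open_nbhs_nbhs; split=> //; exact: closed_openC.
- have ir : nbhs x (chart i @^-1` (ball (chart i x) (r / 2))).
    apply: (chart_continuous ix); apply: nbhsx_ballx.
    by rewrite divr_gt0.
  have ox : nbhs x (chart_dom i).
    by apply: open_nbhs_nbhs; split=> //; exact: chart_dom_open.
  apply: (@filterS _ (nbhs x) _ _ _ _ (filterI ox ir)) => y [iy By].
  rewrite /b; case: pselect => // iy'; rewrite /bf big1 // => a _; apply: plateau1 =>
      //.
  have [_ /(_ ord0 a)] := By; rewrite /ball /= distrC => /ltW; exact.
- move=> y nUy; apply: (@filterS _ (nbhs y) _ (~` K)) => [z /b0 //|].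
  apply: open_nbhs_nbhs; split; first exact: closed_openC.
  by case/KU.
Qed.

End Bump.

(** * Multilinear algebra *)

Section Multilinear.
Context (R : realType) (V : vectType R).

Definition multilinear (k : nat) (f : kform V k) : Prop :=
  forall (i : 'I_k) (v : 'I_k -> V) (c : R) (u w : V),
     f [eta v with i |-> c *: u + w] =
     c * f [eta v with i |-> u] + f [eta v with i |-> w].

Lemma with_id (T : eqType) (U : Type) (v : T -> U) i : [eta v with i |-> v i] = v :>
    (T -> U).
Proof. by apply: funext => j /=; case: eqP => // ->. Qed.

Lemma with_same (T : eqType) (U : Type) (v : T -> U) i a b :
  [eta [eta v with i |-> a] with i |-> b] = [eta v with i |-> b] :> (T -> U).
Proof. by apply: funext => j /=; case: eqP. Qed.

Lemma withC (T : eqType) (U : Type) (v : T -> U) i j a b : i != j ->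
  [eta [eta v with i |-> a] with j |-> b] = [eta [eta v with j |-> b] with i |-> a]
      :> (T -> U).
Proof.
move=> ij; apply: funext => l /=; case: eqP => [->|//].
by case: eqP => // ji; rewrite ji eqxx in ij.
Qed.

Lemma multilinear0 k (f : kform V k) i v : multilinear f -> f [eta v with i |-> 0] = 0.
Proof.
move=> fl; have := fl i v 1 0 0; rewrite scale1r addr0 mul1r => /esym/eqP.
by rewrite -subr_eq0 addrK => /eqP.
Qed.

Lemma multilinearZ k (f : kform V k) i v c u : multilinear f ->
  f [eta v with i |-> c *: u] = c * f [eta v with i |-> u].
Proof. by move=> fl; have := fl i v c u 0; rewrite addr0 (multilinear0 _ _ fl) addr0.
    Qed.

Lemma multilinearD k (f : kform V k) i v u w : multilinear f ->
  f [eta v with i |-> u + w] = f [eta v with i |-> u] + f [eta v with i |-> w].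
Proof. by move=> fl; have := fl i v 1 u w; rewrite scale1r mul1r. Qed.

Lemma multilinearN k (f : kform V k) i v u : multilinear f ->
  f [eta v with i |-> - u] = - f [eta v with i |-> u].
Proof. by move=> fl; rewrite -scaleN1r multilinearZ // mulN1r. Qed.

Lemma multilinear_sum k (f : kform V k) i v (I : finType) (c : I -> R) (u : I -> V) :
  multilinear f ->
  f [eta v with i |-> \sum_a c a *: u a] = \sum_a c a * f [eta v with i |-> u a].
Proof.
move=> fl; elim/big_rec2: _ => [|a y1 y2 _ <-]; first exact: multilinear0.
by rewrite fl.
Qed.

(** Written with the same [unlift] as [interior], so that the two are convertible. *)
Definition fcons (U : Type) (k : nat) (u : U) (v : 'I_k -> U) : 'I_k.+1 -> U :=
  fun j => if unlift ord0 j is Some i then v i else u.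

Lemma fcons0 (U : Type) k (u : U) (v : 'I_k -> U) : fcons u v ord0 = u.
Proof. by rewrite /fcons unlift_none. Qed.

Lemma fconsS (U : Type) k (u : U) (v : 'I_k -> U) i : fcons u v (lift ord0 i) = v i.
Proof. by rewrite /fcons liftK. Qed.

Lemma fconsP (U : Type) k (v w : 'I_k.+1 -> U) : v ord0 = w ord0 ->
  (forall i, v (lift ord0 i) = w (lift ord0 i)) -> v = w.
Proof.
by move=> v0 vS; apply: funext => j; case: (unliftP ord0 j) => [i ->|->].
Qed.

Lemma fcons_with0 (U : Type) k (u w : U) (v : 'I_k -> U) :
  fcons w v = [eta fcons u v with ord0 |-> w].
Proof. by apply: fconsP => [|i] /=; rewrite ?fcons0 ?fconsS. Qed.

Lemma fcons_withS (U : Type) k (u w : U) (v : 'I_k -> U) i :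
  fcons u [eta v with i |-> w] = [eta fcons u v with lift ord0 i |-> w].
Proof.
by apply: fconsP => [|j] /=; rewrite ?fcons0 ?fconsS //= (inj_eq lift_inj).
Qed.

Lemma fcons_eta (U : Type) k (v : 'I_k.+1 -> U) : fcons (v ord0) (fun i => v (lift
    ord0 i)) = v.
Proof. by apply: fconsP => [|i] /=; rewrite ?fcons0 ?fconsS. Qed.

Lemma sum_ffunS (T : nmodType) (r k : nat) (F : {ffun 'I_k.+1 -> 'I_r} -> T) :
  \sum_J F J = \sum_a \sum_(J : {ffun 'I_k -> 'I_r}) F [ffun i => fcons a J i].
Proof.
rewrite pair_big /= (reindex (fun q : 'I_r * {ffun 'I_k -> 'I_r} => [ffun i => fcons
    q.1 q.2 i])) //=.
exists (fun J : {ffun 'I_k.+1 -> 'I_r} => (J ord0, [ffun i => J (lift ord0 i)])).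
  by move=> [a J] _; rewrite ffunE fcons0; congr pair; apply/ffunP => i; rewrite
      !ffunE fconsS.
move=> J _; apply/ffunP => i; rewrite ffunE /=.
by case: (unliftP ord0 i) => [j|] ->; rewrite ?fcons0 ?fconsS ?ffunE.
Qed.

Lemma multilinear_fcons k (f : kform V k.+1) u : multilinear f ->
  multilinear (fun v => f (fcons u v) : R).
Proof. by move=> fl i v c w w'; rewrite !fcons_withS fl. Qed.

Lemma multilinear_expand r k (f : kform V k) (c : 'I_k -> 'I_r -> R) (w : 'I_k ->
    'I_r -> V) :
  multilinear f ->
  f (fun i => \sum_a c i a *: w i a) =
  \sum_(J : {ffun 'I_k -> 'I_r}) (\prod_i c i (J i)) * f (fun i => w i (J i)).
Proof.
elim: k f c w => [|k IH] f c w fl.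
  rewrite (big_pred1 (ffun0 (card_ord 0))) => [|J].
    by rewrite big_ord0 mul1r; congr f; apply: funext => -[].
  by apply/esym/eqP/ffunP => -[].
rewrite sum_ffunS -(fcons_eta (fun i => _)) (fcons_with0 0).
rewrite (multilinear_sum _ _ _ _ fl); apply: eq_bigr => a _.
rewrite -fcons_with0 (IH _ _ _ (multilinear_fcons _ fl)) mulr_sumr.
apply: eq_bigr => J _; rewrite big_ord_recl ffunE fcons0 -mulrA; congr (_ * (_ * _)).
  by apply: eq_bigr => i _; rewrite ffunE fconsS.
by congr f; apply: fconsP => [|i]; rewrite ?fcons0 ?fconsS ffunE ?fcons0 ?fconsS.
Qed.

Lemma multilinear_ext k (f g : kform V k) : multilinear f -> multilinear g ->
  forall r (w : 'I_r -> V), (forall u, exists c : 'I_r -> R, u = \sum_a c a *: w a) ->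
  (forall J : 'I_k -> 'I_r, f (w \o J) = g (w \o J)) -> f = g.
Proof.
move=> fl gl r w ws fg; apply: funext => v.
have [c vc] := choice (fun i => ws (v i)).
have -> : v = fun i => \sum_a c i a *: w a by apply: funext.
by rewrite !multilinear_expand //; apply: eq_bigr => J _; rewrite [f _](fg J).
Qed.

(** Polarisation: the form vanishes with [v i + v j] in both slots. *)
Lemma alternating_swap k (f : kform V k) (v : 'I_k -> V) i j : alternating f ->
  i != j -> f (fun l => v (tperm i j l)) = - f v.
Proof.
move=> [fl fa] ij.
pose F a b := f [eta [eta v with i |-> a] with j |-> b].
have ji : j != i by rewrite eq_sym.
have F0 a : F a a = 0 by apply: (fa i j _ ij) => /=; rewrite eqxx (negbTE ij) eqxx.
have Fl a a' b : F (a + a') b = F a b + F a' b.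
  by rewrite /F !(withC _ _ _ ij) multilinearD.
have Fr a b b' : F a (b + b') = F a b + F a b' by rewrite /F multilinearD.
have -> : f v = F (v i) (v j) by rewrite /F with_id with_id.
have -> : f (fun l => v (tperm i j l)) = F (v j) (v i).
  rewrite /F; congr f; apply: funext => l /=.
  by case: tpermP => [->|->|/eqP/negbTE-> /eqP/negbTE->] //; rewrite eqxx ?(negbTE ij).
have := F0 (v i + v j); rewrite Fl !Fr !F0 add0r addr0 => /eqP.
by rewrite addrC addr_eq0 => /eqP.
Qed.

Lemma alternating_perm k (f : kform V k) (v : 'I_k -> V) (s : 'S_k) : alternating f ->
  f (fun l => v (s l)) = (-1) ^+ s * f v.
Proof.
move=> fa; have [ts -> tsd] := prod_tpermP s.
elim: ts v tsd => [|t ts IH] v /=.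
  by rewrite big_nil odd_perm1 mul1r => _; congr f; apply: funext => l; rewrite perm1.
case/andP=> td tsd; rewrite big_cons odd_mul_tperm signr_addb td /=.
rewrite -mulrA -(IH _ tsd) mulN1r -(alternating_swap _ fa td).
by congr f; apply: funext => l; rewrite permM.
Qed.

Lemma alternating_lin k (f : kform V k) : alternating f -> multilinear f.
Proof. by case. Qed.

Lemma alternating_reindex k k' (f : kform V k) (h : 'I_k -> 'I_k') (h' : 'I_k' ->
    'I_k) :
  cancel h h' -> cancel h' h -> alternating f -> alternating (fun v => f (v \o h) : R).
Proof.
move=> hK h'K [fl fa]; split=> [i v c u w|i j v ij vij].
  have E a : [eta v with i |-> a] \o h = [eta v \o h with h' i |-> a].
    by apply: funext => l /=; rewrite -(inj_eq (can_inj hK)) h'K.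
  by rewrite !E fl.
by apply: (fa (h' i) (h' j)); rewrite ?(inj_eq (can_inj h'K)) //= !h'K.
Qed.

Definition vcat (U : Type) p q (v : 'I_p -> U) (w : 'I_q -> U) (i : 'I_(p + q)) : U :=
  match fintype.split i with inl j => v j | inr j => w j end.

Lemma vcatl U p q (v : 'I_p -> U) (w : 'I_q -> U) i : vcat v w (lshift q i) = v i.
Proof. by rewrite /vcat (unsplitK (inl i)). Qed.

Lemma vcatr U p q (v : 'I_p -> U) (w : 'I_q -> U) i : vcat v w (rshift p i) = w i.
Proof. by rewrite /vcat (unsplitK (inr i)). Qed.

Lemma vcat_ext U p q (v w : 'I_(p + q) -> U) :
  (forall i, v (lshift q i) = w (lshift q i)) ->
  (forall i, v (rshift p i) = w (rshift p i)) -> v = w.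
Proof.
move=> vl vr; apply: funext => i; rewrite -(fintype.splitK i).
by case: (fintype.split i) => j /=.
Qed.

Lemma vcat_withl U p q (v : 'I_p -> U) (w : 'I_q -> U) i u :
  vcat [eta v with i |-> u] w = [eta vcat v w with lshift q i |-> u].
Proof.
apply: vcat_ext => j /=; rewrite ?vcatl ?vcatr //= ?(inj_eq (@lshift_inj _ _)) //.
by rewrite eq_rlshift.
Qed.

Lemma vcat_withr U p q (v : 'I_p -> U) (w : 'I_q -> U) i u :
  vcat v [eta w with i |-> u] = [eta vcat v w with rshift p i |-> u].
Proof.
apply: vcat_ext => j /=; rewrite ?vcatl ?vcatr //= ?(inj_eq (@rshift_inj _ _)) //.
by rewrite eq_lrshift.
Qed.

Lemma alternating_vcatl p q (f : kform V (p + q)) w : alternating f ->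
  alternating (fun v : 'I_p -> V => f (vcat v w) : R).
Proof.
case=> fl fa; split=> [i v c u u'|i j v ij vij]; first by rewrite !vcat_withl fl.
by apply: (fa (lshift q i) (lshift q j)); rewrite ?(inj_eq (@lshift_inj _ _)) ?vcatl.
Qed.

Lemma alternating_vcatr p q (f : kform V (p + q)) v : alternating f ->
  alternating (fun w : 'I_q -> V => f (vcat v w) : R).
Proof.
case=> fl fa; split=> [i w c u u'|i j w ij wij]; first by rewrite !vcat_withr fl.
by apply: (fa (rshift p i) (rshift p j)); rewrite ?(inj_eq (@rshift_inj _ _)) ?vcatr.
Qed.

Lemma sum_ffun_vcat (T : nmodType) (r p q : nat) (F : {ffun 'I_(p + q) -> 'I_r} -> T) :
  \sum_J F J = \sum_(J : {ffun 'I_p -> 'I_r}) \sum_(K : {ffun 'I_q -> 'I_r})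
     F [ffun i => vcat J K i].
Proof.
rewrite pair_big /= (reindex (fun Q : {ffun 'I_p -> 'I_r} * {ffun 'I_q -> 'I_r} =>
  [ffun i => vcat Q.1 Q.2 i])) //=.
exists (fun J : {ffun 'I_(p + q) -> 'I_r} =>
    ([ffun i => J (lshift q i)], [ffun i => J (rshift p i)])).
  by move=> [J K] _; congr pair; apply/ffunP => i; rewrite !ffunE ?vcatl ?vcatr.
move=> J _; apply/ffunP => i; rewrite ffunE /=.
rewrite -(fintype.splitK i); case: (fintype.split i) => j /=.
  by rewrite vcatl ffunE.
by rewrite vcatr ffunE.
Qed.

End Multilinear.

(** * Two determinant identities *)

Section DetReplace.
Context (R : comNzRingType) (k : nat).
Implicit Types A B : 'M[R]_k.

(** Both sums are the derivative of the determinant at [A] in the direction [B], taken once column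
    by column and once row by row. *)
Lemma det_replace A B :
  \sum_l \det (\matrix_(i, j) if j == l then B i j else A i j) =
  \sum_l \det (\matrix_(i, j) if i == l then B i j else A i j).
Proof.
rewrite /determinant exchange_big [RHS]exchange_big; apply: eq_bigr => s _.
rewrite -!mulr_sumr; congr (_ * _); rewrite (reindex_inj (@perm_inj _ s)).
apply: eq_bigr => l _; apply: eq_bigr => i _.
by rewrite !mxE (inj_eq perm_inj).
Qed.

(* Both sides are determinants of order [k + 1], which differ by the exchange
   of the rows [r] and [s]. *)
Lemma det_cofactor_swap (W : 'I_k.+1 -> 'I_k -> R) (w : 'I_k -> R) (r s : 'I_k.+1) :
  r != s ->
  (-1) ^+ r * \det (\matrix_(i, j) if lift r i == s then w j else W (lift r i) j) =
  - ((-1) ^+ s * \det (\matrix_(i, j) if lift s i == r then w j else W (lift s i) j)).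
Proof.
pose N a b : 'M_k.+1 := \matrix_(i, j) if unlift ord0 j is Some j' then
   (if i == a then 0 else if i == b then w j' else W i j') else (i == a)%:R.
have detN a b : a != b -> \det (N a b) =
    (-1) ^+ a * \det (\matrix_(i, j) if lift a i == b then w j else W (lift a i) j).
  move=> ab; rewrite (expand_det_col _ ord0) (bigD1 a) //= big1 ?addr0 => [|i ia];
      last first.
    by rewrite mxE unlift_none (negbTE ia) mul0r.
  rewrite mxE unlift_none eqxx mul1r /cofactor addn0; congr (_ * \det _).
  by apply/matrixP => i j; rewrite !mxE liftK eq_sym (negbTE (neq_lift _ _)).
move=> rs; have sr : s != r by rewrite eq_sym.
rewrite -(detN _ _ rs) -(detN _ _ sr).
have -> : N s r = xrow r s (N r s).
  apply/matrixP => i j; rewrite !mxE; case: tpermP => [->|->|/eqP ir /eqP si].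
  - by rewrite !eqxx (negbTE rs) (negbTE sr).
  - by rewrite !eqxx.
  - by rewrite (negbTE ir) (negbTE si).
by rewrite xrowE detM det_perm odd_tperm rs mulN1r opprK.
Qed.

End DetReplace.

(** * Decomposable forms, pairing, contraction and top forms *)

Section WedgeCov.
Context (R : realType) (V : vectType R).
Implicit Types (k p q : nat).

Lemma dualD (c : dualv V) (u v : V) : c (u + v) = c u + c v :> R.
Proof. exact: (linearD (c : 'Hom(V, R^o))). Qed.

Lemma dualZ (c : dualv V) a (u : V) : c (a *: u) = a * c u :> R.
Proof. exact: (linearZ_LR (c : 'Hom(V, R^o)) a u). Qed.

Lemma dual_comb (c d : dualv V) a (u : V) : (a *: c + d) u = a * c u + d u :> R.
Proof. by rewrite lfunE /= lfunE. Qed.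

Lemma wedge_covE k (c : 'I_k -> dualv V) v :
  wedge_cov c v = \sum_(s : 'S_k) (-1) ^+ s * \prod_i (c i (v (s i)) : R).
Proof.
by apply: eq_bigr => s _; congr (_ * _); apply: eq_bigr => i _; rewrite mxE.
Qed.

Lemma wedge_cov_tr k (c : 'I_k -> dualv V) v :
  wedge_cov c v = \det (\matrix_(i, j) (c j (v i) : R)).
Proof. by rewrite /wedge_cov -det_tr; congr (\det _); apply/matrixP => i j; rewrite
    !mxE. Qed.

Lemma wedge_cov_alt k (c : 'I_k -> dualv V) : alternating (wedge_cov c).
Proof.
split=> [i v a u w|i j v ij vij]; rewrite !wedge_cov_tr.
  rewrite (@determinant_multilinear _ _ _ (\matrix_(l, j) (c j ([eta v with i |-> u]
      l) : R))
    (\matrix_(l, j) (c j ([eta v with i |-> w] l) : R)) i a 1).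
  - by rewrite mul1r.
  - by apply/rowP => j; rewrite !mxE /= eqxx dualD dualZ mul1r.
  - by apply/matrixP => l j; rewrite !mxE /= eq_sym (negbTE (neq_lift _ _)).
  - by apply/matrixP => l j; rewrite !mxE /= eq_sym (negbTE (neq_lift _ _)).
by rewrite (determinant_alternate ij) // => l; rewrite !mxE vij.
Qed.

Lemma wedge_cov_alt_cov k (v : 'I_k -> V) :
  alternating (fun c : 'I_k -> dualv V => wedge_cov c v : R).
Proof.
split=> [i c a u w|i j c ij cij]; rewrite /wedge_cov.
  rewrite (@determinant_multilinear _ _ _ (\matrix_(l, j) ([eta c with i |-> u] l (v
      j) : R))
    (\matrix_(l, j) ([eta c with i |-> w] l (v j) : R)) i a 1).
  - by rewrite mul1r.
  - by apply/rowP => j; rewrite !mxE /= eqxx dual_comb mul1r.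
  - by apply/matrixP => l j; rewrite !mxE /= eq_sym (negbTE (neq_lift _ _)).
  - by apply/matrixP => l j; rewrite !mxE /= eq_sym (negbTE (neq_lift _ _)).
by rewrite (determinant_alternate ij) // => l; rewrite !mxE cij.
Qed.

Lemma wedge_cov_fcons k (th : dualv V) (c : 'I_k -> dualv V) (v : 'I_k.+1 -> V) :
  wedge_cov (fcons th c) v =
  \sum_(r < k.+1) (-1) ^+ r * (th (v r) : R) * wedge_cov c (fun i => v (lift r i)).
Proof.
rewrite /wedge_cov (expand_det_row _ ord0); apply: eq_bigr => r _.
rewrite mxE fcons0 /cofactor add0n mulrA [_ * (-1) ^+ r]mulrC.
congr (_ * \det _); apply/matrixP => i j.
by rewrite !mxE fconsS.
Qed.

(** Laplace expansion along the column of [X]. In the minor belonging to [c j] the covector [th]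
    still stands first; moving it to place [j] is a cycle of sign [(-1)^j], which against the
    cofactor sign [(-1)^(j+1)] leaves the single minus. *)
Lemma interior_wedge_cov k (th : dualv V) (c : 'I_k -> dualv V) (X : V) (v : 'I_k ->
    V) :
  Defs.interior X (wedge_cov (fcons th c)) v =
  (th X : R) * wedge_cov c v - \sum_j (c j X : R) * wedge_cov [eta c with j |-> th] v.
Proof.
rewrite /Defs.interior -/(fcons X v) {1}/wedge_cov (expand_det_col _ ord0) big_ord_recl.
rewrite mxE !fcons0 /cofactor expr0 mul1r; congr (_ * \det _ + _).
  by apply/matrixP => i j; rewrite !mxE !fconsS.
rewrite -sumrN; apply: eq_bigr => j _.
rewrite mxE fcons0 fconsS -mulrN; congr (_ * _).
case: k c v j => [|k] c v j; first by case: j.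
have -> : \det (row' (lift ord0 j) (col' ord0 (\matrix_(i, j0) (fcons th c i (fcons X
    v j0) : R)))) =
    wedge_cov (fun l => [eta c with j |-> th] (lift_perm ord0 j 1%g l)) v.
  congr (\det _); apply/matrixP => i l; rewrite !mxE fconsS.
  case: (unliftP ord0 i) => [i' ->|->].
    rewrite lift_perm_lift perm1 /= eq_sym (negbTE (neq_lift _ _)).
    have -> : lift (lift ord0 j) (lift ord0 i') = lift ord0 (lift j i').
      by apply: val_inj; rewrite /= /bump /= !add1n ltnS addnS.
    by rewrite fconsS.
  rewrite lift_perm_id /= eqxx.
  have -> : lift (lift ord0 j) ord0 = ord0 :> 'I_k.+2 by apply: val_inj.
  by rewrite fcons0.
rewrite (alternating_perm _ _ (wedge_cov_alt_cov v)) odd_lift_perm odd_perm1 addbF /=.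
by rewrite addn0 signr_odd /= /bump /= add1n exprS mulN1r mulNr mulrA -expr2
    sqrr_sign mul1r.
Qed.

(** The resolution of the identity by a frame and its coframe, common to the [vbasis] of a fibre and
    to the local frames of a bundle. *)
Definition frame_pair r (e : 'I_r -> V) (e' : 'I_r -> dualv V) :=
  forall v, v = \sum_a (e' a v : R) *: e a.

Lemma frame_pair_dual r (e : 'I_r -> V) e' : frame_pair e e' ->
  forall c : dualv V, c = \sum_a (c (e a) : R) *: e' a.
Proof.
move=> ee c; apply/lfunP => v; rewrite sum_lfunE {1}(ee v) linear_sum.
by apply: eq_bigr => a _; rewrite [LHS]dualZ scale_lfunE [LHS]mulrC.
Qed.

Lemma frame_pair_basis r (e : r.-tuple V) : basis_of {:V} e ->
  frame_pair (tnth e) (fun a => linfun (coord e a : V -> R^o)).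
Proof.
move=> be v; rewrite {1}(coord_basis be (memvf v)); apply: eq_bigr => a _.
by rewrite lfunE (tnth_nth 0).
Qed.

Lemma frame_pair_vbasis : frame_pair (@basis_vec R V) (@basis_cov R V).
Proof. exact: frame_pair_basis (vbasisP _). Qed.

(** Each of the [k!] terms of the determinant contributes [xi c]: reindexing the tuples by its
    permutation cancels its sign against that of [xi], and what remains is the expansion of [xi] in
    the coframe. *)
Lemma sum_wedge_cov r (e : 'I_r -> V) e' k (xi : kvec V k) c : frame_pair e e' ->
  alternating xi ->
  \sum_(J : {ffun 'I_k -> 'I_r}) wedge_cov c (fun j => e (J j)) * xi (fun j => e' (J
      j)) =
  k`!%:R * xi c.
Proof.
move=> ee xa.
under eq_bigr do rewrite wedge_covE mulr_suml.
rewrite exchange_big /=; under eq_bigr => s _.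
  rewrite (reindex_inj (h := fun J : {ffun 'I_k -> 'I_r} => [ffun i => J (s^-1%g
      i)])); last first.
    move=> J K /ffunP JK; apply/ffunP => i; have := JK (s i).
    by rewrite !ffunE permK.
  rewrite (eq_bigr (fun J : {ffun 'I_k -> 'I_r} => (\prod_i (c i (e (J i)) : R)) * xi
      (fun j => e' (J j)))) => [|J _]; last first.
    under eq_bigr do rewrite ffunE permK.
    under [X in xi X]funext do rewrite ffunE.
    rewrite (alternating_perm (fun j => e' (J j)) s^-1%g xa) odd_permV.
    by rewrite mulrACA mulrA -signr_addb addbb mul1r.
  rewrite -(multilinear_expand (fun i a => c i (e a) : R) (fun _ => e')
      (alternating_lin xa)).
  over.
rewrite sumr_const card_Sn mulr_natl; congr (xi _ *+ _).
by apply: funext => i; exact/esym/(frame_pair_dual ee).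
Qed.

Lemma sum_form_wedge r (e : 'I_r -> V) e' k (f : kform V k) v : frame_pair e e' ->
  alternating f ->
  \sum_(J : {ffun 'I_k -> 'I_r}) f (fun j => e (J j)) * wedge_cov (fun j => e' (J j))
      v =
  k`!%:R * f v.
Proof.
move=> ee fa.
under eq_bigr do rewrite wedge_covE mulr_sumr.
rewrite exchange_big /= (eq_bigr (fun=> f v)) => [|s _]; last first.
  transitivity ((-1) ^+ s * f (fun i => v (s i))); last first.
    by rewrite (alternating_perm _ _ fa) mulrA -signr_addb addbb mul1r.
  have -> : (fun i => v (s i)) = fun i => \sum_a (e' a (v (s i)) : R) *: e a.
    by apply: funext => i; exact: ee.
  rewrite (multilinear_expand _ (fun=> e) (alternating_lin fa)) mulr_sumr.
  by apply: eq_bigr => J _; rewrite mulrCA; congr (_ * _); rewrite mulrC.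
by rewrite sumr_const card_Sn mulr_natl.
Qed.

Lemma pairing_comb k (f g : kform V k) (xi : kvec V k) c :
  pairing (fun v => c * f v + g v) xi = c * pairing f xi + pairing g xi.
Proof.
rewrite /pairing mulrCA -mulrDr; congr (_ * _).
rewrite mulr_sumr -big_split /=; by apply: eq_bigr => J _; rewrite mulrDl mulrA.
Qed.

Lemma factR_neq0 n : n`!%:R != 0 :> R.
Proof. by rewrite pnatr_eq0 -lt0n fact_gt0. Qed.

Lemma pairing_wedge_cov k (c : 'I_k -> dualv V) (xi : kvec V k) :
  alternating xi -> pairing (wedge_cov c) xi = xi c.
Proof.
move=> xa; rewrite /pairing (sum_wedge_cov c frame_pair_vbasis xa).
by rewrite mulrA mulVf ?factR_neq0 ?mul1r.
Qed.

(** Against an alternating [xi] all [(p + q)!] permutations in [wedge] contribute the same amount,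
    which cancels the factorial in [pairing]; only the weight [p! q!] is left. *)
Lemma pairing_wedge p q (f : kform V p) (g : kform V q) (xi : kvec V (p + q)) :
  alternating xi ->
  p`!%:R * q`!%:R * pairing (wedge f g) xi =
  \sum_(J : {ffun 'I_p -> 'I_(\dim {:V})}) \sum_(K : {ffun 'I_q -> 'I_(\dim {:V})})
    f (fun i => basis_vec (J i)) * g (fun i => basis_vec (K i)) *
    xi (vcat (fun i => basis_cov (J i)) (fun i => basis_cov (K i))).
Proof.
move=> xa; pose F (L : {ffun 'I_(p + q) -> 'I_(\dim {:V})}) :=
  f (fun i => basis_vec (L (lshift q i))) * g (fun i => basis_vec (L (rshift p i))) *
  xi (fun i => basis_cov (L i)).
transitivity (\sum_L F L); last first.
  rewrite sum_ffun_vcat; apply: eq_bigr => J _; apply: eq_bigr => K _.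
  congr (f _ * g _ * xi _); apply: funext => i; rewrite ?ffunE ?vcatl ?vcatr //.
  by rewrite /vcat; case: fintype.split.
set S := \sum_L F L; have E (s : 'S_(p + q)) : \sum_(L : {ffun 'I_(p + q) -> 'I_(\dim
    {:V})})
    ((-1) ^+ s * f (fun i => basis_vec (L (s (lshift q i)))) *
     g (fun i => basis_vec (L (s (rshift p i))))) * xi (fun i => basis_cov (L i)) = S.
  rewrite (reindex_inj (h := fun L : {ffun 'I_(p + q) -> 'I_(\dim {:V})} => [ffun i
      => L (s^-1%g i)])).
    apply: eq_bigr => L _.
    have -> : xi (fun i => basis_cov ([ffun i => L (s^-1%g i)] i)) =
              (-1) ^+ s * xi (fun i => basis_cov (L i)).
      rewrite -odd_permV -(alternating_perm (fun j => basis_cov (L j)) s^-1%g xa).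
      by congr xi; apply: funext => i; rewrite ffunE.
    have -> : (fun i => basis_vec ([ffun i => L (s^-1%g i)] (s (lshift q i)))) = (fun
        i => basis_vec (L (lshift q i))).
      by apply: funext => i; rewrite ffunE permK.
    have -> : (fun i => basis_vec ([ffun i => L (s^-1%g i)] (s (rshift p i)))) = (fun
        i => basis_vec (L (rshift p i))).
      by apply: funext => i; rewrite ffunE permK.
    rewrite /F; move: (f _) (g _) (xi _) => a b c.
    have := sqrr_sign R s; rewrite expr2; move: ((-1) ^+ s) => z zz.
    transitivity (z * z * (a * b * c)); first by ring.
    by rewrite zz mul1r.
  move=> J K /ffunP JK; apply/ffunP => i; have := JK (s i).
  by rewrite !ffunE permK.
rewrite /pairing /wedge.
under eq_bigr do rewrite -mulrA mulr_suml.
rewrite -mulr_sumr exchange_big /= (eq_bigr (fun=> S)) => [|s _]; last exact: E.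
rewrite sumr_const card_Sn.
rewrite mulrCA mulVKf ?mulf_neq0 ?factR_neq0 //.
by rewrite -[S *+ _]mulr_natl mulKf ?factR_neq0.
Qed.

(** In the double sum of [pairing_wedge] the tuples [J] and [K] are summed separately, each by
    [sum_wedge_cov], which gives back the factors [p!] and [q!]. *)
Lemma contract_wedge_cov p q (c : 'I_p -> dualv V) (d : 'I_q -> dualv V) (xi : kvec V
    (p + q)) :
  alternating xi -> contract (wedge_cov c) xi d = xi (vcat c d).
Proof.
move=> xa; rewrite /contract.
have pq0 : p`!%:R * q`!%:R != 0 :> R by rewrite mulf_neq0 ?factR_neq0.
apply: (mulfI pq0); rewrite (pairing_wedge _ _ xa).
rewrite -mulrA -(sum_wedge_cov d frame_pair_vbasis (alternating_vcatr c xa)).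
rewrite mulr_sumr exchange_big /=; apply: eq_bigr => K _.
rewrite mulrCA -(sum_wedge_cov c frame_pair_vbasis (alternating_vcatl _ xa)).
by rewrite mulr_sumr; apply: eq_bigr => J _; rewrite mulrCA mulrA.
Qed.

Lemma dual_vec_of (xi : kvec V 1) (c : dualv V) : multilinear xi ->
  c (vec_of xi) = xi (fun=> c) :> R.
Proof.
move=> xl.
have E d : [eta (fun=> 0) with (ord0 : 'I_1) |-> d] = (fun=> d) :> ('I_1 -> dualv V).
  by apply: funext => i /=; rewrite (ord1 i).
rewrite {2}(frame_pair_dual frame_pair_vbasis c) -E (multilinear_sum _ _ _ _ xl).
rewrite /vec_of (linear_sum (c : 'Hom(V, R^o))); apply: eq_bigr => a _.
by rewrite E [LHS]dualZ mulrC.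
Qed.

(** Proportionality of top forms, stated without division. On a tuple [e \o J] both sides vanish if
    [J] repeats an index; otherwise [J] is a permutation and gives [f] and [g] the same sign. *)
Lemma top_form m (e : 'I_m -> V) e' (f g : kform V m) v : frame_pair e e' ->
  alternating f -> alternating g -> g e * f v = f e * g v.
Proof.
move=> ee fa ga.
have lin a (h : kform V m) : multilinear h -> multilinear (fun v => a * h v : R).
  by move=> hl i w c u u'; rewrite hl mulrDr mulrCA.
suff : (fun v => g e * f v) = (fun v => f e * g v) by move/(congr1 (fun h => h v)).
apply: (multilinear_ext (lin _ _ (alternating_lin fa)) (lin _ _ (alternating_lin ga))
    (w := e)).
  by move=> u; exists (fun a => e' a u); exact: ee.
move=> J; have [/injectiveP Ji|] := boolP (injectiveb J).
  have -> : e \o J = fun i => e (perm Ji i) by apply: funext => i; rewrite permE.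
  by rewrite (alternating_perm _ _ fa) (alternating_perm _ _ ga) mulrCA [RHS]mulrCA
      [g e * _]mulrC.
case/injectivePn => i [j ij Jij].
have eJ : (e \o J) i = (e \o J) j by rewrite /= Jij.
by rewrite (fa.2 i j _ ij eJ) (ga.2 i j _ ij eJ) !mulr0.
Qed.

(** The identity [th /\ iota_X f = th(X) f] for a top form, evaluated at [e]. It produces the term
    [X h] in the divergence of [h X]. *)
Lemma top_interior m (e : 'I_m -> V) e' (f : kform V m) (th : dualv V) X : frame_pair
    e e' ->
  alternating f -> \sum_i (th (e i) : R) * f [eta e with i |-> X] = (th X : R) * f e.
Proof.
move=> ee fa; rewrite {2}(ee X).
have -> : (th (\sum_a (e' a X : R) *: e a) : R) = \sum_a (e' a X : R) * th (e a).
  rewrite (linear_sum (th : 'Hom(V, R^o))); apply: eq_bigr => a _; exact: dualZ.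
rewrite mulr_suml; apply: eq_bigr => i _.
rewrite (ee X) (multilinear_sum _ _ _ _ (alternating_lin fa)) (bigD1 i) //= with_id.
rewrite big1 ?addr0 => [|a ai]; first by rewrite -(ee X); ring.
by rewrite (fa.2 i a) ?mulr0 1?eq_sym //= eqxx (negbTE ai).
Qed.

End WedgeCov.

(** * Derivations *)

Section Smooth.
Context (R : realType) (d : nat) (M : manifold R d).
Implicit Types (f g : M -> R) (x y : M).

Lemma smooth_cst (c : R) : smooth (fun _ : M => c).
Proof. by apply/smoothP => x; exact: smooth_at_cst. Qed.



Lemma smoothD f g : smooth f -> smooth g -> smooth (fun y => f y + g y).
Proof. by move=> /smoothP fs /smoothP gs; apply/smoothP => x; exact: smooth_atD. Qed.

Lemma smoothM f g : smooth f -> smooth g -> smooth (fun y => f y * g y).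
Proof. by move=> /smoothP fs /smoothP gs; apply/smoothP => x; exact: smooth_atM. Qed.

Lemma smoothN f : smooth f -> smooth (fun y => - f y).
Proof. by move=> /smoothP fs; apply/smoothP => x; exact: smooth_atN. Qed.

Lemma smoothB f g : smooth f -> smooth g -> smooth (fun y => f y - g y).
Proof. by move=> fs gs; exact: smoothD fs (smoothN gs). Qed.

Lemma smooth_sum (I : Type) (r : seq I) (P : pred I) (f : I -> M -> R) :
  (forall i, P i -> smooth (f i)) -> smooth (fun y => \sum_(i <- r | P i) f i y).
Proof.
move=> fs; apply/smoothP => x; apply: smooth_at_sum => i Pi.
by move/smoothP : (fs i Pi).
Qed.

Lemma smooth_prod (I : Type) (r : seq I) (P : pred I) (f : I -> M -> R) :
  (forall i, P i -> smooth (f i)) -> smooth (fun y => \prod_(i <- r | P i) f i y).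
Proof.
move=> fs; apply/smoothP => x; apply: smooth_at_prod => i Pi.
by move/smoothP : (fs i Pi).
Qed.

Lemma smooth_det k (a : 'I_k -> 'I_k -> M -> R) : (forall i j, smooth (a i j)) ->
  smooth (fun y => \det (\matrix_(i, j) a i j y)).
Proof.
move=> sa; rewrite /determinant; apply: smooth_sum => s _.
apply: smoothM; first exact: smooth_cst.
apply: smooth_prod => i _; rewrite (_ : (fun y => _) = a i (s i)) //.
by apply: funext => y; rewrite mxE.
Qed.

End Smooth.
Arguments smooth_cst {R d} M c.

Section Derivation.
Context (R : realType) (d : nat) (M : manifold R d) (x : M) (D : (M -> R) -> R).
Hypothesis Dx : tangent_at x D.
Implicit Types (f g : M -> R).

Lemma tangentD f g : smooth f -> smooth g -> D (fun y => f y + g y) = D f + D g.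
Proof.
move=> fs gs; have := Dx.1 1 f g fs gs; rewrite mul1r => <-.
by congr D; apply: funext => y; rewrite mul1r.
Qed.

Lemma tangentM f g : smooth f -> smooth g ->
  D (fun y => f y * g y) = D f * g x + f x * D g.
Proof. exact: Dx.2. Qed.

Lemma tangent_cst (c : R) : D (fun=> c) = 0.
Proof.
have D1 : D (fun=> 1) = 0.
  have := tangentM (smooth_cst M 1) (smooth_cst M 1); rewrite !mulr1 mul1r.
  by move/eqP; rewrite -subr_eq0 opprD addrA subrr sub0r oppr_eq0 => /eqP.
have D0 : D (fun=> 0) = 0.
  have := tangentD (smooth_cst M 0) (smooth_cst M 0); rewrite addr0.
  by move/eqP; rewrite -subr_eq0 opprD addrA subrr sub0r oppr_eq0 => /eqP.
have := Dx.1 c (fun=> 1) (fun=> 0) (smooth_cst M 1) (smooth_cst M 0).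
by rewrite D1 D0 mulr0 addr0 mulr1 addr0.
Qed.

Lemma tangentZ c f : smooth f -> D (fun y => c * f y) = c * D f.
Proof. by move=> fs; rewrite tangentM ?tangent_cst ?mul0r ?add0r //; exact:
    smooth_cst. Qed.

Lemma tangentN f : smooth f -> D (fun y => - f y) = - D f.
Proof.
move=> fs; rewrite -mulN1r -tangentZ //; congr D.
by apply: funext => y; rewrite mulN1r.
Qed.

Lemma tangentB f g : smooth f -> smooth g -> D (fun y => f y - g y) = D f - D g.
Proof. by move=> fs gs; rewrite tangentD ?tangentN //; exact: smoothN. Qed.

Lemma tangent_sum (I : Type) (r : seq I) (P : pred I) (f : I -> M -> R) :
  (forall i, P i -> smooth (f i)) ->
  D (fun y => \sum_(i <- r | P i) f i y) = \sum_(i <- r | P i) D (f i).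
Proof.
move=> fs; elim: r => [|i r IH].
  rewrite big_nil -[RHS](tangent_cst 0); congr D; apply: funext => y.
  by rewrite big_nil.
rewrite big_cons; case: ifP => Pi.
  rewrite -IH -tangentD; [|exact: fs|exact: smooth_sum].
  by congr D; apply: funext => y; rewrite big_cons Pi.
by rewrite -IH; congr D; apply: funext => y; rewrite big_cons Pi.
Qed.

(** For a bump function [b] at [x] supported where [f = g], the product [(f - g) * b] vanishes
    identically, and the product rule reads its derivative as [D f - D g]. *)
Lemma tangent_local f g : smooth f -> smooth g -> (\near x, f x = g x) -> D f = D g.
Proof.
move=> fs gs; rewrite /prop_near1 nbhsE => -[V [oV Vx] fg].
have [b [bs b1 b0]] := exists_bump oV Vx.
have /(congr1 D) : (fun y => (f y - g y) * b y) = fun=> 0.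
  apply: funext => y; have [Vy|nVy] := pselect (V y).
    by rewrite (fg y Vy) subrr mul0r.
  by rewrite (nbhs_singleton (b0 y nVy)) mulr0.
rewrite tangentM ?tangentB ?tangent_cst //; last exact: smoothB.
rewrite (nbhs_singleton b1) (fg x Vx) subrr mul0r addr0 mulr1.
by move/eqP; rewrite subr_eq0 => /eqP.
Qed.

Lemma tangent_prod k (f : 'I_k -> M -> R) : (forall i, smooth (f i)) ->
  D (fun y => \prod_i f i y) =
  \sum_l \prod_i (if i == l then D (f i) else f i x).
Proof.
elim: k f => [|k IH] f fs.
  rewrite big_ord0 -[RHS](tangent_cst 1); congr D; apply: funext => y.
  by rewrite big_ord0.
have -> : (fun y => \prod_i f i y) = (fun y => f ord0 y * \prod_i f (lift ord0 i) y).
  by apply: funext => y; rewrite big_ord_recl.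
rewrite tangentM ?IH //; last by apply: smooth_prod.
rewrite big_ord_recl; congr (_ + _).
  rewrite big_ord_recl eqxx; congr (_ * _); apply: eq_bigr => i _.
rewrite mulr_sumr; apply: eq_bigr => l _; rewrite big_ord_recl (negbTE (neq_lift _ _)).
by congr (_ * _); apply: eq_bigr => i _; rewrite (inj_eq lift_inj).
Qed.

Lemma tangent_det k (a : 'I_k -> 'I_k -> M -> R) : (forall i j, smooth (a i j)) ->
  D (fun y => \det (\matrix_(i, j) a i j y)) =
  \sum_l \det (\matrix_(i, j) if i == l then D (a i j) else a i j x).
Proof.
move=> sa; rewrite /determinant exchange_big tangent_sum => [|s _]; last first.
  apply: smoothM; first exact: smooth_cst.
  apply: smooth_prod => i _; rewrite (_ : (fun y => _) = a i (s i)) //.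
  by apply: funext => y; rewrite mxE.
apply: eq_bigr => s _; rewrite -mulr_sumr.
have -> : (fun y => (-1) ^+ s * \prod_i (\matrix_(i, j) a i j y) i (s i)) =
          (fun y => (-1) ^+ s * \prod_i a i (s i) y).
  by apply: funext => y; congr (_ * _); apply: eq_bigr => i _; rewrite mxE.
rewrite tangentZ ?tangent_prod //; last exact: smooth_prod.
by congr (_ * _); apply: eq_bigr => l _; apply: eq_bigr => i _; rewrite mxE.
Qed.

Lemma smooth_ln f : (forall y, 0 < f y) -> smooth f -> smooth (fun y => ln (f y)).
Proof. by move=> f0 /smoothP fs; apply/smoothP => y; exact: smooth_at_ln. Qed.

(* With [u = ln f - ln (f x)] one has [f / f x = 1 + u * q u] for the entire
   function [q w = (e^w - 1) / w], whose value at [0] is [1]. *)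
Lemma tangent_ln f : (forall y, 0 < f y) -> smooth f ->
  D (fun y => ln (f y)) = D f / f x.
Proof.
move=> f0 fs; have us := smoothB (smooth_ln f0 fs) (smooth_cst M (ln (f x))).
pose q t : R := limn (pseries (@expm1_coeff R) t).
have qs : smooth (fun y => q (ln (f y) - ln (f x))).
  apply/smoothP => y; move/smoothP/(_ y) : us => uy.
  apply: (@smooth_at_comp _ _ _ [set phi | exists2 c, exp_bounded c &
      phi = fun t => limn (pseries c t)] setT _ _ openT _ I uy q).
    move=> _ [c cb ->]; exists (fun t => limn (pseries (pseries_diffs c) t)).
      by exists (pseries_diffs c) => //; exact: exp_bounded_diffs.
    by move=> t _; exact: is_derive_exp_bounded.
  by exists (@expm1_coeff R) => //; exact: exp_bounded_expm1.
have E : f = fun y => f x * (1 + (ln (f y) - ln (f x)) * q (ln (f y) - ln (f x))).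
  apply: funext => y; rewrite expm1_coeffE addrC subrK expRB !lnK ?posrE //.
  by rewrite mulrCA divff ?mulr1 // gt_eqF.
rewrite {2}E tangentZ; last by apply: smoothD; [exact: smooth_cst|exact: smoothM].
rewrite tangentD ?tangent_cst ?add0r; [|exact: smooth_cst|exact: smoothM].
rewrite tangentM // subrr mul0r addr0 /q expm1_coeff0 mulr1 tangentB; [|exact:
    smooth_ln|exact: smooth_cst].
by rewrite tangent_cst subr0 mulrAC divff ?mul1r // gt_eqF.
Qed.

End Derivation.

(** * Vector bundles *)

Section Bundle.
Context (R : realType) (d : nat) (M : manifold R d) (m : nat) (E : vbundle M m).
Implicit Types (f g : M -> R) (x y : M) (s t : sec E).

Lemma frame_pair_frame (i : frame_index E) x : frame_dom i x ->
  frame_pair (tnth (frame i x)) (coframe i x).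
Proof. by move=> ix; apply: frame_pair_basis; exact: frame_basis. Qed.

Lemma coframeE (i : frame_index E) x a v : coframe i x a v = coord (frame i x) a v :> R.
Proof. by rewrite lfunE. Qed.

Lemma frame_dom_near (i : frame_index E) x : frame_dom i x -> \near x, frame_dom i x.
Proof. by move=> ix; apply: open_nbhs_nbhs; split=> //; exact: frame_dom_open. Qed.

Definition smooth_sec_at x s := forall (i : frame_index E) (a : 'I_m),
  frame_dom i x -> smooth_at x (fun y => coord (frame i y) a (s y)).

Lemma smooth_secP s : smooth_sec s <-> forall x, smooth_sec_at x s.
Proof.
split=> [ss x i a ix|ss i a].
  have oi : open (frame_dom i `&` setT) by apply: openI; [exact:
      frame_dom_open|exact: openT].
  by have /(smooth_onP _ oi) := ss i a; apply; split.
have oi : open (frame_dom i `&` setT) by apply: openI; [exact: frame_dom_open|exact: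
    openT].
by apply/(smooth_onP _ oi) => x [ix _]; exact: ss.
Qed.

Lemma smooth_sec_at_eq x s t : (\near x, s x = t x) -> smooth_sec_at x s ->
    smooth_sec_at x t.
Proof.
move=> st ss i a ix; apply: smooth_at_eq (ss i a ix).
by apply: (@filterS _ (nbhs x) _ _ _ _ st) => y ->.
Qed.

Lemma smooth_sec_at_comb x f s t : smooth_at x f -> smooth_sec_at x s ->
  smooth_sec_at x t -> smooth_sec_at x (fun y => f y *: s y + t y).
Proof.
move=> fs ss ts i a ix.
apply: smooth_at_eq (smooth_atD (smooth_atM fs (ss i a ix)) (ts i a ix)).
by near=> y; rewrite linearP.
Unshelve. all: by end_near. Qed.

Lemma smooth_sec_at0 x : smooth_sec_at x (fun=> 0).
Proof.
move=> i a ix; apply: smooth_at_eq (smooth_at_cst x 0).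
by near=> y; rewrite linear0.
Unshelve. all: by end_near. Qed.

Arguments smooth_sec_at0 x i a _ : clear implicits.

Lemma smooth_sec_at_sum x (I : Type) (r : seq I) (f : I -> M -> R) (s : I -> sec E) :
  (forall a, smooth_at x (f a)) -> (forall a, smooth_sec_at x (s a)) ->
  smooth_sec_at x (fun y => \sum_(a <- r) f a y *: s a y).
Proof.
move=> fs ss; elim: r => [|a r IH].
  by apply: smooth_sec_at_eq (smooth_sec_at0 x); near=> y; rewrite big_nil.
apply: (smooth_sec_at_eq _ (smooth_sec_at_comb (fs a) (ss a) IH)).
by near=> y; rewrite big_cons.
Unshelve. all: by end_near. Qed.

Lemma smooth_sec_at_frame (i : frame_index E) a x : frame_dom i x ->
  smooth_sec_at x (fun y => tnth (frame i y) a).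
Proof.
move=> ix j b jx.
have oij : open (frame_dom j `&` frame_dom i) by apply: openI; exact: frame_dom_open.
by have /(smooth_onP _ oij) := frame_transition j i b a; apply.
Qed.

Lemma smooth_sec_comb f s t : smooth f -> smooth_sec s -> smooth_sec t ->
  smooth_sec (fun y => f y *: s y + t y).
Proof.
move=> /smoothP fs /smooth_secP ss /smooth_secP ts; apply/smooth_secP => x.
exact: smooth_sec_at_comb.
Qed.

Lemma smooth_sec0 : smooth_sec (fun x => 0 : fib E x).
Proof. by apply/smooth_secP => x; exact: smooth_sec_at0. Qed.

Lemma smooth_secZ f s : smooth f -> smooth_sec s -> smooth_sec (fun y => f y *: s y).
Proof.
move=> fs ss; have := smooth_sec_comb fs ss smooth_sec0.
by rewrite (_ : (fun y => _ + _) = fun y => f y *: s y) //; apply: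
    functional_extensionality_dep => y; rewrite addr0.
Qed.

Lemma smooth_secD s t : smooth_sec s -> smooth_sec t -> smooth_sec (fun y => s y + t y).
Proof.
move=> ss ts; have := smooth_sec_comb (smooth_cst M 1) ss ts.
by rewrite (_ : (fun y => _ + _) = fun y => s y + t y) //; apply:
    functional_extensionality_dep => y; rewrite scale1r.
Qed.

Lemma smooth_sec_sum (I : Type) (r : seq I) (f : I -> M -> R) (s : I -> sec E) :
  (forall a, smooth (f a)) -> (forall a, smooth_sec (s a)) ->
  smooth_sec (fun y => \sum_(a <- r) f a y *: s a y).
Proof.
move=> fs ss; apply/smooth_secP => x; apply: smooth_sec_at_sum => a.
  by move/smoothP: (fs a).
by move/smooth_secP: (ss a).
Qed.

Lemma smooth_cutoff (U : set M) (b g : M -> R) : smooth b ->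
  (forall y, ~ U y -> \near y, b y = 0) -> (forall y, U y -> smooth_at y g) ->
  smooth (fun y => b y * g y).
Proof.
move=> /smoothP bs b0 gs; apply/smoothP => y.
have [Uy|nUy] := pselect (U y); first by apply: smooth_atM (bs y) (gs y Uy).
apply: smooth_at_eq (smooth_at_cst y 0).
by apply: (@filterS _ (nbhs y) _ _ _ _ (b0 y nUy)) => z ->; rewrite mul0r.
Qed.

Lemma smooth_sec_cutoff (U : set M) (b : M -> R) s : smooth b ->
  (forall y, ~ U y -> \near y, b y = 0) -> (forall y, U y -> smooth_sec_at y s) ->
  smooth_sec (fun y => b y *: s y).
Proof.
move=> /smoothP bs b0 ss; apply/smooth_secP => y.
have [Uy|nUy] := pselect (U y).
  apply: (smooth_sec_at_eq _ (smooth_sec_at_comb (bs y) (ss y Uy) (smooth_sec_at0 y))).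
  by near=> z; rewrite addr0.
apply: (smooth_sec_at_eq _ (smooth_sec_at0 y)).
by apply: (@filterS _ (nbhs y) _ _ _ _ (b0 y nUy)) => z ->; rewrite scale0r.
Unshelve. all: by end_near. Qed.

(* A neighbourhood of [x] carries a frame of global sections [e a], and there
   a section [s] is [\sum_a (b * s_a) *: e a] with globally smooth coefficients. *)
Lemma frame_bump x : exists (i : frame_index E) (b : M -> R),
  [/\ (smooth b /\ \near x, b x = 1), frame_dom i x,
      forall a, smooth_sec (fun y => b y *: tnth (frame i y) a),
      forall s a, smooth_sec s -> smooth (fun y => b y * coord (frame i y) a (s y)) &
      forall s y, b y ^+ 2 *: s y = \sum_a (b y * coord (frame i y) a (s y)) *: (b y
          *: tnth (frame i y) a)].
Proof.
have [i ix] := frame_cover E x.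
have [b [bs b1 b0]] := exists_bump (@frame_dom_open _ _ _ _ _ i) ix.
exists i, b; split=> //.
- by move=> a; apply: smooth_sec_cutoff bs b0 _ => y iy; exact: smooth_sec_at_frame.
- move=> s a /smooth_secP ss; apply: smooth_cutoff bs b0 _ => y iy; exact: ss.
- move=> s y; have [iy|niy] := pselect (frame_dom i y); last first.
    rewrite (nbhs_singleton (b0 y niy)) expr0n scale0r big1 // => a _.
    by rewrite mul0r scale0r.
  rewrite {1}(frame_pair_frame iy (s y)) scaler_sumr; apply: eq_bigr => a _.
  by rewrite !scalerA coframeE; congr (_ *: _); ring.
Qed.

Lemma sec_ext_exists x (v : fib E x) : exists s, smooth_sec s /\ s x = v.
Proof.
have [i [b [[bs b1] ix es cs bE]]] := frame_bump x.
exists (fun y => \sum_a coord (frame i x) a v *: (b y *: tnth (frame i y) a)); split.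
  by apply: smooth_sec_sum => // a; exact: smooth_cst.
rewrite (nbhs_singleton b1) [RHS](frame_pair_frame ix v); apply: eq_bigr => a _.
by rewrite scale1r coframeE.
Qed.

Lemma extP x (v : fib E x) : smooth_sec (ext v) /\ ext v x = v.
Proof.
have [s ss] := sec_ext_exists v.
by have := @xgetPex {classic sec E} (fun=> 0) [set s | smooth_sec (s : sec E) /\ s x
    = v] (ex_intro _ s ss).
Qed.

Lemma smooth_ext x (v : fib E x) : smooth_sec (ext v).
Proof. by have [] := extP v. Qed.

Lemma ext_at x (v : fib E x) : ext v x = v.
Proof. by have [] := extP v. Qed.

(* For a bump function [b] at [x] and a local frame [e], every [u] equals
   [(1 - b^2) u + \sum_a (b u_a) (b e_a)]; if [u x = 0], then all these
   coefficients vanish at [x]. *)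
Lemma tensorial x (T : sec E -> R) s t :
  (forall s t, smooth_sec s -> smooth_sec t -> T (fun y => s y + t y) = T s + T t) ->
  (forall f s, smooth f -> smooth_sec s -> T (fun y => f y *: s y) = f x * T s) ->
  smooth_sec s -> smooth_sec t -> s x = t x -> T s = T t.
Proof.
move=> TD TZ; have T0 : T (fun=> 0) = 0.
  have := TZ (fun=> 0) (fun=> 0) (smooth_cst M 0) smooth_sec0; rewrite mul0r => <-.
  by congr T; apply: functional_extensionality_dep => y; rewrite scale0r.
have Tsum (I : Type) (r : seq I) (f : I -> M -> R) (e : I -> sec E) :
    (forall a, smooth (f a)) -> (forall a, smooth_sec (e a)) ->
    T (fun y => \sum_(a <- r) f a y *: e a y) = \sum_(a <- r) f a x * T (e a).
  move=> fs es; elim: r => [|a r IH].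
    rewrite big_nil -[RHS]T0; congr T; apply: functional_extensionality_dep => y.
    by rewrite big_nil.
  rewrite big_cons -IH -TZ // -TD; [|exact: smooth_secZ|exact: smooth_sec_sum].
  by congr T; apply: functional_extensionality_dep => y; rewrite big_cons.
have Tz u : smooth_sec u -> u x = 0 -> T u = 0.
  move=> us u0; have [i [b [[bs b1] ix es cs bE]]] := frame_bump x.
  have -> : u = fun y => (1 - b y ^+ 2) *: u y +
      \sum_a (b y * coord (frame i y) a (u y)) *: (b y *: tnth (frame i y) a).
    by apply: functional_extensionality_dep => y; rewrite -bE -scalerDl subrK scale1r.
  have b2 : smooth (fun y => 1 - b y ^+ 2).
    by apply: smoothB; [exact: smooth_cst|exact: smoothM].
  rewrite TD; [|exact: smooth_secZ|by apply: smooth_sec_sum => // a; exact: cs].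
  rewrite (Tsum _ _ (fun a y => b y * coord (frame i y) a (u y))) //; last by move=>
      a; exact: cs.
  rewrite TZ // (nbhs_singleton b1) expr1n subrr mul0r add0r big1 // => a _.
  by rewrite u0 linear0 mulr0 mul0r.
move=> ss ts st; have Nt : smooth_sec (fun y => -1 *: t y).
  by apply: (@smooth_secZ (fun=> -1)) => //; exact: smooth_cst.
have -> : s = fun y => (s y + -1 *: t y) + t y.
  by apply: functional_extensionality_dep => y; rewrite scaleN1r subrK.
rewrite TD //; last exact: smooth_secD.
by rewrite Tz ?add0r //; [exact: smooth_secD|rewrite scaleN1r st subrr].
Qed.

Lemma tensorial_multi x k (T : ('I_k -> sec E) -> R) (v w : 'I_k -> sec E) :
  (forall i v s t, (forall j, smooth_sec (v j)) -> smooth_sec s -> smooth_sec t ->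
    T [eta v with i |-> fun y => s y + t y] = T [eta v with i |-> s] + T [eta v with
        i |-> t]) ->
  (forall i v f s, (forall j, smooth_sec (v j)) -> smooth f -> smooth_sec s ->
    T [eta v with i |-> fun y => f y *: s y] = f x * T [eta v with i |-> s]) ->
  (forall i, smooth_sec (v i)) -> (forall i, smooth_sec (w i)) ->
  (forall i, v i x = w i x) -> T v = T w.
Proof.
move=> TD TZ vs ws vw.
(* Hybrid families: [w] in the first [n] slots and [v] in the others. Consecutive ones differ in a
   single slot, where [tensorial] applies. *)
pose h (n : nat) (i : 'I_k) := if (i < n)%N then w i else v i.
have hs n i : smooth_sec (h n i) by rewrite /h; case: ifP.
suff H n : T v = T (h n).
  by rewrite (H k); congr T; apply: funext => i; rewrite /h ltn_ord.
elim: n => [|n ->]; first by congr T; apply: funext => i.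
have [nk|kn] := ltnP n k; last first.
  congr T; apply: funext => i; rewrite /h !(leq_trans (ltn_ord i)) //.
  exact: leqW.
pose i0 := Ordinal nk.
have -> : h n.+1 = [eta h n with i0 |-> w i0].
  apply: funext => i /=; rewrite /h ltnS leq_eqVlt -(inj_eq val_inj) /=.
  by case: eqP => // ei; congr w; exact: val_inj.
have {1}-> : h n = [eta h n with i0 |-> v i0].
  apply: funext => i /=; case: eqP => // ->; by rewrite /h /= ltnn.
apply: (@tensorial x (fun s => T [eta h n with i0 |-> s])) => //.
- by move=> *; exact: TD.
- by move=> *; exact: TZ.
Qed.

Lemma smooth_form_app_at k (al : lform E k) x (s : 'I_k -> sec E) : smooth_form al ->
  (forall i, smooth_sec_at x (s i)) -> smooth_at x (fun y => al y (fun i => s i y)).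
Proof.
move=> [aa als] ss; have [i ix] := frame_cover E x.
have : smooth_at x (fun y => \sum_(J : {ffun 'I_k -> 'I_m})
    (\prod_l coord (frame i y) (J l) (s l y)) * al y (fun l => tnth (frame i y) (J l))).
  apply: smooth_at_sum => J _; apply: smooth_atM.
    by apply: smooth_at_prod => l _; exact: ss.
  by have /(smooth_onP _ (@frame_dom_open _ _ _ _ _ i)) := als i J; apply.
apply: smooth_at_eq; apply: (@filterS _ (nbhs x) _ _ _ _ (frame_dom_near ix)) => y iy.
have -> : (fun l => s l y) = fun l => \sum_a coord (frame i y) a (s l y) *: tnth
    (frame i y) a.
  apply: funext => l; rewrite [LHS](frame_pair_frame iy); apply: eq_bigr => a _.
  by rewrite coframeE.
by rewrite (multilinear_expand _ (fun=> tnth (frame i y)) (alternating_lin (aa y))).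
Qed.

Lemma smooth_form_app k (al : lform E k) (s : 'I_k -> sec E) : smooth_form al ->
  (forall i, smooth_sec (s i)) -> smooth (fun y => al y (fun i => s i y)).
Proof.
move=> als ss; apply/smoothP => x; apply: smooth_form_app_at => // i.
by move/smooth_secP: (ss i).
Qed.

Lemma smooth_formP k (al : lform E k) : (forall x, alternating (al x)) ->
  (forall x (s : 'I_k -> sec E), (forall i, smooth_sec_at x (s i)) ->
     smooth_at x (fun y => al y (fun i => s i y))) -> smooth_form al.
Proof.
move=> aa als; split=> // i J.
apply/(smooth_onP _ (@frame_dom_open _ _ _ _ _ i)) => x ix.
by apply: als => l; exact: smooth_sec_at_frame.
Qed.

End Bundle.

(** * The dual bundle *)

Section DualBundle.
Context (R : realType) (d : nat) (M : manifold R d) (m : nat) (E : vbundle M m).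

Lemma coframe_free (i : frame_index E) x (k : 'I_m -> R) b : frame_dom i x ->
  (\sum_a k a *: coframe i x a) (tnth (frame i x) b) = k b :> R.
Proof.
move=> ix; have fr : free (frame i x) by have /andP[] := frame_basis ix.
rewrite sum_lfunE (bigD1 b) //= big1 ?addr0 => [|a ab].
  by rewrite scale_lfunE coframeE (tnth_nth 0) (coord_free _ _ fr) eqxx [LHS]mulr1.
by rewrite scale_lfunE coframeE (tnth_nth 0) (coord_free _ _ fr) eq_sym (negbTE ab)
    [LHS]mulr0.
Qed.

Lemma coframe_basis (i : frame_index E) x : frame_dom i x ->
  basis_of {:dualv (fib E x)} [tuple coframe i x a | a < m].
Proof.
move=> ix; apply/andP; split.
  rewrite eqEsubv subvf /=; apply/subvP => c _.
  rewrite (frame_pair_dual (frame_pair_frame ix) c); apply: memv_suml => a _.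
  by apply/memvZ/memv_span/mapP; exists a; rewrite ?mem_enum.
apply/freeP => k k0 b.
rewrite -(coframe_free k b ix).
have -> : \sum_a k a *: coframe i x a = 0 :> dualv (fib E x).
  rewrite -[RHS]k0; apply: eq_bigr => a _.
  by rewrite -(tnth_nth 0 [tuple coframe i x a | a < m]) tnth_mktuple.
by rewrite lfunE.
Qed.

Lemma coord_coframe (i : frame_index E) x (c : dualv (fib E x)) a : frame_dom i x ->
  coord [tuple coframe i x a | a < m] a c = c (tnth (frame i x) a) :> R.
Proof.
move=> ix; have fr : free [tuple coframe i x a | a < m].
  by have /andP[] := coframe_basis ix.
rewrite {1}(frame_pair_dual (frame_pair_frame ix) c).
apply: etrans (coord_sum_free (fun b => c (tnth (frame i x) b) : R) a fr).
by congr (coord _ _ _); apply: eq_bigr => b _; rewrite -tnth_nth tnth_mktuple.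
Qed.

Lemma coframe_transition (i j : frame_index E) (a b : 'I_m) :
  smooth_on (frame_dom i `&` frame_dom j)
    (fun x => coord [tuple coframe i x a | a < m] a (tnth [tuple coframe j x a | a <
        m] b)).
Proof.
have oij : open (frame_dom i `&` frame_dom j) by apply: openI; exact: frame_dom_open.
apply: (@smooth_on_eq _ _ _ _ (fun x => coord (frame j x) b (tnth (frame i x) a))) =>
    //.
  by move=> x [ix jx]; rewrite coord_coframe // tnth_mktuple coframeE.
by rewrite setIC; exact: frame_transition.
Qed.

(** With the dual realised as a [vbundle], covector fields are its sections and multisections are
    its forms, so the results on sections and forms carry over. *)
Definition dual_bundle : vbundle M m :=
  @Vbundle R d M m (fun x => dualv (fib E x)) (frame_index E) (@frame_dom _ _ _ _ E)
    (fun i x => [tuple coframe i x a | a < m]) (@frame_dom_open _ _ _ _ E)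
    (@frame_cover _ _ _ _ E) coframe_basis coframe_transition.

Lemma smooth_cosecP (c : cosec E) :
  smooth_cosec c <-> smooth_sec (c : sec dual_bundle).
Proof.
have oi (i : frame_index E) : open (frame_dom i `&` setT).
  by apply: openI; [exact: frame_dom_open|exact: openT].
split=> cs i a; apply: smooth_on_eq (oi i) _ (cs i a) => x [ix _] /=.
  by rewrite coord_coframe.
by rewrite coord_coframe.
Qed.

Lemma smooth_multivecP k (xi : multivec E k) :
  smooth_multivec xi <-> smooth_form (xi : lform dual_bundle k).
Proof.
by split=> -[xa xs]; split=> // i J; apply: smooth_on_eq (@frame_dom_open _ _ _ _ _
    i) _ (xs i J) => x ix /=;
  congr (xi x _); apply: funext => j; rewrite tnth_mktuple.
Qed.

Lemma ext_covP x (c : dualv (fib E x)) : smooth_cosec (ext_cov c) /\ ext_cov c x = c.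
Proof.
have [s [/smooth_cosecP ss sx]] := @sec_ext_exists _ _ _ _ dual_bundle x c.
exact: (@xgetPex {classic cosec E} (fun=> 0) [set s | smooth_cosec (s : cosec E) /\ s
    x = c] (ex_intro _ s (conj ss sx))).
Qed.

End DualBundle.

(** * Calculus on a Lie algebroid *)

(** The functions fed to [linfun] here are linear only by a proof, so a linear map has to be packed
    before it can be evaluated. *)
Lemma linfunE (R : realType) (V : vectType R) (f : V -> R^o) :
  (forall c u v, f (c *: u + v) = c * f u + f v) -> forall v, linfun f v = f v :> R.
Proof.
move=> fl v.
pose fL : {linear V -> R^o} := HB.pack f (GRing.isLinear.Build R V R^o _ f fl).
exact: (lfunE fL v).
Qed.

Section Algebroid.
Context (R : realType) (d : nat) (M : manifold R d) (m : nat).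
Context (A : lie_algebroid M m).
Implicit Types (f g h : M -> R) (x y : M) (X Y Z : sec A).

Lemma dfunE f x (v : fib A x) : smooth f -> dfun A f x v = anchor v f :> R.
Proof. by move=> fs; apply: linfunE => c u w; exact: anchor_linear. Qed.

Lemma along_smooth X f : smooth_sec X -> smooth f -> smooth (along X f).
Proof. exact: anchor_smooth. Qed.

Lemma smooth_cosec_app_at (c : cosec A) x X : smooth_cosec c -> smooth_sec_at x X ->
  smooth_at x (fun y => c y (X y) : R).
Proof.
move=> /smooth_cosecP/smooth_secP/(_ x) cs Xs; have [i ix] := frame_cover A x.
have : smooth_at x (fun y => \sum_a coord (frame i y) a (X y) *
    (coord (frame (v := dual_bundle A) i y) a (c y) : R)).
  by apply: smooth_at_sum => a _; apply: smooth_atM; [exact: Xs|exact: cs].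
apply: smooth_at_eq; apply: (@filterS _ (nbhs x) _ _ _ _ (frame_dom_near ix)) => y iy.
rewrite {2}(frame_pair_frame iy (X y)) (linear_sum (c y : 'Hom(_, R^o))).
by apply: eq_bigr => a _; rewrite [RHS]dualZ coframeE coord_coframe.
Qed.

Lemma smooth_dfun f : smooth f -> smooth_cosec (dfun A f).
Proof.
move=> fs i a; have oi : open (frame_dom i `&` setT).
  by apply: openI; [exact: frame_dom_open|exact: openT].
apply/(smooth_onP _ oi) => x [ix _].
have [j [b [[bs b1] jx es _ _]]] := frame_bump A x.
have [b' [bs' b1' b0']] := exists_bump (@frame_dom_open _ _ _ _ _ i) ix.
have Xs : smooth_sec (fun y => b' y *: tnth (frame i y) a).
  by apply: smooth_sec_cutoff bs' b0' _ => y iy; exact: smooth_sec_at_frame.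
have /smoothP/(_ x) := along_smooth Xs fs.
apply: smooth_at_eq; apply: (@filterS _ (nbhs x) _ _ _ _ b1') => y by1.
by rewrite /along by1 scale1r dfunE.
Qed.

Lemma anchorZ x c (v : fib A x) f : smooth f -> anchor (c *: v) f = c * anchor v f.
Proof. by move=> fs; rewrite -!dfunE // dualZ. Qed.

Lemma anchorD x (u v : fib A x) f : smooth f -> anchor (u + v) f = anchor u f +
    anchor v f.
Proof. by move=> fs; rewrite -!dfunE // dualD. Qed.

Lemma anchorN x (v : fib A x) f : smooth f -> anchor (- v) f = - anchor v f.
Proof. by move=> fs; rewrite -scaleN1r anchorZ // mulN1r. Qed.

Lemma bracketDl X Y Z x : smooth_sec X -> smooth_sec Y -> smooth_sec Z ->
  bracket (fun y => X y + Y y) Z x = bracket X Z x + bracket Y Z x.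
Proof.
move=> Xs Ys Zs; rewrite -[in RHS](scale1r (bracket X Z x)) -bracket_linear //.
by congr (bracket _ Z x); apply: functional_extensionality_dep => y; rewrite scale1r.
Qed.

Lemma bracketZl X Y f x : smooth_sec X -> smooth_sec Y -> smooth f ->
  bracket (fun y => f y *: X y) Y x = f x *: bracket X Y x - anchor (Y x) f *: X x.
Proof.
move=> Xs Ys fs; rewrite bracket_anti //; last exact: smooth_secZ.
rewrite (bracket_leibniz Ys Xs fs) opprD -scalerN -bracket_anti //.
Qed.

Lemma bracketDr X Y Z x : smooth_sec X -> smooth_sec Y -> smooth_sec Z ->
  bracket Z (fun y => X y + Y y) x = bracket Z X x + bracket Z Y x.
Proof.
move=> Xs Ys Zs; rewrite bracket_anti //; last exact: smooth_secD.
by rewrite bracketDl // opprD -!bracket_anti.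
Qed.

(** With [Z = X - X'] and a bump function [b] supported where [Z = 0], one has [X = (1 - b) Z + X'].
    Both [1 - b] and [Z] vanish at [x], which kills the two terms of the Leibniz rule. *)
Lemma bracket_local X X' Y x : smooth_sec X -> smooth_sec X' -> smooth_sec Y ->
  (\near x, X x = X' x) -> bracket X Y x = bracket X' Y x.
Proof.
move=> Xs Xs' Ys; rewrite /prop_near1 nbhsE => -[V [oV Vx] XX'].
have [b [bs b1 b0]] := exists_bump oV Vx.
pose Z y := X y + -1 *: X' y.
have Zs : smooth_sec Z by apply: smooth_secD => //; apply: (@smooth_secZ _ _ _ _ _
    (fun=> -1)) => //; exact: smooth_cst.
have cs : smooth (fun y => 1 - b y) by apply: smoothB => //; exact: smooth_cst.
have Zx : Z x = 0 by rewrite /Z XX' // scaleN1r subrr.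
have -> : X = fun y => (1 - b y) *: Z y + X' y.
  apply: functional_extensionality_dep => y; have [Vy|nVy] := pselect (V y).
    by rewrite /Z XX' // scaleN1r subrr scaler0 add0r.
  by rewrite (nbhs_singleton (b0 y nVy)) subr0 scale1r /Z scaleN1r subrK.
rewrite bracketDl //; last exact: smooth_secZ.
by rewrite bracketZl // Zx (nbhs_singleton b1) subrr scale0r scaler0 subrr add0r.
Qed.

Lemma anchor_local x (v : fib A x) f g : smooth f -> smooth g ->
  (\near x, f x = g x) -> anchor v f = anchor v g.
Proof. by move=> fs gs; apply: (tangent_local (anchor_tangent v)). Qed.

Lemma smooth_wedge_cov_at k (c : 'I_k -> cosec A) x (s : 'I_k -> sec A) :
  (forall i, smooth_cosec (c i)) -> (forall i, smooth_sec_at x (s i)) ->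
  smooth_at x (fun y => wedge_cov (fun i => c i y) (fun j => s j y)).
Proof.
move=> cs ss; apply: smooth_at_sum => p _; apply: smooth_atM; first exact:
    smooth_at_cst.
apply: smooth_at_prod => i _; have := smooth_cosec_app_at (cs i) (ss (p i)).
by apply: smooth_at_eq; near=> y; rewrite mxE.
Unshelve. all: by end_near. Qed.

Lemma smooth_form_wedge k (c : 'I_k -> cosec A) : (forall i, smooth_cosec (c i)) ->
  smooth_form (fun x => wedge_cov (fun i => c i x)).
Proof.
move=> cs; apply: smooth_formP => [x|x s ss]; first exact: wedge_cov_alt.
exact: smooth_wedge_cov_at.
Qed.

Lemma alternating_comb (V : vectType R) k (f g : kform V k) c :
  alternating f -> alternating g -> alternating (fun v => c * f v + g v : R).
Proof.
move=> [fl fa] [gl ga]; split=> [i v a u w|i j v ij vij].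
  by rewrite fl gl; ring.
by rewrite (fa i j) // (ga i j) // mulr0 addr0.
Qed.

Lemma smooth_form_comb k (al be : lform A k) h : smooth h ->
  smooth_form al -> smooth_form be -> smooth_form (fun x v => h x * al x v + be x v).
Proof.
move=> /smoothP hs als bes; apply: smooth_formP => [x|x s ss].
  by apply: alternating_comb; [have [] := als|have [] := bes].
by apply: smooth_atD; [apply: smooth_atM => //|]; exact: smooth_form_app_at.
Qed.

Lemma smooth_form0 k : smooth_form (fun x (_ : 'I_k -> fib A x) => 0 : R).
Proof.
apply: smooth_formP => [x|x s ss]; last exact: smooth_at_cst.
by split=> // i v c u w; rewrite mulr0 addr0.
Qed.

Lemma smooth_formZ k (al : lform A k) h : smooth h -> smooth_form al ->
  smooth_form (fun x v => h x * al x v).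
Proof.
move=> hs als; have := smooth_form_comb hs als (smooth_form0 k).
by congr smooth_form; apply: functional_extensionality_dep => x; apply: funext => v;
    rewrite addr0.
Qed.

Lemma smooth_formD k (al be : lform A k) : smooth_form al -> smooth_form be ->
  smooth_form (fun x v => al x v + be x v).
Proof.
move=> als bes; have := smooth_form_comb (smooth_cst M 1) als bes.
by congr smooth_form; apply: functional_extensionality_dep => x; apply: funext => v;
    rewrite mul1r.
Qed.

Lemma smooth_form_sum k (I : Type) (r : seq I) (al : I -> lform A k) :
  (forall a, smooth_form (al a)) -> smooth_form (fun x v => \sum_(a <- r) al a x v).
Proof.
move=> als; elim: r => [|a r IH].
  have := smooth_form0 k; congr smooth_form; apply: functional_extensionality_dep => x.
  by apply: funext => v; rewrite big_nil.
have := smooth_formD (als a) IH; congr smooth_form; apply: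
    functional_extensionality_dep => x.
by apply: funext => v; rewrite big_cons.
Qed.

Definition wedge_d k (f : 'I_k -> M -> R) : lform A k :=
  fun x => wedge_cov (fun i => dfun A (f i) x).

Arguments wedge_d {k} f x v.

Lemma smooth_wedge_d k (f : 'I_k -> M -> R) : (forall i, smooth (f i)) -> smooth_form
    (wedge_d f).
Proof. by move=> fs; apply: smooth_form_wedge => i; exact: smooth_dfun. Qed.

Lemma wedge_dE k (f : 'I_k -> M -> R) x v : (forall i, smooth (f i)) ->
  wedge_d f x v = \det (\matrix_(i, j) anchor (v j) (f i)).
Proof. by move=> fs; congr (\det _); apply/matrixP => i j; rewrite !mxE dfunE. Qed.

Lemma det_row_sub k (N P Q : 'M[R]_k) :
  \sum_l \det (\matrix_(i, j) if i == l then P i j - Q i j else N i j) =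
  \sum_l \det (\matrix_(i, j) if i == l then P i j else N i j) -
  \sum_l \det (\matrix_(i, j) if i == l then Q i j else N i j).
Proof.
rewrite -sumrB; apply: eq_bigr => l _.
rewrite (@determinant_multilinear _ _ _ (\matrix_(i, j) if i == l then P i j else N i j)
  (\matrix_(i, j) if i == l then Q i j else N i j) l 1 (-1)).
- by rewrite mul1r mulN1r.
- by apply/rowP => j; rewrite !mxE eqxx mul1r mulN1r.
- by apply/matrixP => i j; rewrite !mxE eq_sym (negbTE (neq_lift _ _)).
- by apply/matrixP => i j; rewrite !mxE eq_sym (negbTE (neq_lift _ _)).
Qed.

(** Differentiating the determinant row by row yields the entries [X (V_j f_i)], and each bracket
    replaces a column by the entries [X (V_j f_i) - V_j (X f_i)]. By [det_replace] the columns may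
    be traded for rows, and only the rows [V_j (X f_i)] survive. The sections [V] are arbitrary, so
    that independence of the extensions can later be deduced. *)
Lemma lie_eval_wedge_d X g k (f : 'I_k -> M -> R) (V : 'I_k -> sec A) x :
  smooth_sec X -> smooth g -> (forall i, smooth (f i)) -> (forall i, smooth_sec (V
      i)) ->
  along X (fun y => g y * wedge_d f y (fun i => V i y)) x -
  \sum_(l < k) g x * wedge_d f x [eta (fun i => V i x) with l |-> bracket X (V l) x] =
  along X g x * wedge_d f x (fun i => V i x) +
  g x * \sum_j wedge_d [eta f with j |-> along X (f j)] x (fun i => V i x).
Proof.
move=> Xs gs fs Vs; have vf i j : smooth (along (V j) (f i)) by exact: along_smooth.
have D := anchor_tangent (X x).
have -> : (fun y => g y * wedge_d f y (fun i => V i y)) =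
          (fun y => g y * \det (\matrix_(i, j) along (V j) (f i) y)).
  by apply: funext => y; rewrite wedge_dE.
rewrite {1}/along (tangentM D gs (smooth_det (a := fun i j => along (V j) (f i)) vf)).
rewrite (tangent_det D (a := fun i j => along (V j) (f i)) vf) -addrA.
rewrite -(wedge_dE (fun j => V j x) fs); congr (_ + _).
rewrite -mulr_sumr -mulrBr; congr (_ * _).
pose N := \matrix_(i < k, j < k) along (V j) (f i) x.
pose P := \matrix_(i < k, j < k) along X (along (V j) (f i)) x.
pose Q := \matrix_(i < k, j < k) along (V j) (along X (f i)) x.
have -> : \sum_l \det (\matrix_(i, j) if i == l then anchor (X x) (along (V j) (f i))
    else along (V j) (f i) x) =
    \sum_l \det (\matrix_(i, j) if i == l then P i j else N i j).
  by apply: eq_bigr => l _; congr (\det _); apply/matrixP => i j; rewrite !mxE.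
have -> : \sum_l wedge_d f x [eta (fun i => V i x) with l |-> bracket X (V l) x] =
    \sum_l \det (\matrix_(i, j) if j == l then (P - Q) i j else N i j).
  apply: eq_bigr => l _; rewrite wedge_dE //; congr (\det _); apply/matrixP => i j;
      rewrite !mxE /=.
  by case: eqP => // ->; rewrite anchor_bracket.
rewrite det_replace.
have -> : \sum_l \det (\matrix_(i, j) if i == l then (P - Q) i j else N i j) =
    \sum_l \det (\matrix_(i, j) if i == l then P i j - Q i j else N i j).
  by apply: eq_bigr => l _; congr (\det _); apply/matrixP => i j; rewrite !mxE.
rewrite det_row_sub opprB addrC subrK; apply: eq_bigr => l _.
rewrite wedge_dE => [|i /=]; last by case: eqP => // _; exact: along_smooth.
by congr (\det _); apply/matrixP => i j; rewrite !mxE /=; case: eqP => // ->.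
Qed.

Lemma lie_form_wedge_d X g k (f : 'I_k -> M -> R) x v :
  smooth_sec X -> smooth g -> (forall i, smooth (f i)) ->
  lie_form X (fun y w => g y * wedge_d f y w) v =
  along X g x * wedge_d f x v + g x * \sum_j wedge_d [eta f with j |-> along X (f j)]
      x v.
Proof.
move=> Xs gs fs; have vE : v = fun i => ext (v i) x by apply: funext => i; rewrite
    ext_at.
have Vs i : smooth_sec (ext (v i)) by exact: smooth_ext.
have := lie_eval_wedge_d x Xs gs fs Vs; rewrite /= -vE => <-.
by rewrite /lie_form; congr (_ - _); apply: eq_bigr => i _.
Qed.

(** Expansion along the row of [g] accounts for the terms with [V_r g]; everything else contains
    second derivatives and must cancel. For [r < s] the bracket contributes both orders of
    differentiation: [F r s] cancels against the action of [V r], and [F s r] against the action of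
    [V s] by [det_cofactor_swap]. *)
Lemma dform_wedge_d g k (f : 'I_k -> M -> R) x v : smooth g -> (forall i, smooth (f
    i)) ->
  dform (fun y w => g y * wedge_d f y w) v = wedge_d (fcons g f) x v.
Proof.
move=> gs fs; pose V i := ext (v i); have Vs i : smooth_sec (V i) by exact: smooth_ext.
have Vx i : V i x = v i by exact: ext_at.
have -> : wedge_d (fcons g f) x v = \sum_(r < k.+1) (-1) ^+ r * along (V r) g x *
    wedge_d f x (fun i => v (lift r i)).
  rewrite /wedge_d (_ : (fun i => dfun A (fcons g f i) x) = fcons (dfun A g x) (fun i
      => dfun A (f i) x)).
    rewrite wedge_cov_fcons; apply: eq_bigr => r _; congr (_ * _ * _).
    by rewrite /along Vx dfunE.
  by apply: fconsP => [|i]; rewrite ?fcons0 ?fconsS.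
rewrite /dform /leibniz_diff -/V.
(* [F] holds the second derivatives; [T r s w] is the minor without row [r] in which row [s] is
   replaced by [w]. *)
pose F (r i : 'I_k.+1) (j : 'I_k) := along (V r) (along (V i) (f j)) x.
pose W r j := along (V r) (f j) x.
pose T (r s : 'I_k.+1) (w : 'I_k -> R) := \det (\matrix_(i < k, j < k) if lift r i ==
    s then w j else W (lift r i) j).
have E (r : 'I_k.+1) : along (V r) (fun y => g y * wedge_d f y (fun i => V (lift r i)
    y)) x =
    along (V r) g x * wedge_d f x (fun i => v (lift r i)) + g x * \sum_(s | s != r) T
        r s (F r s).
  have -> : (fun y => g y * wedge_d f y (fun i => V (lift r i) y)) =
      (fun y => g y * \det (\matrix_(i, j) along (V (lift r i)) (f j) y)).
    by apply: funext => y; rewrite wedge_dE // -det_tr; congr (_ * \det _);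
        apply/matrixP => i j; rewrite !mxE.
  have D := anchor_tangent (V r x).
  have vf' i j : smooth (along (V (lift r i)) (f j)) by exact: along_smooth.
  rewrite {1}/along (tangentM D gs (smooth_det (a := fun i j => along (V (lift r i))
      (f j)) vf')).
  rewrite (tangent_det D (a := fun i j => along (V (lift r i)) (f j)) vf').
  congr (_ * _ + _ * _).
    rewrite wedge_dE // -det_tr; congr (\det _); apply/matrixP => i j; rewrite !mxE.
    by rewrite /along Vx.
  transitivity (\sum_(l < k) T r (lift r l) (F r (lift r l))).
    apply: eq_bigr => l _; congr (\det _); apply/matrixP => i j; rewrite !mxE (inj_eq
        lift_inj).
    by case: eqP => // ->.
  have D1 : \sum_s T r s (F r s) = T r r (F r r) + \sum_(s | s != r) T r s (F r s) by
      rewrite (bigD1 r).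
  by apply: (addrI (T r r (F r r))); rewrite -D1 (bigD1_ord r).
have B (r s : 'I_k.+1) : (r < s)%N -> g x * wedge_d f x (fun i => if lift r i == s
    then bracket (V r) (V s) x else V (lift r i) x) =
    g x * (T r s (F r s) - T r s (F s r)).
  move=> rs; congr (_ * _); rewrite wedge_dE // -det_tr.
  have sr : s != r by rewrite -(inj_eq val_inj) /= gtn_eqF.
  case: (unliftP r s) sr => [l ->|->]; last by rewrite eqxx.
  move=> _; rewrite /T.
  rewrite (@determinant_multilinear _ _ _
    (\matrix_(i, j) if lift r i == lift r l then F r (lift r l) j else W (lift r i) j)
    (\matrix_(i, j) if lift r i == lift r l then F (lift r l) r j else W (lift r i)
        j) l 1 (-1)).
  - by rewrite mul1r mulN1r.
  - by apply/rowP => j; rewrite !mxE eqxx mul1r mulN1r anchor_bracket.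
  - by apply/matrixP => i j; rewrite !mxE (inj_eq lift_inj) eq_sym (negbTE (neq_lift
      _ _)).
  - by apply/matrixP => i j; rewrite !mxE (inj_eq lift_inj) eq_sym (negbTE (neq_lift
      _ _)).
rewrite /dform /leibniz_diff -/V.
under eq_bigr do rewrite E mulrDr mulrA.
rewrite big_split /= -addrA -[RHS]addr0; congr (_ + _).
have -> : \sum_(r < k.+1) \sum_(s < k.+1 | (r < s)%N) (-1) ^+ r.+1 *
    (g x * wedge_d f x (fun i => (if lift r i == s then bracket (V r) (V s) else V
        (lift r i)) x)) =
  \sum_(r < k.+1) \sum_(s < k.+1 | (r < s)%N) (-1) ^+ r.+1 * (g x * (T r s (F r s) -
      T r s (F s r))).
  apply: eq_bigr => r _; apply: eq_bigr => s rs; rewrite -B //; congr (_ * (_ *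
      wedge_d _ _ _)).
  by apply: funext => i; case: ifP.
have -> : \sum_(i < k.+1) (-1) ^+ i * (g x * \sum_(s | s != i) T i s (F i s)) =
   \sum_(i < k.+1) \sum_(s < k.+1 | (i < s)%N) (-1) ^+ i * (g x * T i s (F i s)) +
   \sum_(i < k.+1) \sum_(s < k.+1 | (s < i)%N) (-1) ^+ i * (g x * T i s (F i s)).
  rewrite -big_split /=; apply: eq_bigr => i _.
  rewrite (bigID (fun s : 'I_k.+1 => (i < s)%N)) /= mulrDr mulrDr !mulr_sumr.
  by congr (_ + _); apply: eq_bigl => s; rewrite -(inj_eq val_inj) /=; case: ltngtP.
(* The action terms with [s < i] are transposed, so that all three sums run over the same pairs and
   cancel pair by pair. *)
rewrite [X in _ + X + _](exchange_big_dep xpredT) //= -addrA addrC -!big_split /=.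
apply: big1 => r _; rewrite -!big_split /=; apply: big1 => s rs.
have sr : s != r by rewrite -(inj_eq val_inj) /= gtn_eqF.
have C : (-1) ^+ s * T s r (F s r) = - ((-1) ^+ r * T r s (F s r)).
  exact: det_cofactor_swap.
rewrite mulrCA C exprS mulN1r; move: ((-1) ^+ r) => z; ring.
Qed.

End Algebroid.
Arguments wedge_d {R d M m} A {k} f x v.

(** * Additivity and locality of the operators on forms *)

Section FormCalculus.
Context (R : realType) (d : nat) (M : manifold R d) (m : nat).
Context (A : lie_algebroid M m).
Implicit Types (f g h : M -> R) (x y : M) (X Y Z : sec A).

Lemma lform_ext k (al be : lform A k) : (forall x v, al x v = be x v) -> al = be.
Proof.
by move=> ab; apply: functional_extensionality_dep => x; apply: funext => v.
Qed.

Lemma smooth_form_ext k (al : lform A k) x (v : 'I_k -> fib A x) :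
  smooth_form al -> smooth (fun y => al y (fun i => ext (v i) y)).
Proof. by move=> als; apply: smooth_form_app => // i; exact: smooth_ext. Qed.

Lemma lie_formD X k (al be : lform A k) x (v : 'I_k -> fib A x) : smooth_form al ->
    smooth_form be ->
  lie_form X (fun y w => al y w + be y w) v = lie_form X al v + lie_form X be v :> R.
Proof.
move=> als bes; rewrite /lie_form {1}/along (tangentD (anchor_tangent (X x)));
  [|exact: smooth_form_ext..].
by rewrite big_split opprD addrACA.
Qed.

Lemma lie_form_local X k (al be : lform A k) x (v : 'I_k -> fib A x) : smooth_form al
    -> smooth_form be ->
  (\near x, al x = be x) -> lie_form X al v = lie_form (x := x) X be v.
Proof.
move=> als bes ab; rewrite /lie_form /along (nbhs_singleton ab).
congr (_ - _); apply: anchor_local; [exact: smooth_form_ext..|].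
by apply: (@filterS _ (nbhs x) _ _ _ _ ab) => y ->.
Qed.

Lemma lie_formDl X Y k (al : lform A k) x (v : 'I_k -> fib A x) : smooth_sec X ->
    smooth_sec Y -> smooth_form al ->
  lie_form (fun y => X y + Y y) al v = lie_form X al v + lie_form (x := x) Y al v.
Proof.
move=> Xs Ys als; rewrite /lie_form /along anchorD; last exact: smooth_form_ext.
rewrite addrACA -opprD -big_split /=; congr (_ - _); apply: eq_bigr => i _.
rewrite bracketDl //; last exact: smooth_ext.
by rewrite (multilinearD _ _ _ _ (alternating_lin (als.1 x))).
Qed.

Lemma lie_form_localX X Y k (al : lform A k) x (v : 'I_k -> fib A x) : smooth_sec X
    -> smooth_sec Y ->
  (\near x, X x = Y x) -> lie_form X al v = lie_form (x := x) Y al v.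
Proof.
move=> Xs Ys XY; rewrite /lie_form /along (nbhs_singleton XY); congr (_ - _).
apply: eq_bigr => i _; congr (al x _); apply: funext => j /=; case: eqP => // _.
by apply: bracket_local => //; exact: smooth_ext.
Qed.

Lemma dformD k (al be : lform A k) x (v : 'I_k.+1 -> fib A x) : smooth_form al ->
    smooth_form be ->
  dform (fun y w => al y w + be y w) v = dform al v + dform (x := x) be v.
Proof.
move=> als bes; rewrite /dform /leibniz_diff [RHS]addrACA; congr (_ + _); rewrite
    -big_split /=.
  apply: eq_bigr => r _; rewrite {1}/along (tangentD (anchor_tangent _)) ?mulrDr //.
    by apply: (smooth_form_ext (fun i => v (lift r i))).
  by apply: (smooth_form_ext (fun i => v (lift r i))).
apply: eq_bigr => r _; rewrite -big_split /=; apply: eq_bigr => s _.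
by rewrite mulrDr.
Qed.

Lemma dform_local k (al be : lform A k) x (v : 'I_k.+1 -> fib A x) : smooth_form al
    -> smooth_form be ->
  (\near x, al x = be x) -> dform al v = dform (x := x) be v.
Proof.
move=> als bes ab; rewrite /dform /leibniz_diff; congr (_ + _).
  apply: eq_bigr => r _; congr (_ * _); apply: anchor_local.
  - by apply: (smooth_form_ext (fun i => v (lift r i))).
  - by apply: (smooth_form_ext (fun i => v (lift r i))).
  - by apply: (@filterS _ (nbhs x) _ _ _ _ ab) => y ->.
apply: eq_bigr => r _; apply: eq_bigr => s _; congr (_ * _).
by rewrite (nbhs_singleton ab).
Qed.

(* Over a neighbourhood of [x] every form is a combination of exact ones, by
   [locally_spanned_by_exact]. *)
Lemma form_ind (hspan : locally_spanned_by_exact A) x k (P : lform A k -> Prop) :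
  (forall al be, smooth_form al -> smooth_form be -> (\near x, al x = be x) -> P al
      -> P be) ->
  (forall al be, smooth_form al -> smooth_form be -> P al -> P be ->
     P (fun y w => al y w + be y w)) ->
  (forall h (f : 'I_k -> M -> R), smooth h -> (forall i, smooth (f i)) ->
     P (fun y w => h y * wedge_d A f y w)) ->
  forall al, smooth_form al -> P al.
Proof.
move=> Pnear PD Pwd.
have P0 : P (fun _ _ => 0).
  have f0 : forall i : 'I_k, smooth ((fun _ _ => 0) i : M -> R) by move=> i; exact:
      smooth_cst.
  have := Pwd (fun=> 0) (fun _ _ => 0) (smooth_cst M 0) f0.
  by congr P; apply: lform_ext => y w; rewrite mul0r.
have Psum (I : Type) (r : seq I) (al : I -> lform A k) : (forall a, smooth_form (al
    a)) ->
    (forall a, P (al a)) -> P (fun y w => \sum_(a <- r) al a y w).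
  move=> als Pal; elim: r => [|a r IH].
    by move: P0; congr P; apply: lform_ext => y w; rewrite big_nil.
  have := PD _ _ (als a) (smooth_form_sum r als) (Pal a) IH.
  by congr P; apply: lform_ext => y w; rewrite big_cons.
(* At most the first [n] factors are not yet exact. The induction step expands the last of these
   over [U], with coefficients cut off by a bump function to make them global. *)
have Pcov n : (n <= k)%N -> forall h (c : 'I_k -> cosec A), smooth h -> (forall i,
    smooth_cosec (c i)) ->
    (forall i : 'I_k, (n <= i)%N -> exists2 f, smooth f & c i = dfun A f) ->
    P (fun y w => h y * wedge_cov (fun i => c i y) w).
  elim: n => [|n IH] nk h c hs cs cf.
    have cf0 i : exists f, smooth f /\ c i = dfun A f by have [f] := cf i isT; exists f.
    have [f fE] := choice cf0; have := Pwd h f hs (fun i => (fE i).1).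
    congr P; apply: lform_ext => y w; congr (_ * wedge_cov _ _).
    by apply: funext => i; rewrite (fE i).2.
  pose i0 := Ordinal nk; have [U [oU Ux spanU]] := hspan x.
  have cU : smooth_cosec_on U (c i0).
    by move=> i a; apply: smooth_on_sub (cs i0 i a) => y [].
  have [r [f [g [fs gs cE]]]] := spanU _ cU.
  have [b [bs b1 b0]] := exists_bump oU Ux.
  pose be j : lform A k := fun y w => (h y * (b y * g j y)) * wedge_cov (fun i =>
      [eta c with i0 |-> dfun A (f j)] i y) w.
  have bgs j : smooth (fun y => b y * g j y).
    apply: smooth_cutoff bs b0 _ => y Uy.
    by have /(smooth_onP _ oU) := gs j; apply.
  have cs' j i : smooth_cosec ([eta c with i0 |-> dfun A (f j)] i).
    by move=> /=; case: eqP => _; [exact: smooth_dfun|exact: cs].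
  have hbs j : smooth (fun y => h y * (b y * g j y)) by apply: smoothM.
  have bes j : smooth_form (be j).
    by apply: (smooth_formZ (hbs j)); exact: (smooth_form_wedge (cs' j)).
  have als : smooth_form (fun y w => h y * wedge_cov (fun i => c i y) w).
    by apply: (smooth_formZ hs); exact: smooth_form_wedge.
  apply: (Pnear _ _ (smooth_form_sum (index_enum 'I_r) bes) als).
    have nU : \near x, U x by exact: open_nbhs_nbhs.
    apply: (@filterS _ (nbhs x) _ _ _ _ (filterI b1 nU)) => y [by1 Uy].
    apply: funext => w; rewrite /be by1.
    have -> : (fun i => c i y) = [eta (fun i => c i y) with i0 |-> \sum_j g j y *:
        dfun A (f j) y].
      by apply: funext => i /=; case: eqP => // ->; rewrite cE.
    rewrite (multilinear_sum (f := fun c => wedge_cov c w) _ _ _ _ (alternating_lin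
        (wedge_cov_alt_cov w))).
    rewrite mulr_sumr; apply: eq_bigr => j _; rewrite mul1r mulrA; congr (_ *
        wedge_cov _ _).
    by apply: funext => i /=; case: eqP.
  apply: Psum => // j; apply: (IH (ltnW nk) _ _ (hbs j) (cs' j)) => i.
  rewrite leq_eqVlt => /orP[ni|ni].
    by exists (f j) => //=; rewrite ifT // -(inj_eq val_inj) /= eq_sym.
  have [f' f's cf'] := cf i ni; exists f' => //=.
  by rewrite ifF // -(inj_eq val_inj) /= gtn_eqF.
move=> al als; have [i ix] := frame_cover A x.
have [b [bs b1 b0]] := exists_bump (@frame_dom_open _ _ _ _ A i) ix.
have es a : smooth_cosec (fun y => b y *: coframe i y a : dualv (fib A y)).
  apply/smooth_cosecP; apply: (@smooth_sec_cutoff _ _ _ _ (dual_bundle A) _ _ (fun y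
      => coframe i y a) bs b0) => y iy.
  have := @smooth_sec_at_frame _ _ _ _ (dual_bundle A) i a y iy.
  by congr smooth_sec_at; apply: functional_extensionality_dep => z; rewrite
      tnth_mktuple.
(* The factor [1/k!] is there because the expansion runs over all index tuples, as in
   [sum_form_wedge]. *)
pose h (J : {ffun 'I_k -> 'I_m}) y := k`!%:R^-1 * (b y * al y (fun j => tnth (frame i
    y) (J j))).
have hs J : smooth (h J).
  apply: smoothM; first exact: smooth_cst.
  apply: smooth_cutoff bs b0 _ => y iy; apply: (smooth_form_app_at (s := fun j y =>
      tnth (frame i y) (J j)) als) => j.
  exact: smooth_sec_at_frame.
pose c (J : {ffun 'I_k -> 'I_m}) (j : 'I_k) : cosec A := fun y => b y *: coframe i y
    (J j).
have cs J j : smooth_cosec (c J j) by exact: es.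
pose be J : lform A k := fun y w => h J y * wedge_cov (fun j => c J j y) w.
have bes J : smooth_form (be J) by apply: (smooth_formZ (hs J)); exact:
    smooth_form_wedge.
apply: (Pnear _ _ (smooth_form_sum (index_enum _) bes) als).
  apply: (@filterS _ (nbhs x) _ _ _ _ (filterI b1 (frame_dom_near ix))) => y [by1 iy].
  apply: funext => w; apply: (mulfI (factR_neq0 R k)).
  rewrite -(sum_form_wedge w (frame_pair_frame iy) (als.1 y)) mulr_sumr.
  apply: eq_bigr => J _; rewrite /be /h by1 mul1r !mulrA mulfV ?factR_neq0 // mul1r.
  by congr (_ * wedge_cov _ _); apply: funext => j; rewrite /c by1 scale1r.
apply: Psum => // J; apply: (Pcov k (leqnn k)) => //= j kj.
by have := ltn_ord j; rewrite ltnNge kj.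
Qed.

End FormCalculus.

(** * Lie derivative of covector fields and Schouten bracket *)

Lemma dual_scale (R : realType) (V : vectType R) (c : dualv V) a (u : V) :
  (a *: c) u = a * c u :> R.
Proof. exact: scale_lfunE. Qed.

Section Schouten.
Context (R : realType) (d : nat) (M : manifold R d) (m : nat).
Context (A : lie_algebroid M m).
Implicit Types (f g h : M -> R) (x y : M) (X Y Z : sec A) (c : cosec A).

Lemma smooth_cosec_app c X : smooth_cosec c -> smooth_sec X ->
  smooth (fun y => c y (X y) : R).
Proof.
move=> cs /smooth_secP Xs; apply/smoothP => x; exact: smooth_cosec_app_at.
Qed.

(** [lie_cosec] uses a chosen extension of each vector. Its defining expression is linear over
    functions in [V], because the terms with the derivative of the function cancel; so every section
    with the same value at [x] gives the same result. The same fact supplies the linearity that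
    [linfun] requires. *)
Lemma lie_cosecE X c V x : smooth_sec X -> smooth_cosec c -> smooth_sec V ->
  lie_cosec X c x (V x) =
  along X (fun y => c y (V y) : R) x - c x (bracket X V x) :> R.
Proof.
move=> Xs cs Vs.
pose T W := along X (fun y => c y (W y) : R) x - (c x (bracket X W x) : R).
have TD s t : smooth_sec s -> smooth_sec t -> T (fun y => s y + t y) = T s + T t.
  move=> ss ts; rewrite /T bracketDr // dualD.
  have -> : (fun y => c y (s y + t y) : R) = (fun y => (c y (s y) : R) + c y (t y)).
    by apply: funext => y; exact: dualD.
  rewrite {1}/along (tangentD (anchor_tangent _)); [|exact: smooth_cosec_app..].
  by rewrite opprD addrACA.
have TZ f s : smooth f -> smooth_sec s -> T (fun y => f y *: s y) = f x * T s.
  move=> fs ss; rewrite /T bracket_leibniz // dualD !dualZ.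
  have -> : (fun y => c y (f y *: s y) : R) = (fun y => f y * (c y (s y) : R)).
    by apply: funext => y; exact: dualZ.
  rewrite {1}/along (tangentM (anchor_tangent _)) //; last exact: smooth_cosec_app.
  rewrite /along; ring.
have TE v : T (ext v) = along X (fun y => c y (ext v y)) x - c x (bracket X (ext v)
    x) :> R by [].
rewrite /lie_cosec linfunE => [|a u v]; last first.
  rewrite -!TE -(TZ (fun=> a) (ext u) (smooth_cst M a) (smooth_ext u)) -TD; [|by
      apply: smooth_secZ; [exact: smooth_cst|exact: smooth_ext]|exact: smooth_ext].
  apply: (tensorial TD TZ) => //; first exact: smooth_ext.
    by apply: smooth_secD; [apply: smooth_secZ; [exact: smooth_cst|]|]; exact:
        smooth_ext.
  by rewrite !ext_at.
rewrite -TE; apply: (tensorial TD TZ) => //; first exact: smooth_ext.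
by rewrite ext_at.
Qed.

Lemma cosec_eq x (c c' : dualv (fib A x)) :
  (forall V : sec A, smooth_sec V -> c (V x) = c' (V x) :> R) -> c = c'.
Proof.
move=> cc; apply/lfunP => v; rewrite -(ext_at v); apply: cc; exact: smooth_ext.
Qed.

Lemma smooth_cosecZ f c : smooth f -> smooth_cosec c -> smooth_cosec (fun y => f y *:
    c y).
Proof. by move=> fs /smooth_cosecP cs; apply/smooth_cosecP; exact: smooth_secZ. Qed.

Lemma smooth_cosecD c c' : smooth_cosec c -> smooth_cosec c' ->
  smooth_cosec (fun y => c y + c' y).
Proof. by move=> /smooth_cosecP cs /smooth_cosecP cs'; apply/smooth_cosecP; exact:
    smooth_secD. Qed.

Lemma lie_cosecD X c c' x : smooth_sec X -> smooth_cosec c -> smooth_cosec c' ->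
  lie_cosec X (fun y => c y + c' y) x = lie_cosec X c x + lie_cosec X c' x.
Proof.
move=> Xs cs cs'; apply: cosec_eq => V Vs.
rewrite [RHS]lfunE /= !lie_cosecE //; last exact: smooth_cosecD.
have -> : (fun y => (c y + c' y) (V y) : R) = (fun y => (c y (V y) : R) + c' y (V y)).
  by apply: funext => y; rewrite lfunE.
rewrite {1}/along (tangentD (anchor_tangent _)); [|exact: smooth_cosec_app..].
by rewrite lfunE /= opprD addrACA.
Qed.

Lemma lie_cosecZ X f c x : smooth_sec X -> smooth f -> smooth_cosec c ->
  lie_cosec X (fun y => f y *: c y) x = f x *: lie_cosec X c x + along X f x *: c x.
Proof.
move=> Xs fs cs; apply: cosec_eq => V Vs.
rewrite [RHS]dual_comb dual_scale !lie_cosecE //; last exact: smooth_cosecZ.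
have -> : (fun y => (f y *: c y) (V y) : R) = (fun y => f y * (c y (V y) : R)).
  by apply: funext => y; exact: dual_scale.
rewrite {1}/along (tangentM (anchor_tangent _)) //; last exact: smooth_cosec_app.
rewrite dual_scale /along; ring.
Qed.

Lemma lie_cosec_dfun X f x : smooth_sec X -> smooth f ->
  lie_cosec X (dfun A f) x = dfun A (along X f) x.
Proof.
move=> Xs fs; apply: cosec_eq => V Vs.
rewrite lie_cosecE //; last exact: smooth_dfun.
have -> : (fun y => dfun A f y (V y) : R) = along V f by apply: funext => y; rewrite
    dfunE.
rewrite !dfunE //; last exact: along_smooth.
by rewrite anchor_bracket // opprB addrC subrK.
Qed.

Section SchoutenEval.
Context (k : nat) (X : sec A) (xi : multivec A k).
Hypotheses (Xs : smooth_sec X) (xis : smooth_multivec xi).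
Arguments xi : clear implicits.

(** The bracket evaluated on arbitrary covector fields in place of the chosen extensions; being
    tensorial in each of them, it agrees with [schouten]. *)
Definition schouten_eval x (C : 'I_k -> cosec A) : R :=
  along X (fun y => xi y (fun i => C i y)) x -
  \sum_(i < k) xi x [eta (fun j => C j x) with i |-> lie_cosec X (C i) x].

Lemma smooth_multivec_app (C : 'I_k -> cosec A) : (forall i, smooth_cosec (C i)) ->
  smooth (fun y => xi y (fun i => C i y)).
Proof.
move=> Cs; apply: (@smooth_form_app _ _ _ _ (dual_bundle A) k xi C).
  exact/smooth_multivecP.
by move=> i; exact/smooth_cosecP.
Qed.

Let xl x : multilinear (xi x).
Proof. by have [/(_ x)/alternating_lin] := xis. Qed.

Let withE (C : 'I_k -> cosec A) i s y :
  (fun j => [eta C with i |-> s] j y) = [eta (fun j => C j y) with i |-> s y].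
Proof. by apply: funext => j /=; case: eqP. Qed.

Let smooth_with (C : 'I_k -> cosec A) i s : (forall j, smooth_cosec (C j)) ->
  smooth_cosec s -> forall j, smooth_cosec ([eta C with i |-> s] j).
Proof. by move=> Cs ss j /=; case: eqP => _; [exact: ss|exact: Cs]. Qed.

Lemma schouten_evalD x i (C : 'I_k -> cosec A) s t :
  (forall j, smooth_cosec (C j)) -> smooth_cosec s -> smooth_cosec t ->
  schouten_eval x [eta C with i |-> fun y => s y + t y] =
  schouten_eval x [eta C with i |-> s] + schouten_eval x [eta C with i |-> t].
Proof.
move=> Cs ss ts; rewrite /schouten_eval.
have -> : (fun y => xi y (fun j => [eta C with i |-> fun y => s y + t y] j y)) =
    (fun y => xi y (fun j => [eta C with i |-> s] j y) + xi y (fun j => [eta C with i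
        |-> t] j y)).
  by apply: funext => y; rewrite !withE multilinearD.
rewrite {1}/along (tangentD (anchor_tangent _));
    [|exact/smooth_multivec_app/smooth_with..].
rewrite addrACA -opprD -big_split /=; congr (_ - _); apply: eq_bigr => j _.
rewrite !withE; have [->|ji] := eqVneq j i.
  by rewrite !with_same lie_cosecD // multilinearD.
have ij : i != j by rewrite eq_sym.
by rewrite !(withC _ _ _ ij) multilinearD.
Qed.

(** Two terms contain [X f], one from the derivative of [xi] and one from the Lie derivative of
    [f s], and they cancel. The sum [F] collects the slots other than [i], which only carry the
    factor along. *)
Lemma schouten_evalZ x i (C : 'I_k -> cosec A) f s :
  (forall j, smooth_cosec (C j)) -> smooth f -> smooth_cosec s ->
  schouten_eval x [eta C with i |-> fun y => f y *: s y] =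
  f x * schouten_eval x [eta C with i |-> s].
Proof.
move=> Cs fs ss; rewrite /schouten_eval.
have -> : (fun y => xi y (fun j => [eta C with i |-> fun y => f y *: s y] j y)) =
    (fun y => f y * xi y (fun j => [eta C with i |-> s] j y)).
  by apply: funext => y; rewrite !withE multilinearZ.
rewrite {1}/along (tangentM (anchor_tangent _)) //; last
    exact/smooth_multivec_app/smooth_with.
pose F := \sum_(j | j != i) f x *
  xi x [eta [eta (fun l => C l x) with i |-> s x] with j |-> lie_cosec X (C j) x].
rewrite (bigD1 i) //= [in RHS](bigD1 i) //= !withE !eqxx !with_same.
rewrite lie_cosecZ // xl multilinearZ // mulrBr mulrDr mulr_sumr.
rewrite [X in _ - (_ + X)](_ : _ = F) 1?[in RHS](_ : \sum_(j | j != i) _ = F).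
- rewrite /along; ring.
- by apply: eq_bigr => j ji; rewrite (negbTE ji) ?withE.
- apply: eq_bigr => j ji; have ij : i != j by rewrite eq_sym.
  by rewrite (negbTE ji) ?withE !(withC _ _ _ ij) multilinearZ.
Qed.

Lemma schouten_eval_ext x (C C' : 'I_k -> cosec A) :
  (forall i, smooth_cosec (C i)) -> (forall i, smooth_cosec (C' i)) ->
  (forall i, C i x = C' i x) -> schouten_eval x C = schouten_eval x C'.
Proof.
move=> Cs Cs' CC'.
apply: (@tensorial_multi _ _ _ _ (dual_bundle A) x k (schouten_eval x) C C') => //.
- move=> i v s t vs ss ts; apply: schouten_evalD.
  + by move=> j; exact/smooth_cosecP.
  + exact/smooth_cosecP.
  + exact/smooth_cosecP.
- move=> i v f s vs fs ss; apply: schouten_evalZ => //.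
  + by move=> j; exact/smooth_cosecP.
  + exact/smooth_cosecP.
- by move=> i; exact/smooth_cosecP.
- by move=> i; exact/smooth_cosecP.
Qed.

Lemma schoutenE x (C : 'I_k -> cosec A) : (forall i, smooth_cosec (C i)) ->
  schouten X xi (fun i => C i x) = schouten_eval x C.
Proof.
move=> Cs; rewrite -(@schouten_eval_ext x (fun i => ext_cov (C i x)) C) //.
- rewrite /schouten /schouten_eval; congr (_ - _); apply: eq_bigr => i _.
  by congr (xi x _); apply: funext => j /=; case: eqP => // _; rewrite (ext_covP _).2.
- by move=> i; exact: (ext_covP _).1.
- by move=> i; exact: (ext_covP _).2.
Qed.

(** Equal covectors have equal chosen extensions. Hence the function under the derivative is
    identically zero, the terms [i] and [j] of the sum are exchanged by a transposition and cancel,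
    and every other term has a repeated argument. *)
Lemma schouten_alt x : 
  alternating (fun c : 'I_k -> dualv (fib A x) => schouten X xi c : R).
Proof.
have Ex (c : 'I_k -> dualv (fib A x)) : (fun i => ext_cov (c i) x) = c.
  by apply: funext => i; exact: (ext_covP _).2.
have Es (c : 'I_k -> dualv (fib A x)) i : smooth_cosec (ext_cov (c i)) by exact:
    (ext_covP _).1.
have SE (c : 'I_k -> dualv (fib A x)) : schouten (x := x) X xi c = schouten_eval x
    (fun i => ext_cov (c i)).
  by rewrite -schoutenE // Ex.
split=> [i v a u w|i j v ij vij].
  have es (c : dualv (fib A x)) : smooth_cosec (ext_cov c) by exact: (ext_covP _).1.
  pose C j := ext_cov (v j); have Cs j : smooth_cosec (C j) by exact: es.
  have S1 u' : schouten (x := x) X xi [eta v with i |-> u'] = schouten_eval x [eta C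
      with i |-> ext_cov u'].
    rewrite SE; apply: schouten_eval_ext => [j|j|j]; [exact: Es|exact: smooth_with|].
    by rewrite (ext_covP _).2 /=; case: eqP => _; rewrite ?/C (ext_covP _).2.
  rewrite !S1 -(schouten_evalZ x i (f := fun=> a)) //; last exact: smooth_cst.
  have as_ : smooth_cosec (fun y => a *: ext_cov u y) by apply: (smooth_cosecZ (f :=
      fun=> a)) => //; exact: smooth_cst.
  rewrite -schouten_evalD //; apply: schouten_eval_ext => [j|j|j].
  - exact: smooth_with.
  - by apply: smooth_with => //; exact: smooth_cosecD.
  - by rewrite /=; case: eqP => _ //; rewrite !(ext_covP _).2.
rewrite SE /schouten_eval.
pose C l := ext_cov (v l); have Cij : C i = C j by rewrite /C vij.
have x0 y : xi y (fun i => C i y) = 0.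
  by have [/(_ y) [_ xa] _] := xis; apply: (xa i j _ ij); rewrite Cij.
have -> : (fun y => xi y (fun i => C i y)) = fun=> 0 by apply: funext.
rewrite /along (tangent_cst (anchor_tangent _)) sub0r -[RHS]oppr0; congr (- _).
have ji : j != i by rewrite eq_sym.
rewrite (bigD1 i) //= (bigD1 j) //= -/(C _) -/(C _).
rewrite big1 => [|l /andP[li lj]]; last first.
  have [/(_ x) [_ xa] _] := xis; apply: (xa i j _ ij) => /=.
  by rewrite eq_sym (negbTE li) eq_sym (negbTE lj) -/(C _) -/(C _) Cij.
have [/(_ x) xa _] := xis.
rewrite addr0 -Cij -(Ex v); set w := [eta _ with i |-> _].
rewrite [X in _ + X](_ : _ = xi x (fun l => w (tperm i j l))).
  by rewrite (alternating_swap _ xa ij) addrN.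
congr (xi x _); apply: funext => l; rewrite /w /=.
case: tpermP => [->|->|/eqP/negbTE-> /eqP/negbTE->] //; rewrite ?eqxx ?(negbTE ij)
    ?(negbTE ji) //.
by rewrite !(ext_covP _).2 vij.
Qed.

End SchoutenEval.
End Schouten.

(** * Divergence *)

Section Divergence.
Context (R : realType) (d : nat) (M : manifold R d) (m : nat).
Context (A : lie_algebroid M m) (hspan : locally_spanned_by_exact A).
Implicit Types (f g h : M -> R) (x y : M) (X Y Z : sec A).

Lemma lie_form_alt X k (al : lform A k) x : smooth_sec X -> smooth_form al ->
  alternating (fun v : 'I_k -> fib A x => lie_form X al v : R).
Proof.
move=> Xs; move: al; apply: (form_ind hspan (x := x)).
- move=> al be als bes ab; congr alternating; apply: funext => v.
  exact: lie_form_local.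
- move=> al be als bes Pal Pbe.
  have := alternating_comb 1 Pal Pbe; congr alternating; apply: funext => v.
  by rewrite mul1r lie_formD.
- move=> h f hs fs.
  have wa (c : 'I_k -> M -> R) : alternating (wedge_d A c x) by exact: wedge_cov_alt.
  have a0 : alternating (fun v : 'I_k -> fib A x => 0 : R) by have [] := smooth_form0
      A k.
  have sa (r : seq 'I_k) : alternating (fun v => \sum_(j <- r) wedge_d A [eta f with
      j |-> along X (f j)] x v : R).
    elim: r => [|j r IH].
      by move: a0; congr alternating; apply: funext => v; rewrite big_nil.
    have := alternating_comb 1 (wa [eta f with j |-> along X (f j)]) IH.
    by congr alternating; apply: funext => v; rewrite big_cons mul1r.
  have := alternating_comb (along X h x) (wa f) (alternating_comb (h x) (sa
      (index_enum _)) a0).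
  by congr alternating; apply: funext => v; rewrite lie_form_wedge_d // addr0.
Qed.

(** Independence of the extensions in [lie_form] is inherited from the exact forms, for which
    [lie_eval_wedge_d] holds with arbitrary sections. *)
Lemma lie_formE X k (al : lform A k) x (V : 'I_k -> sec A) : smooth_sec X ->
  (forall i, smooth_sec (V i)) -> smooth_form al ->
  lie_form X al (fun i => V i x) = along X (fun y => al y (fun i => V i y)) x -
    \sum_(i < k) al x [eta (fun j => V j x) with i |-> bracket X (V i) x] :> R.
Proof.
move=> Xs Vs; move: al; apply: (form_ind hspan (x := x)).
- move=> al be als bes ab; rewrite -(lie_form_local X _ als bes ab) => ->.
  rewrite (nbhs_singleton ab); congr (_ - _); apply: anchor_local; [exact:
      smooth_form_app..|].
  by apply: (@filterS _ (nbhs x) _ _ _ _ ab) => y ->.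
- move=> al be als bes Pal Pbe; rewrite lie_formD // Pal Pbe.
  rewrite {3}/along (tangentD (anchor_tangent _)); [|exact: smooth_form_app..].
  by rewrite addrACA -opprD -big_split.
- move=> h f hs fs; rewrite lie_form_wedge_d // -(lie_eval_wedge_d x Xs hs fs Vs) //.
Qed.

Context (nu : lform A m) (hnu : orientation_form nu).
Arguments nu : clear implicits.

Let nus : smooth_form nu.
Proof. by case: hnu. Qed.

(** The wedge of the coframe takes the value 1 on the frame, so by [top_form] the form [nu x] would
    vanish altogether if it vanished there. *)
Lemma orientation_frame (i : frame_index A) x : frame_dom i x ->
  nu x (tnth (frame i x)) != 0.
Proof.
move=> ix; apply/negP => /eqP nu0; have [v /negP] := hnu.2 x; apply; apply/eqP.
have e1 : wedge_cov (coframe i x) (tnth (frame i x)) = 1.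
  rewrite -(det1 R m); congr (\det _); apply/matrixP => a b; rewrite !mxE.
  have fr : free (frame i x) by have /andP[] := frame_basis ix.
  by rewrite coframeE (tnth_nth 0) (coord_free _ _ fr) // eq_sym.
have := top_form v (frame_pair_frame ix) (nus.1 x) (wedge_cov_alt (coframe i x)).
by rewrite e1 mul1r nu0 mul0r.
Qed.

(** For smooth [X] and an orientation form [nu] the set has exactly one element, by [divergenceE]
    and [divergence_unique]; 0 is the default of [xget]. *)
Definition divergence X x : R := xget 0 [set dl | forall v : 'I_m -> fib A x,
    lie_form X nu v = dl * nu x v].

Lemma divergenceE X x (v : 'I_m -> fib A x) : smooth_sec X -> lie_form X nu v =
    divergence X x * nu x v.
Proof.
move=> Xs; have [i ix] := frame_cover A x; have n0 := orientation_frame ix.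
have : [set dl | forall v : 'I_m -> fib A x, lie_form X nu v = dl * nu x v]
    (lie_form X nu (tnth (frame i x)) / nu x (tnth (frame i x))).
  move=> w; apply: (mulfI n0).
  rewrite (top_form w (frame_pair_frame ix) (lie_form_alt x Xs nus) (nus.1 x)).
  by field.
by move=> H; apply: (xgetPex 0 (ex_intro _ _ H)).
Qed.

Lemma divergence_unique X x c : smooth_sec X -> (forall v : 'I_m -> fib A x, lie_form
    X nu v = c * nu x v) ->
  divergence X x = c.
Proof.
move=> Xs cE; have [v v0] := hnu.2 x; apply: (mulIf v0).
by rewrite -divergenceE.
Qed.

(** Near [x] the divergence is the quotient of [L_X nu] and [nu] on a frame made global by a cutoff;
    [lie_formE] exhibits the numerator as smooth. *)
Lemma smooth_divergence X : smooth_sec X -> smooth (divergence X).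
Proof.
move=> Xs; apply/smoothP => x.
have [i [b [[bs b1] ix es _ _]]] := frame_bump A x.
pose V a : sec A := fun y => b y *: tnth (frame i y) a.
have Vs a : smooth_sec (V a) by exact: es.
have Vx : (fun a => V a x) = tnth (frame i x).
  by apply: funext => a; rewrite /V (nbhs_singleton b1) scale1r.
have LE : (fun y => lie_form X nu (fun a => V a y)) =
  (fun y => along X (fun z => nu z (fun a => V a z)) y -
    \sum_(l < m) nu y (fun j => [eta V with l |-> bracket X (V l)] j y)).
  apply: funext => y; rewrite lie_formE //; congr (_ - _); apply: eq_bigr => l _.
  by congr (nu y _); apply: funext => j /=; case: eqP.
have Ls : smooth_at x (fun y => lie_form X nu (fun a => V a y)).
  rewrite LE; move/smoothP: (smooth_form_app nus Vs) => ns.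
  apply: smooth_atB; first by have /smoothP := along_smooth Xs (smooth_form_app nus Vs).
  apply: smooth_at_sum => l _.
  have Vs' j : smooth_sec ([eta V with l |-> bracket X (V l)] j).
    by move=> /=; case: eqP => _; [exact: bracket_smooth|exact: Vs].
  by have /smoothP := smooth_form_app nus Vs'.
have n0 : nu x (fun a => V a x) != 0 by rewrite Vx orientation_frame.
have ns : smooth_at x (fun y => nu y (fun a => V a y)) by have /smoothP :=
    smooth_form_app nus Vs.
apply: smooth_at_eq (smooth_atM Ls (smooth_atV n0 ns)).
have : nbhs x ((fun y => nu y (fun a => V a y)) @^-1` [set t : R | t != 0]).
  apply: (smooth_at_continuous ns).
  apply: open_nbhs_nbhs; split=> //.
by apply: (@filterS _ (nbhs x)) => y /= ny; rewrite divergenceE // mulfK.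
Qed.

Lemma divergenceD X Y x : smooth_sec X -> smooth_sec Y ->
  divergence (fun y => X y + Y y) x = divergence X x + divergence Y x.
Proof.
move=> Xs Ys; apply: divergence_unique => [|v]; first exact: smooth_secD.
by rewrite lie_formDl // !divergenceE // mulrDl.
Qed.

(** Each bracket [[h X, V_a]] contributes [- (V_a h) X], and [top_interior] sums these contributions
    to [(X h) nu]. *)
Lemma divergenceZ h X x : smooth h -> smooth_sec X ->
  divergence (fun y => h y *: X y) x = h x * divergence X x + along X h x.
Proof.
move=> hs Xs; have hXs : smooth_sec (fun y => h y *: X y) by exact: smooth_secZ.
have [i ix] := frame_cover A x; have n0 := orientation_frame ix.
apply: (mulIf n0); rewrite -divergenceE // mulrDl -mulrA -divergenceE // /along.
rewrite -(dfunE _ hs) -(top_interior _ _ (frame_pair_frame ix) (nus.1 x)).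
rewrite /lie_form {1}/along anchorZ; last exact: smooth_form_ext.
rewrite mulrBr -addrA; congr (_ + _).
rewrite mulr_sumr -sumrN -sumrN -big_split /=; apply: eq_bigr => a _.
rewrite bracketZl //; last exact: smooth_ext.
have nl := alternating_lin (nus.1 x).
rewrite multilinearD // multilinearZ // -scaleNr multilinearZ // opprD mulNr opprK.
by rewrite dfunE // ext_at.
Qed.

Lemma divergence0 x : divergence (fun=> 0) x = 0.
Proof.
have := divergenceZ x (smooth_cst M 0) (@smooth_sec0 _ _ _ _ A); rewrite mul0r /along
    (tangent_cst (anchor_tangent _)) addr0 => <-.
by congr divergence; apply: functional_extensionality_dep => y; rewrite scaler0.
Qed.

Lemma divergence_sum (I : Type) (r : seq I) (X : I -> sec A) x : (forall a,
    smooth_sec (X a)) ->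
  divergence (fun y => \sum_(a <- r) X a y) x = \sum_(a <- r) divergence (X a) x.
Proof.
move=> Xs; elim: r => [|a r IH].
  by rewrite big_nil -[RHS](divergence0 x); congr divergence; apply:
      functional_extensionality_dep => y; rewrite big_nil.
have Ss : smooth_sec (fun y => \sum_(a <- r) X a y).
  have := smooth_sec_sum r (fun a => smooth_cst M 1) Xs; congr smooth_sec.
  by apply: functional_extensionality_dep => y; apply: eq_bigr => b _; rewrite scale1r.
rewrite big_cons -IH -divergenceD //; congr divergence.
by apply: functional_extensionality_dep => y; rewrite big_cons.
Qed.

(** The commutator of the Lie derivatives on [nu], written out for the functions [N U]. After two
    applications of [along_N], the terms in which no divergence is differentiated behave as follows:
    those with a divergence as factor cancel, replacements at two different positions are symmetric
    and cancel, and those at one position combine by the Jacobi identity. *)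
Lemma divergence_bracket X Y x : smooth_sec X -> smooth_sec Y ->
  divergence (bracket X Y) x = along X (divergence Y) x - along Y (divergence X) x.
Proof.
move=> Xs Ys; have [i ix] := frame_cover A x; have n0 := orientation_frame ix.
have XYs := bracket_smooth Xs Ys; have Dx := smooth_divergence Xs; have Dy :=
    smooth_divergence Ys.
pose V a := ext (tnth (frame i x) a); have Vs a : smooth_sec (V a) by exact: smooth_ext.
have Vx : (fun a => V a x) = tnth (frame i x) by apply: funext => a; exact: ext_at.
pose W a Z := [eta V with a |-> bracket Z (V a)].
have Ws a Z : smooth_sec Z -> forall b, smooth_sec (W a Z b).
  by move=> Zs b; rewrite /W /=; case: eqP => _; [exact: bracket_smooth|exact: Vs].
pose N (U : 'I_m -> sec A) y := nu y (fun a => U a y).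
have Ns U : (forall a, smooth_sec (U a)) -> smooth (N U) by exact: smooth_form_app.
have along_N Z U y : smooth_sec Z -> (forall a, smooth_sec (U a)) ->
    along Z (N U) y = divergence Z y * N U y + \sum_a N [eta U with a |-> bracket Z
        (U a)] y.
  move=> Zs Us.
  have -> : \sum_a N [eta U with a |-> bracket Z (U a)] y =
      \sum_a nu y [eta (fun b => U b y) with a |-> bracket Z (U a) y].
    by apply: eq_bigr => a _; congr (nu y _); apply: funext => b /=; case: eqP.
  by rewrite -divergenceE // lie_formE // subrK.
have step Z Z' : smooth_sec Z -> smooth_sec Z' ->
    along Z (along Z' (N V)) x = along Z (divergence Z') x * N V x +
      divergence Z' x * along Z (N V) x + divergence Z x * \sum_a N (W a Z') x +
      \sum_a \sum_b N [eta W a Z' with b |-> bracket Z (W a Z' b)] x.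
  move=> Zs Zs'; have D := anchor_tangent (Z x).
  have -> : along Z' (N V) = fun y => divergence Z' y * N V y + \sum_a N (W a Z') y.
    by apply: funext => y; rewrite along_N.
  have DVs : smooth (fun y => divergence Z' y * N V y) by apply: smoothM; [exact:
      smooth_divergence|exact: Ns].
  have NWs a : smooth (N (W a Z')) by apply: Ns; exact: Ws.
  rewrite {1}/along (tangentD D) //; last exact: smooth_sum.
  rewrite (tangentM D); [|exact: smooth_divergence|exact: Ns].
  rewrite (tangent_sum D) // -[RHS]addrA; congr (_ + _).
  rewrite mulr_sumr -big_split /=; apply: eq_bigr => a _.
  by rewrite -/(along _ _ _) along_N //; exact: Ws.
have := along_N (bracket X Y) V x XYs Vs.
rewrite {1}/along anchor_bracket //; last exact: Ns.
rewrite -!/(along _ _ _) !step // !along_N // => E.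
apply: (mulIf n0); rewrite -Vx -/(N V x) mulrBl.
have J : \sum_a \sum_b N [eta W a Y with b |-> bracket X (W a Y b)] x -
         \sum_a \sum_b N [eta W a X with b |-> bracket Y (W a X b)] x =
         \sum_a N [eta V with a |-> bracket (bracket X Y) (V a)] x.
  rewrite [X in _ - X]exchange_big /= -sumrB; apply: eq_bigr => a _.
  have VaJ : bracket X (bracket Y (V a)) x - bracket Y (bracket X (V a)) x =
      bracket (bracket X Y) (V a) x.
    have := bracket_jacobi Xs Ys (Vs a) x.
    have -> : bracket (V a) X = fun y => -1 *: bracket X (V a) y.
      by apply: functional_extensionality_dep => y; rewrite scaleN1r -bracket_anti.
    rewrite (bracket_leibniz Ys (bracket_smooth Xs (Vs a)) (smooth_cst M (-1))).
    rewrite (tangent_cst (anchor_tangent _)) scale0r addr0 scaleN1r (bracket_anti (Vs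
        a) XYs).
    by move/eqP; rewrite subr_eq0 => /eqP.
  rewrite -sumrB (bigD1 a) //= big1 ?addr0 => [|b ba]; last first.
    apply/eqP; rewrite subr_eq0; apply/eqP; have ab : a != b by rewrite eq_sym.
    by rewrite /W /= (negbTE ba) (negbTE ab) (withC _ _ _ ab).
  rewrite /W /= eqxx !with_same.
  have nl := alternating_lin (nus.1 x).
  have NE Z : N [eta V with a |-> Z] x = nu x [eta (fun b => V b x) with a |-> Z x].
    by congr (nu x _); apply: funext => b /=; case: eqP.
  by rewrite !NE -VaJ multilinearD // multilinearN.
move: E; rewrite -J; set s1 := \sum_a \sum_b _; set s2 := \sum_a \sum_b _ => E.
apply: (addIr (s1 - s2)); rewrite -E; ring.
Qed.

End Divergence.

(** * Nambu structures *)

Section Contract.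
Context (R : realType) (V : vectType R) (p : nat).

Lemma contract_comb (xi : kvec V (p + 1)) (a b : kform V p) c :
  contract (fun v => c * a v + b v) xi = fun d => c * contract a xi d + contract b xi d.
Proof.
apply: funext => d; rewrite /contract -pairing_comb; congr (pairing _ _).
apply: funext => v; rewrite /wedge mulrCA -mulrDr; congr (_ * _).
rewrite mulr_sumr -big_split /=; apply: eq_bigr => s _.
by move: (_ ^+ _) => z; ring.
Qed.

Lemma vec_of_comb (xi xi' : kvec V 1) c :
  vec_of (fun d => c * xi d + xi' d) = c *: vec_of xi + vec_of xi'.
Proof.
rewrite /vec_of scaler_sumr -big_split; apply: eq_bigr => a _.
by rewrite scalerDl scalerA.
Qed.

Lemma vec_of_contract_comb (xi : kvec V (p + 1)) (a b : kform V p) c :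
  vec_of (contract (fun v => c * a v + b v) xi) =
  c *: vec_of (contract a xi) + vec_of (contract b xi).
Proof. by rewrite contract_comb vec_of_comb. Qed.

Lemma dual_vec_of_contract (xi : kvec V (p + 1)) (d : 'I_p -> dualv V) (c : dualv V) :
  alternating xi -> c (vec_of (contract (wedge_cov d) xi)) = xi (vcat d (fun=> c)) :> R.
Proof.
move=> xa; have -> : contract (wedge_cov d) xi = fun e => xi (vcat d e).
  by apply: funext => e; exact: contract_wedge_cov.
exact: (dual_vec_of c (alternating_lin (alternating_vcatr d xa))).
Qed.

End Contract.

(** * The Nambu condition on exact forms *)

Section Nambu.
Context (R : realType) (d : nat) (M : manifold R d) (m : nat).
Context (A : lie_algebroid M m) (hspan : locally_spanned_by_exact A).
Context (p : nat) (Pi : multivec A (p + 1)) (hPi : nambu Pi).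
Arguments Pi : clear implicits.
Implicit Types (h u : M -> R) (x y : M) (X Y Z : sec A) (f g : 'I_p -> M -> R).

Let Pis : smooth_multivec Pi.
Proof. by case: hPi. Qed.

Let Pia x : alternating (Pi x).
Proof. by have [] := Pis. Qed.

Lemma dfunM h u x : smooth h -> smooth u ->
  dfun A (fun y => h y * u y) x = h x *: dfun A u x + u x *: dfun A h x.
Proof.
move=> hs us; apply/lfunP => v; rewrite [RHS]dual_comb dual_scale !dfunE //; last
    exact: smoothM.
by rewrite (tangentM (anchor_tangent v)) // addrC [u x * _]mulrC.
Qed.

Lemma dfun_cst c x : dfun A (fun=> c) x = 0.
Proof.
apply/lfunP => v; rewrite dfunE; last exact: smooth_cst.
by rewrite (tangent_cst (anchor_tangent v)) lfunE.
Qed.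

(** The differentials of functions span the dual of the fibre, so they separate its vectors. *)
Lemma anchor_inj x (u v : fib A x) :
  (forall h, smooth h -> anchor u h = anchor v h) -> u = v.
Proof.
move=> uv; have cuv (c : dualv (fib A x)) : c u = c v :> R.
  have [cs cx] := ext_covP c; have [U [oU Ux spanU]] := hspan x.
  have cU : smooth_cosec_on U (ext_cov c).
    by move=> i a; apply: smooth_on_sub (cs i a) => y [].
  have [r [F [g [Fs gs cE]]]] := spanU _ cU.
  rewrite -cx cE // !sum_lfunE; apply: eq_bigr => j _.
  by rewrite [LHS]dual_scale [RHS]dual_scale !dfunE // uv.
have [i ix] := frame_cover A x.
by rewrite (frame_pair_frame ix u) (frame_pair_frame ix v); under eq_bigr do rewrite
    cuv.
Qed.

(** The Nambu bracket of [p + 1] functions, with the last one kept apart as the function being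
    differentiated. *)
Definition fun_bracket f u x : R :=
  Pi x (vcat (fun i => dfun A (f i) x) (fun=> dfun A u x)).

Lemma smooth_brk f u : (forall i, smooth (f i)) -> smooth u -> smooth (fun_bracket f u).
Proof.
move=> fs us; have := smooth_multivec_app Pis (C := vcat (fun i => dfun A (f i))
    (fun=> dfun A u)).
rewrite (_ : (fun y => _) = fun_bracket f u).
  apply=> i; rewrite /vcat; case: fintype.split => j; exact: smooth_dfun.
apply: funext => y; congr (Pi y _); apply: funext => i.
by rewrite /vcat; case: fintype.split.
Qed.

Lemma brk_with f u x j h : fun_bracket [eta f with j |-> h] u x =
  Pi x [eta vcat (fun i => dfun A (f i) x) (fun=> dfun A u x) with lshift 1 j |->
      dfun A h x].
Proof.
rewrite /fun_bracket -vcat_withl; congr (Pi x (vcat _ _)); apply: funext => i /=.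
by case: eqP.
Qed.

Lemma brk_withr f u x h : fun_bracket f h x =
  Pi x [eta vcat (fun i => dfun A (f i) x) (fun=> dfun A u x) with rshift p ord0 |->
      dfun A h x].
Proof.
rewrite /fun_bracket -vcat_withr; congr (Pi x (vcat _ _)); apply: funext => i /=.
by rewrite (ord1 i).
Qed.

Lemma brk_withM f j h u w x : smooth h -> smooth u ->
  fun_bracket [eta f with j |-> fun y => h y * u y] w x =
  h x * fun_bracket [eta f with j |-> u] w x + u x * fun_bracket [eta f with j |-> h]
      w x.
Proof.
move=> hs us; rewrite !brk_with dfunM // (alternating_lin (Pia x)).
by rewrite multilinearZ //; exact: alternating_lin.
Qed.

Lemma brkM f h u x : smooth h -> smooth u ->
  fun_bracket f (fun y => h y * u y) x = h x * fun_bracket f u x + u x * fun_bracket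
      f h x.
Proof.
move=> hs us; rewrite !(brk_withr f (fun=> 0)) dfunM // (alternating_lin (Pia x)).
by rewrite multilinearZ //; exact: alternating_lin.
Qed.

Lemma brk_with_cst f j c w x : fun_bracket [eta f with j |-> fun=> c] w x = 0.
Proof. by rewrite brk_with dfun_cst multilinear0 //; exact: alternating_lin. Qed.

Lemma brk_swap f j u w x : fun_bracket [eta f with j |-> u] w x = - fun_bracket [eta
    f with j |-> w] u x.
Proof.
rewrite /fun_bracket; have lr : lshift 1 j != rshift p ord0 by rewrite eq_lrshift.
rewrite -(alternating_swap _ (Pia x) lr); congr (Pi x _).
apply: funext => i; case: tpermP => [->|->|/eqP il /eqP ir].
- by rewrite vcatl vcatr /= eqxx.
- by rewrite vcatl vcatr /= eqxx.
case: (fintype.splitP i) => l il'.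
  have {}il' : i = lshift 1 l by exact: val_inj.
  by move: il; rewrite il' !vcatl /= (inj_eq (@lshift_inj _ _)) => /negbTE ->.
have ir' : i = rshift p ord0 by apply: val_inj; rewrite /= il' (ord1 l).
by rewrite ir' eqxx in ir.
Qed.

Definition hamiltonian f : sec A := sharp Pi (wedge_d A f).

Lemma along_ham f u x : smooth u -> along (hamiltonian f) u x = fun_bracket f u x.
Proof.
by move=> us; rewrite /along -dfunE // /hamiltonian /sharp dual_vec_of_contract.
Qed.

Lemma smooth_ham f : (forall i, smooth (f i)) -> smooth_sec (hamiltonian f).
Proof.
move=> fs; apply/smooth_secP => x i a ix.
have : smooth_at x (fun y => Pi y (fun l => vcat (fun i => dfun A (f i)) (fun=> fun y
    => coframe i y a) l y)).
  apply: (@smooth_form_app_at _ _ _ _ (dual_bundle A) (p + 1) Pi x _ _).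
    exact/smooth_multivecP.
  move=> l; rewrite /vcat; case: fintype.split => j.
    by have /smooth_cosecP/smooth_secP/(_ x) := @smooth_dfun _ _ _ _ A _ (fs j).
  have := @smooth_sec_at_frame _ _ _ _ (dual_bundle A) i a x ix.
  by congr smooth_sec_at; apply: functional_extensionality_dep => z; rewrite
      tnth_mktuple.
apply: smooth_at_eq; near=> y.
rewrite -coframeE /hamiltonian /sharp dual_vec_of_contract //; congr (Pi y _).
by apply: funext => l; rewrite /vcat; case: fintype.split.
Unshelve. all: by end_near. Qed.

Lemma sharp_comb h (al be : lform A p) x :
  sharp Pi (fun y w => h y * al y w + be y w) x = h x *: sharp Pi al x + sharp Pi be x.
Proof. exact: vec_of_contract_comb. Qed.

Lemma sharp0 x : sharp Pi (fun _ _ => 0) x = 0.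
Proof.
have := sharp_comb (fun=> -1) (fun _ _ => 0) (fun _ _ => 0) x.
rewrite scaleN1r addNr => <-; congr (vec_of (contract _ _)).
by apply: funext => v; rewrite mulr0 addr0.
Qed.

Lemma sharpZ h (al : lform A p) x : sharp Pi (fun y w => h y * al y w) x = h x *:
    sharp Pi al x.
Proof.
rewrite -[RHS]addr0 -(sharp0 x) -sharp_comb; congr (vec_of (contract _ _)).
by apply: funext => v; rewrite addr0.
Qed.

Lemma sharpD (al be : lform A p) x : sharp Pi (fun y w => al y w + be y w) x = sharp
    Pi al x + sharp Pi be x.
Proof.
rewrite -[sharp Pi al x]scale1r -(sharp_comb (fun=> 1)); congr (vec_of (contract _ _)).
by apply: funext => v; rewrite mul1r.
Qed.

(** [contract] and [vec_of] sum over the [vbasis] of each fibre, which is chosen without any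
    regularity in the base point. On exact forms this basis disappears, and [form_ind] transfers the
    smoothness. *)
Lemma smooth_sharp (al : lform A p) : smooth_form al -> smooth_sec (sharp Pi al).
Proof.
move=> als; apply/smooth_secP => x; move: al als; apply: (form_ind hspan (x := x)).
- move=> al be als bes ab; apply: smooth_sec_at_eq.
  by apply: (@filterS _ (nbhs x) _ _ _ _ ab) => y aby; rewrite /sharp aby.
- move=> al be als bes Pal Pbe.
  apply: smooth_sec_at_eq (smooth_sec_at_comb (smooth_at_cst x 1) Pal Pbe).
  by near=> y; rewrite sharpD scale1r.
- move=> h f hs fs; have /smooth_secP/(_ x) := smooth_secZ hs (smooth_ham fs).
  apply: smooth_sec_at_eq; near=> y; by rewrite sharpZ.
Unshelve. all: by end_near. Qed.

(** The right side of the Nambu condition, up to sign, tested against [du]: [interior_wedge_cov]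
    expands the contraction of [dh /\ df_1 /\ .. /\ df_p] with the Hamiltonian section of [g]. *)
Lemma dual_sharp_interior f g h u x : (forall i, smooth (f i)) -> (forall i, smooth
    (g i)) ->
  smooth h -> smooth u ->
  dfun A u x (sharp Pi (interior_form (hamiltonian g) (dform (fun y w => h y *
      wedge_d A f y w))) x) =
  fun_bracket g h x * fun_bracket f u x - \sum_j fun_bracket g (f j) x * fun_bracket
      [eta f with j |-> h] u x :> R.
Proof.
move=> fs gs hs us.
pose om : lform A p := interior_form (hamiltonian g) (dform (fun y w => h y * wedge_d
    A f y w)).
have E : om x = fun v => fun_bracket g h x * wedge_d A f x v +
    \sum_j (- fun_bracket g (f j) x) * wedge_d A [eta f with j |-> h] x v.
  apply: funext => v; rewrite /om /interior_form.
  have -> : @dform _ _ _ _ A _ (fun y w => h y * wedge_d A f y w) x =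
      wedge_cov (fcons (dfun A h x) (fun i => dfun A (f i) x)).
    apply: funext => w; rewrite dform_wedge_d //; congr (wedge_cov _ _).
    by apply: fconsP => [|i]; rewrite ?fcons0 ?fconsS.
  rewrite interior_wedge_cov dfunE // -/(along (hamiltonian g) h x) along_ham // -sumrN.
  congr (_ + _); apply: eq_bigr => j _; rewrite mulNr dfunE // -/(along (hamiltonian
      g) (f j) x) along_ham //.
  by congr (- (_ * wedge_cov _ _)); apply: funext => i /=; case: eqP.
rewrite -/om /sharp E vec_of_contract_comb [LHS](dualD (dfun A u x)) dualZ
    dual_vec_of_contract //.
congr (_ + _); rewrite -sumrN.
have sumE (r : seq 'I_p) : dfun A u x (vec_of (contract (fun v => \sum_(j <- r) (-
    fun_bracket g (f j) x) * wedge_d A [eta f with j |-> h] x v) (Pi x))) =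
  \sum_(j <- r) - (fun_bracket g (f j) x * fun_bracket [eta f with j |-> h] u x) :> R.
  elim: r => [|j r IH].
    rewrite big_nil (_ : vec_of _ = 0); first exact: (linear0 (dfun A u x : 'Hom(_,
        R^o))).
    rewrite -[RHS](sharp0 x); congr (vec_of (contract _ _)).
    by apply: funext => v; rewrite big_nil.
  have brE f' : fun_bracket f' u x = dfun A u x (vec_of (contract (wedge_d A f' x)
      (Pi x))) :> R.
    by rewrite dual_vec_of_contract.
  rewrite big_cons -IH -mulNr (brE [eta f with j |-> h]) -dualZ -dualD.
  rewrite -vec_of_contract_comb; congr (dfun A u x (vec_of (contract _ _))).
  by apply: funext => v; rewrite big_cons.
exact: sumE.
Qed.

(* The Nambu condition for [alpha = h df] and [beta = dg]. *)
Lemma nambu_exact f g h u x : (forall i, smooth (f i)) -> (forall i, smooth (g i)) ->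
  smooth h -> smooth u ->
  along (fun y => h y *: hamiltonian f y) (fun_bracket g u) x -
  \sum_j fun_bracket [eta g with j |-> along (fun y => h y *: hamiltonian f y) (g j)]
      u x -
  fun_bracket g (along (fun y => h y *: hamiltonian f y) u) x =
  - (fun_bracket g h x * fun_bracket f u x - \sum_j fun_bracket g (f j) x *
      fun_bracket [eta f with j |-> h] u x).
Proof.
move=> fs gs hs us; set X := fun y => h y *: hamiltonian f y.
have Xs : smooth_sec X by apply: smooth_secZ => //; exact: smooth_ham.
have XE : X = sharp Pi (fun y w => h y * wedge_d A f y w).
  by apply: functional_extensionality_dep => y; rewrite sharpZ.
have als : smooth_form (fun y w => h y * wedge_d A f y w) by apply: smooth_formZ =>
    //; exact: smooth_wedge_d.
have := hPi.2 _ _ als (smooth_wedge_d A gs) x; rewrite -XE => /(congr1 (fun v => dfun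
    A u x v : R)) /=.
rewrite [X in _ = X -> _](_ : _ = - (dfun A u x (sharp Pi (interior_form (hamiltonian
    g) (dform (fun y w => h y * wedge_d A f y w))) x) : R)); last first.
  by rewrite -scaleN1r dualZ mulN1r.
rewrite dual_sharp_interior // => <-.
rewrite dual_vec_of_contract; last exact: schouten_alt.
pose C : 'I_(p + 1) -> cosec A := vcat (fun i => dfun A (g i)) (fun=> dfun A u).
have Cs i : smooth_cosec (C i).
  by rewrite /C /vcat; case: fintype.split => j; exact: smooth_dfun.
have CE y : (fun i => C i y) = vcat (fun i => dfun A (g i) y) (fun=> dfun A u y).
  by apply: vcat_ext => i; rewrite /C ?vcatl ?vcatr.
rewrite -CE schoutenE // /schouten_eval big_split_ord /= big_ord1 opprD addrA.
congr (_ - _ - _).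
- by congr (along X _ _); apply: funext => y; rewrite CE.
- apply: eq_bigr => j _; rewrite brk_with CE /C vcatl lie_cosec_dfun //.
- by rewrite (brk_withr g u) CE /C vcatr lie_cosec_dfun.
Qed.

End Nambu.

(** * Hamiltonian sections and their divergences *)

Section Modular.
Context (R : realType) (d : nat) (M : manifold R d) (m : nat).
Context (A : lie_algebroid M m) (hspan : locally_spanned_by_exact A).
Context (p : nat) (Pi : multivec A (p + 1)) (hPi : nambu Pi).
Arguments Pi : clear implicits.
Implicit Types (h u : M -> R) (x y : M) (X Y Z : sec A) (f g : 'I_p -> M -> R).

Local Notation brk := (fun_bracket Pi).
Local Notation ham := (hamiltonian Pi).

Let hams f : (forall i, smooth (f i)) -> smooth_sec (ham f).
Proof. exact: smooth_ham. Qed.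

Lemma smooth_with f j u : (forall i, smooth (f i)) -> smooth u ->
  forall i, smooth ([eta f with j |-> u] i).
Proof. by move=> fs us i /=; case: eqP. Qed.

Lemma along_hamE f u : smooth u -> along (ham f) u = brk f u.
Proof. by move=> us; apply: funext => x; exact: (along_ham hPi). Qed.

(** The fundamental identity of Nambu brackets: [nambu_exact] with [h = 1], whose right side
    consists of brackets having the constant 1 as an entry. *)
Lemma ham_brk f g u x : (forall i, smooth (f i)) -> (forall i, smooth (g i)) ->
    smooth u ->
  brk f (brk g u) x =
  \sum_j brk [eta g with j |-> brk f (g j)] u x + brk g (brk f u) x.
Proof.
move=> fs gs us; have := nambu_exact hPi x fs gs (smooth_cst M 1) us.
have -> : (fun y => 1 *: ham f y) = ham f.
  by apply: functional_extensionality_dep => y; rewrite scale1r.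
have bs : smooth (brk g u) by exact: (smooth_brk hPi).
rewrite !along_hamE //.
under eq_bigr do rewrite along_hamE //.
rewrite (_ : \sum_j brk g (f j) x * brk [eta f with j |-> fun=> 1] u x = 0); last first.
  by apply: big1 => j _; rewrite (brk_with_cst hPi) mulr0.
rewrite subr0 [brk g (fun=> 1) x](_ : _ = 0); last first.
  by rewrite -along_hamE; [exact: (tangent_cst (anchor_tangent _))|exact: smooth_cst].
by rewrite mul0r oppr0 -addrA -opprD => /eqP; rewrite subr_eq0 => /eqP.
Qed.

Lemma anchor_sum (I : Type) (r : seq I) x (v : I -> fib A x) u : smooth u ->
  anchor (\sum_(j <- r) v j) u = \sum_(j <- r) anchor (v j) u.
Proof.
move=> us; rewrite -dfunE // (linear_sum (dfun A u x : 'Hom(_, R^o))).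
by apply: eq_bigr => j _; exact: dfunE.
Qed.

(** The fundamental identity, read as an equality of derivations and lifted to sections by
    [anchor_inj]. *)
Lemma ham_bracket f g : (forall i, smooth (f i)) -> (forall i, smooth (g i)) ->
  bracket (ham f) (ham g) = fun x => \sum_j ham [eta g with j |-> brk f (g j)] x.
Proof.
move=> fs gs; apply: functional_extensionality_dep => x.
apply: (anchor_inj hspan) => u us; rewrite anchor_sum //.
rewrite anchor_bracket; [|exact: hams|exact: hams|by []].
rewrite -!/(along _ _) -!/(along _ _ x) !along_hamE //; [|exact: (smooth_brk hPi)..].
rewrite ham_brk // addrK; apply: eq_bigr => j _.
by rewrite -/(along _ _ x) along_hamE.
Qed.

(* The terms of [nambu_exact] that contain derivatives of [h]. *)
Lemma ham_quadratic f g h x : (forall i, smooth (f i)) -> (forall i, smooth (g i)) ->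
    smooth h ->
  \sum_j brk f (g j) x *: ham [eta g with j |-> h] x +
  \sum_j brk g (f j) x *: ham [eta f with j |-> h] x = 0.
Proof.
move=> fs gs hs; apply: (anchor_inj hspan) => u us.
rewrite anchorD // !anchor_sum // -[RHS]dfunE // (linear0 (dfun A u x : 'Hom(_, R^o))).
have E f' g' : \sum_j anchor (brk f' (g' j) x *: ham [eta g' with j |-> h] x) u =
    \sum_j brk f' (g' j) x * brk [eta g' with j |-> h] u x.
  by apply: eq_bigr => j _; rewrite anchorZ // -/(along _ _ x) along_hamE.
rewrite !E.
have := nambu_exact hPi x fs gs hs us.
have aE w : smooth w -> along (fun y => h y *: ham f y) w = fun y => h y * brk f w y.
  by move=> ws; apply: funext => y; rewrite -along_hamE // /along anchorZ.
have bs w f' : (forall i, smooth (f' i)) -> smooth w -> smooth (brk f' w) by exact: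
    (smooth_brk hPi).
rewrite !aE //; last exact: bs.
have -> : \sum_j brk [eta g with j |-> along (fun y => h y *: ham f y) (g j)] u x =
    h x * \sum_j brk [eta g with j |-> brk f (g j)] u x +
    \sum_j brk f (g j) x * brk [eta g with j |-> h] u x.
  rewrite mulr_sumr -big_split; apply: eq_bigr => j _ /=.
  by rewrite aE // (brk_withM hPi) //; exact: bs.
rewrite (brkM hPi) //; last exact: bs.
(* The fundamental identity removes all multiples of [h x]; the product [brk g h x * brk f u x]
   occurs on both sides. *)
rewrite ham_brk // => /eqP; rewrite -subr_eq0 => /eqP E1.
apply: oppr_inj; rewrite oppr0 -[RHS]E1; ring.
Qed.

Context (nu : lform A m) (hnu : orientation_form nu).
Arguments nu : clear implicits.

Local Notation div := (divergence nu).

Lemma smooth_div_ham f : (forall i, smooth (f i)) -> smooth (div (ham f)).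
Proof. by move=> fs; apply: (smooth_divergence hspan hnu); exact: hams. Qed.

Lemma div_ham_bracket f g x : (forall i, smooth (f i)) -> (forall i, smooth (g i)) ->
  brk f (div (ham g)) x - brk g (div (ham f)) x =
  \sum_j div (ham [eta g with j |-> brk f (g j)]) x.
Proof.
move=> fs gs; have [fs' gs'] := (hams fs, hams gs).
rewrite -!along_hamE; [|exact: smooth_div_ham..].
rewrite -(divergence_bracket hspan hnu) // ham_bracket // (divergence_sum hspan hnu)
    // => j.
by apply: hams; apply: smooth_with => //; exact: (smooth_brk hPi).
Qed.

(** The divergence of [ham_quadratic] also differentiates its coefficients. By [brk_swap], the
    derivative of [{f, g_j}] along the section of [g[j := h]] is minus the derivative of [h] along
    that of [g[j := {f, g_j}]], so these terms add up to [- [X_f, X_g] h]. The second sum gives the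
    same with [f] and [g] exchanged, and the two cancel. *)
Lemma div_ham_quadratic f g h x : (forall i, smooth (f i)) -> (forall i, smooth (g
    i)) -> smooth h ->
  \sum_j brk f (g j) x * div (ham [eta g with j |-> h]) x +
  \sum_j brk g (f j) x * div (ham [eta f with j |-> h]) x = 0.
Proof.
move=> fs gs hs.
have bs w f' : (forall i, smooth (f' i)) -> smooth w -> smooth (brk f' w) by exact:
    (smooth_brk hPi).
have Hs g' j : (forall i, smooth (g' i)) -> smooth_sec (ham [eta g' with j |-> h]).
  by move=> gs'; apply: hams; exact: smooth_with.
have Ss f' g' j : (forall i, smooth (f' i)) -> (forall i, smooth (g' i)) ->
    smooth_sec (fun y => brk f' (g' j) y *: ham [eta g' with j |-> h] y).
  by move=> fs' gs'; apply: smooth_secZ; [exact: bs|exact: Hs].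
have SSs f' g' : (forall i, smooth (f' i)) -> (forall i, smooth (g' i)) ->
    smooth_sec (fun y => \sum_j brk f' (g' j) y *: ham [eta g' with j |-> h] y).
  by move=> fs' gs'; apply: smooth_sec_sum => j; [exact: bs|exact: Hs].
have D f' g' : (forall i, smooth (f' i)) -> (forall i, smooth (g' i)) ->
    div (fun y => \sum_j brk f' (g' j) y *: ham [eta g' with j |-> h] y) x =
    \sum_j brk f' (g' j) x * div (ham [eta g' with j |-> h]) x - anchor (bracket (ham
        f') (ham g') x) h.
  move=> fs' gs'; rewrite (divergence_sum hspan hnu) => [|j]; last exact: Ss.
  rewrite ham_bracket // anchor_sum // -sumrB; apply: eq_bigr => j _.
  rewrite (divergenceZ hspan hnu) //; [|exact: bs|exact: Hs].
  have bsj : smooth (brk f' (g' j)) by exact: bs.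
  by rewrite (along_hamE _ bsj) (brk_swap hPi) -(along_hamE _ hs).
have := divergence0 hspan hnu x.
have <- : (fun y => \sum_j brk f (g j) y *: ham [eta g with j |-> h] y +
    \sum_j brk g (f j) y *: ham [eta f with j |-> h] y) = fun=> 0.
  by apply: functional_extensionality_dep => y; exact: ham_quadratic.
rewrite (divergenceD hspan hnu); [|exact: SSs..].
rewrite !D // (bracket_anti (hams fs) (hams gs)) anchorN // opprK.
by move=> E; rewrite -[RHS]E [RHS]addrACA subrr addr0.
Qed.

(** * The cocycle identity *)

Section Cochain.
Context (Mt : multivec A p) (hMt : smooth_multivec Mt).
Arguments Mt : clear implicits.
Hypothesis MtE : forall f x, (forall i, smooth (f i)) ->
  Mt x (fun i => dfun A (f i) x) = div (ham f) x.

Definition eval_mv (al : lform A p) x := pairing (al x) (Mt x).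

Lemma eval_mv_wedge_d f x : (forall i, smooth (f i)) -> pairing (wedge_d A f x) (Mt
    x) = div (ham f) x.
Proof. by move=> fs; rewrite pairing_wedge_cov ?MtE //; have [] := hMt. Qed.

Lemma pairing_sum (V : vectType R) k (I : Type) (r : seq I) (a : I -> kform V k) (xi
    : kvec V k) :
  pairing (fun v => \sum_(j <- r) a j v) xi = \sum_(j <- r) pairing (a j) xi.
Proof.
elim: r => [|j r IH].
  by rewrite big_nil /pairing big1 ?mulr0 // => J _; rewrite big_nil mul0r.
rewrite big_cons -IH -[X in X + _]mul1r -pairing_comb; congr pairing.
by apply: funext => v; rewrite big_cons mul1r.
Qed.

Lemma pairingZ (V : vectType R) k (a : kform V k) (xi : kvec V k) c :
  pairing (fun v => c * a v) xi = c * pairing a xi.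
Proof.
rewrite /pairing mulrCA; congr (_ * _); rewrite mulr_sumr; apply: eq_bigr => J _.
by rewrite mulrA.
Qed.

Lemma pairingD (V : vectType R) k (a b : kform V k) (xi : kvec V k) :
  pairing (fun v => a v + b v) xi = pairing a xi + pairing b xi.
Proof.
rewrite -[pairing a xi]mul1r -pairing_comb; congr pairing.
by apply: funext => v; rewrite mul1r.
Qed.

Lemma smooth_eval_mv (al : lform A p) : smooth_form al -> smooth (eval_mv al).
Proof.
move=> als; apply/smoothP => x; move: al als; apply: (form_ind hspan (x := x)).
- move=> al be als bes ab; apply: smooth_at_eq.
  by apply: (@filterS _ (nbhs x) _ _ _ _ ab) => y aby; rewrite /eval_mv aby.
- move=> al be als bes Pal Pbe; apply: smooth_at_eq (smooth_atD Pal Pbe).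
  by near=> y; rewrite /eval_mv pairingD.
- move=> h f /smoothP hs fs; move/smoothP: (smooth_div_ham fs) => ds.
  apply: smooth_at_eq (smooth_atM (hs x) (ds x)).
  by near=> y; rewrite /eval_mv pairingZ eval_mv_wedge_d.
Unshelve. all: by end_near. Qed.

(** The terms are sorted for their later evaluation: the sum with factor [u x * h x] is the one in
    [div_ham_bracket], and the last group, with derivatives of [h], is the one in
    [div_ham_quadratic]. *)
Lemma nambu_bracket_exact h f u g x : smooth h -> smooth u ->
  (forall i, smooth (f i)) -> (forall i, smooth (g i)) ->
  @nambu_bracket _ _ _ _ A p Pi (fun y w => h y * wedge_d A f y w) (fun y w => u y *
      wedge_d A g y w) x =
  fun v => h x * brk f u x * wedge_d A g x v - u x * brk g h x * wedge_d A f x v +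
    (u x * h x * (\sum_j wedge_d A [eta g with j |-> brk f (g j)] x v) +
     u x * (\sum_j brk f (g j) x * wedge_d A [eta g with j |-> h] x v +
            \sum_j brk g (f j) x * wedge_d A [eta f with j |-> h] x v)).
Proof.
move=> hs us fs gs; apply: funext => v; rewrite /nambu_bracket.
have hfs : smooth_form (fun y w => h y * wedge_d A f y w) by apply: smooth_formZ =>
    //; exact: smooth_wedge_d.
have Xs := smooth_sharp hspan hPi hfs.
have XE : sharp Pi (fun y w => h y * wedge_d A f y w) = fun y => h y *: ham f y.
  by apply: functional_extensionality_dep => y; rewrite sharpZ.
have bs w f' : (forall i, smooth (f' i)) -> smooth w -> smooth (brk f' w) by exact:
    (smooth_brk hPi).
have aE w : smooth w -> along (fun y => h y *: ham f y) w = fun y => h y * brk f w y.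
  by move=> ws; apply: funext => y; rewrite -along_hamE // /along anchorZ.
rewrite lie_form_wedge_d // XE aE //.
have -> : \sum_j wedge_d A [eta g with j |-> along (fun y => h y *: ham f y) (g j)] x
    v =
    h x * \sum_j wedge_d A [eta g with j |-> brk f (g j)] x v +
    \sum_j brk f (g j) x * wedge_d A [eta g with j |-> h] x v.
  have wE j w : wedge_d A [eta g with j |-> w] x v = wedge_cov [eta (fun i => dfun A
      (g i) x) with j |-> dfun A w x] v.
    by congr (wedge_cov _ _); apply: funext => i /=; case: eqP.
  rewrite mulr_sumr -big_split; apply: eq_bigr => j _ /=.
  have al := alternating_lin (wedge_cov_alt_cov v).
  rewrite aE // !wE dfunM // ?al; last exact: bs.
  by congr (_ + _); exact: (multilinearZ (f := fun c => wedge_cov c v)).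
rewrite /interior_form.
have -> : @dform _ _ _ _ A _ (fun y w => h y * wedge_d A f y w) x =
    wedge_cov (fcons (dfun A h x) (fun i => dfun A (f i) x)).
  apply: funext => w; rewrite dform_wedge_d //; congr (wedge_cov _ _).
  by apply: fconsP => [|i]; rewrite ?fcons0 ?fconsS.
rewrite interior_wedge_cov sharpZ dualZ dfunE // -/(along (ham g) h x) along_hamE //.
have -> : \sum_j dfun A (f j) x (u x *: sharp Pi (wedge_d A g) x) * wedge_cov [eta
    (fun i => dfun A (f i) x) with j |-> dfun A h x] v =
    u x * \sum_j brk g (f j) x * wedge_d A [eta f with j |-> h] x v.
  rewrite mulr_sumr; apply: eq_bigr => j _.
  rewrite [X in X * _]dualZ dfunE // -/(along (ham g) (f j) x) along_hamE // -mulrA.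
  by congr (_ * (_ * wedge_cov _ _)); apply: funext => i /=; case: eqP.
rewrite -/(wedge_d A f x v); ring.
Qed.

(** [form_ind] is applied to [al] for arbitrary [be], and then to [be]. Although the bracket is not
    linear over functions, the whole expression is additive and local in each argument. *)
Lemma eval_mv_closed (al be : lform A p) x : smooth_form al -> smooth_form be ->
  along (sharp Pi al) (eval_mv be) x - along (sharp Pi be) (eval_mv al) x -
  pairing (@nambu_bracket _ _ _ _ A p Pi al be x) (Mt x) = 0.
Proof.
move=> als bes; move: al als.
have nearS (al al' : lform A p) : (\near x, al x = al' x) -> \near x, sharp Pi al x =
    sharp Pi al' x.
  by move=> aa; apply: (@filterS _ (nbhs x) _ _ _ _ aa) => y ay; rewrite /sharp ay.
have nearI (al al' : lform A p) : (\near x, al x = al' x) -> \near x, eval_mv al x =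
    eval_mv al' x.
  by move=> aa; apply: (@filterS _ (nbhs x) _ _ _ _ aa) => y ay; rewrite /eval_mv ay.
have iD (al al' : lform A p) : eval_mv (fun y w => al y w + al' y w) = fun y =>
    eval_mv al y + eval_mv al' y.
  by apply: funext => y; exact: pairingD.
have sD (al al' : lform A p) : sharp Pi (fun y w => al y w + al' y w) = fun y =>
    sharp Pi al y + sharp Pi al' y.
  by apply: functional_extensionality_dep => y; exact: sharpD.
have Ss := smooth_sharp hspan hPi.
apply: (form_ind hspan (x := x)).
- move=> al al' als als' aa.
  have sa := nbhs_singleton (nearS _ _ aa).
  suff -> : @nambu_bracket _ _ _ _ A p Pi al be x = @nambu_bracket _ _ _ _ A p Pi al'
      be x.
    by rewrite /along sa (anchor_local _ (smooth_eval_mv als) (smooth_eval_mv als')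
        (nearI _ _ aa)).
  apply: funext => v; rewrite /nambu_bracket; congr (_ - _).
    by apply: lie_form_localX; [exact: Ss..|exact: nearS].
  rewrite /interior_form; congr (Defs.interior _ _ _); apply: funext => w.
  exact: dform_local.
- move=> al al' als als' Pal Pal'.
  rewrite -[RHS]addr0 -{1}Pal -Pal' iD sD.
  have -> : @nambu_bracket _ _ _ _ A p Pi (fun y w => al y w + al' y w) be x =
     fun v => @nambu_bracket _ _ _ _ A p Pi al be x v + @nambu_bracket _ _ _ _ A p Pi
         al' be x v.
    apply: funext => v; rewrite /nambu_bracket sD lie_formDl //; [|exact: Ss..].
    rewrite [RHS]addrACA -opprD; congr (_ - _).
    by rewrite /interior_form /Defs.interior dformD.
  rewrite pairingD {1 2}/along anchorD; last exact: smooth_eval_mv.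
  rewrite (tangentD (anchor_tangent _)); [|exact: smooth_eval_mv..].
  rewrite /along; ring.
move=> h f hs fs; move: be bes.
have hfs : smooth_form (fun y w => h y * wedge_d A f y w) by apply: smooth_formZ =>
    //; exact: smooth_wedge_d.
apply: (form_ind hspan (x := x)).
- move=> be be' bes bes' bb.
  have sb := nbhs_singleton (nearS _ _ bb).
  set al := (fun y w => h y * wedge_d A f y w) : lform A p.
  suff -> : @nambu_bracket _ _ _ _ A p Pi al be x = @nambu_bracket _ _ _ _ A p Pi al
      be' x.
    by rewrite /along sb (anchor_local _ (smooth_eval_mv bes) (smooth_eval_mv bes')
        (nearI _ _ bb)).
  apply: funext => v; rewrite /nambu_bracket /interior_form sb; congr (_ - _).
  exact: lie_form_local.
- move=> be be' bes bes'; set al := (fun y w => h y * wedge_d A f y w) : lform A p =>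
    Pbe Pbe'.
  rewrite -[RHS]addr0 -{1}Pbe -Pbe' iD sD.
  have -> : @nambu_bracket _ _ _ _ A p Pi al (fun y w => be y w + be' y w) x =
     fun v => @nambu_bracket _ _ _ _ A p Pi al be x v + @nambu_bracket _ _ _ _ A p Pi
         al be' x v.
    apply: funext => v; rewrite /nambu_bracket lie_formD // [RHS]addrACA -opprD;
        congr (_ - _).
    (* Additivity in [be] needs [dform al] to be linear in its first slot; [al] is exact up to a
       factor by now, which makes this visible. *)
    have al1 : alternating (dform (x := x) al).
      have -> : @dform _ _ _ _ A _ al x = wedge_cov (fcons (dfun A h x) (fun i =>
          dfun A (f i) x)).
        apply: funext => w; rewrite dform_wedge_d //; congr (wedge_cov _ _).
        by apply: fconsP => [|i]; rewrite ?fcons0 ?fconsS.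
      exact: wedge_cov_alt.
    have IE (Z : fib A x) : Defs.interior Z (@dform _ _ _ _ A _ al x) v =
        @dform _ _ _ _ A _ al x [eta fcons 0 v with ord0 |-> Z].
      by rewrite -fcons_with0.
    by rewrite /interior_form sD !IE (multilinearD _ _ _ _ (alternating_lin al1)).
  rewrite pairingD {1 2}/along (tangentD (anchor_tangent _)); [|exact:
      smooth_eval_mv..].
  rewrite anchorD; last exact: smooth_eval_mv.
  rewrite /along; ring.
move=> u g us gs; rewrite nambu_bracket_exact //.
have iE h' f' : (forall i, smooth (f' i)) ->
    eval_mv (fun y w => h' y * wedge_d A f' y w) = fun y => h' y * div (ham f') y.
  by move=> fs'; apply: funext => y; rewrite /eval_mv pairingZ eval_mv_wedge_d.
have sE h' f' : sharp Pi (fun y w => h' y * wedge_d A f' y w) = fun y => h' y *: ham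
    f' y.
  by apply: functional_extensionality_dep => y; rewrite sharpZ.
have aE h' f' w : smooth w -> along (fun y => h' y *: ham f' y) w x = h' x * brk f' w x.
  by move=> ws; rewrite -along_hamE // /along anchorZ.
have ds f' : (forall i, smooth (f' i)) -> smooth (div (ham f')) by exact:
    smooth_div_ham.
have bs w f' : (forall i, smooth (f' i)) -> smooth w -> smooth (brk f' w) by exact:
    (smooth_brk hPi).
rewrite !iE // !sE !aE; [|by apply: smoothM => //; exact: ds..].
rewrite !(brkM hPi) //; [|exact: ds..].
rewrite !pairingD pairingZ eval_mv_wedge_d //.
have -> : pairing (fun v => - (u x * brk g h x * wedge_d A f x v)) (Mt x) = - (u x *
    brk g h x * div (ham f) x).
  under [X in pairing X]funext do rewrite -mulNr.
  by rewrite pairingZ eval_mv_wedge_d // mulNr.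
rewrite !pairingZ pairingD !pairing_sum.
have -> : \sum_j pairing (wedge_d A [eta g with j |-> brk f (g j)] x) (Mt x) =
    brk f (div (ham g)) x - brk g (div (ham f)) x.
  rewrite div_ham_bracket //; apply: eq_bigr => j _.
  by apply: eval_mv_wedge_d; apply: smooth_with => //; exact: bs.
have E f' g' : (forall i, smooth (g' i)) ->
    \sum_j pairing (fun v => brk f' (g' j) x * wedge_d A [eta g' with j |-> h] x v)
        (Mt x) =
    \sum_j brk f' (g' j) x * div (ham [eta g' with j |-> h]) x.
  by move=> gs'; apply: eq_bigr => j _; rewrite pairingZ eval_mv_wedge_d //; exact:
      smooth_with.
rewrite !E // div_ham_quadratic //.
move: (brk f (div (ham g)) x) (brk g (div (ham f)) x) (div (ham g) x) (div (ham f) x).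
by move: (brk f u x) (brk g h x) (u x) (h x) => *; ring.
Qed.

End Cochain.
End Modular.

(** * The modular multisection *)

Section Existence.
Context (R : realType) (d : nat) (M : manifold R d) (m : nat).
Context (A : lie_algebroid M m) (hspan : locally_spanned_by_exact A).
Context (p : nat) (Pi : multivec A (p + 1)) (hPi : nambu Pi).
Arguments Pi : clear implicits.
Context (nu : lform A m) (hnu : orientation_form nu).
Arguments nu : clear implicits.
Implicit Types (h u : M -> R) (x y : M) (X Y Z : sec A) (f g : 'I_p -> M -> R).

Local Notation brk := (fun_bracket Pi).
Local Notation ham := (hamiltonian Pi).
Local Notation div := (divergence nu).

Let Pia x : alternating (Pi x).
Proof. by have [[]] := hPi. Qed.

Lemma divergence_local X Y x : smooth_sec X -> smooth_sec Y ->
  (\near x, X x = Y x) -> div X x = div Y x.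
Proof.
move=> Xs Ys XY; apply: (divergence_unique hspan hnu Xs) => v.
by rewrite (lie_form_localX _ _ Xs Ys XY) (divergenceE hspan hnu).
Qed.

(* [Pi] with its last slot moved to the front, to be paired with the
   [(p + 1)]-form [d alpha]; this absorbs the sign [(-1)^p]. *)
Definition rotPi x : kvec (fib A x) p.+1 :=
  fun c => Pi x (vcat (fun i => c (lift ord0 i)) (fun=> c ord0)).

Arguments rotPi : clear implicits.

Lemma rotPi_alt x : alternating (rotPi x).
Proof.
pose h : 'I_(p + 1) -> 'I_p.+1 := vcat (lift ord0) (fun=> ord0).
pose h' : 'I_p.+1 -> 'I_(p + 1) := fcons (rshift p ord0) (lshift 1).
have hK : cancel h h'.
  move=> i; rewrite -(fintype.splitK i); case: (fintype.split i) => j /=; rewrite /h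
      /h'.
    by rewrite vcatl fconsS.
  by rewrite vcatr fcons0 (ord1 j).
have h'K : cancel h' h.
  move=> i; rewrite /h /h'; case: (unliftP ord0 i) => [j|] ->.
    by rewrite fconsS vcatl.
  by rewrite fcons0 vcatr.
have := alternating_reindex hK h'K (Pia x); congr alternating; apply: funext => c.
by congr (Pi x _); apply: vcat_ext => i /=; rewrite ?vcatl ?vcatr /h ?vcatl ?vcatr.
Qed.

(* The modular function of an arbitrary form. On [h df_1 /\ .. /\ df_p] it is
   [h div(Pi(df))], whence it is [C^oo(M)]-linear. *)
Definition modular_fun (al : lform A p) x : R :=
  div (sharp Pi al) x - pairing (@dform _ _ _ _ A _ al x) (rotPi x).

Let Ss := smooth_sharp hspan hPi.

Let sD (al al' : lform A p) :
  sharp Pi (fun y w => al y w + al' y w) = fun y => sharp Pi al y + sharp Pi al' y.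
Proof. by apply: functional_extensionality_dep => y; exact: sharpD. Qed.

Lemma modular_funD (al be : lform A p) x : smooth_form al -> smooth_form be ->
  modular_fun (fun y w => al y w + be y w) x = modular_fun al x + modular_fun be x.
Proof.
move=> als bes; rewrite /modular_fun sD (divergenceD hspan hnu); [|exact: Ss..].
rewrite [RHS]addrACA -opprD; congr (_ - _); rewrite -pairingD; congr (pairing _ _).
by apply: funext => v; exact: dformD.
Qed.

Lemma modular_fun_local (al be : lform A p) x : smooth_form al -> smooth_form be ->
  (\near x, al x = be x) -> modular_fun al x = modular_fun be x.
Proof.
move=> als bes ab; rewrite /modular_fun; congr (_ - _); last congr (pairing _ _).
  apply: divergence_local; [exact: Ss..|].
  by apply: (@filterS _ (nbhs x) _ _ _ _ ab) => y aby; rewrite /sharp aby.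
by apply: funext => v; exact: dform_local.
Qed.

Lemma modular_fun_wedge_d h f x : smooth h -> (forall i, smooth (f i)) ->
  modular_fun (fun y w => h y * wedge_d A f y w) x = h x * div (ham f) x.
Proof.
move=> hs fs; rewrite /modular_fun.
have -> : sharp Pi (fun y w => h y * wedge_d A f y w) = fun y => h y *: ham f y.
  by apply: functional_extensionality_dep => y; rewrite sharpZ.
rewrite (divergenceZ hspan hnu) //; last exact: smooth_ham.
have -> : @dform _ _ _ _ A _ (fun y w => h y * wedge_d A f y w) x =
    wedge_cov (fcons (dfun A h x) (fun i => dfun A (f i) x)).
  apply: funext => w; rewrite dform_wedge_d //; congr (wedge_cov _ _).
  by apply: fconsP => [|i]; rewrite ?fcons0 ?fconsS.
rewrite pairing_wedge_cov; last exact: rotPi_alt.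
rewrite (along_ham hPi) // /rotPi fcons0; under [X in vcat X]funext do rewrite fconsS.
by rewrite addrK.
Qed.

Lemma modular_funZ (al : lform A p) u x : smooth u -> smooth_form al ->
  modular_fun (fun y w => u y * al y w) x = u x * modular_fun al x.
Proof.
move=> us; move: al; apply: (form_ind hspan (x := x)).
- move=> al be als bes ab; rewrite -(modular_fun_local als bes ab) => <-.
  apply/esym; apply: modular_fun_local; [exact: smooth_formZ..|].
  by apply: (@filterS _ (nbhs x) _ _ _ _ ab) => y ->.
- move=> al be als bes Pal Pbe; rewrite modular_funD // mulrDr -Pal -Pbe.
  rewrite -modular_funD; [|exact: smooth_formZ..].
  by congr (modular_fun _ x); apply: lform_ext => y v; rewrite mulrDr.
- move=> h f hs fs; rewrite modular_fun_wedge_d // mulrA.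
  rewrite -(modular_fun_wedge_d x (smoothM us hs) fs).
  by congr (modular_fun _ x); apply: lform_ext => y v; rewrite mulrA.
Qed.

Lemma modular_fun_smooth (al : lform A p) : smooth_form al -> smooth (modular_fun al).
Proof.
move=> als; apply/smoothP => x; move: al als; apply: (form_ind hspan (x := x)).
- move=> al be als bes ab; apply: smooth_at_eq.
  have := ab; rewrite {1}/prop_near1 {1}nbhsE => -[U [oU Ux] Uab].
  apply: (@filterS _ (nbhs x) _ U) => [y Uy|]; last exact: open_nbhs_nbhs.
  apply: modular_fun_local => //; apply: (@filterS _ (nbhs y) _ U) => //.
  exact: open_nbhs_nbhs.
- move=> al be als bes Pal Pbe; apply: smooth_at_eq (smooth_atD Pal Pbe).
  by near=> y; rewrite modular_funD.
- move=> h f /[dup] hs /smoothP hs' fs; have /smoothP ds := smooth_div_ham hspan hPi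
    hnu fs.
  apply: smooth_at_eq (smooth_atM (hs' x) (ds x)).
  by near=> y; rewrite modular_fun_wedge_d.
Unshelve. all: by end_near. Qed.

Definition wedge_cosec (C : 'I_p -> cosec A) : lform A p :=
  fun x => wedge_cov (fun i => C i x).

Arguments wedge_cosec : clear implicits.

(** The covectors are extended to smooth sections and the modular function of their wedge is taken;
    its linearity over functions makes the value independent of the extensions. *)
Definition modular_mv : multivec A p :=
  fun x c => modular_fun (wedge_cosec (fun i => ext_cov (c i))) x.

Arguments modular_mv : clear implicits.

Let smooth_wc C : (forall i, smooth_cosec (C i)) -> smooth_form (wedge_cosec C).
Proof. exact: smooth_form_wedge. Qed.

Let wc_with C i s x v : wedge_cosec [eta C with i |-> s] x v =
  wedge_cov [eta (fun j => C j x) with i |-> s x] v.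
Proof. by congr (wedge_cov _ _); apply: funext => j /=; case: eqP. Qed.

Let scos_with (C : 'I_p -> cosec A) i s : (forall j, smooth_cosec (C j)) ->
  smooth_cosec s -> forall j, smooth_cosec ([eta C with i |-> s] j).
Proof. by move=> Cs ss j /=; case: eqP => _; [exact: ss|exact: Cs]. Qed.

Lemma modular_fun_wedgeD x i C s t : (forall j, smooth_cosec (C j)) ->
  smooth_cosec s -> smooth_cosec t ->
  modular_fun (wedge_cosec [eta C with i |-> fun y => s y + t y]) x =
  modular_fun (wedge_cosec [eta C with i |-> s]) x + modular_fun (wedge_cosec [eta C
      with i |-> t]) x.
Proof.
move=> Cs ss ts; rewrite -modular_funD; [|exact/smooth_wc/scos_with..].
congr (modular_fun _ x); apply: lform_ext => y v; rewrite !wc_with.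
exact: (multilinearD (f := fun c => wedge_cov c v) _ _ _ _ (alternating_lin
    (wedge_cov_alt_cov v))).
Qed.

Lemma modular_fun_wedgeZ x i C h s : (forall j, smooth_cosec (C j)) ->
  smooth h -> smooth_cosec s ->
  modular_fun (wedge_cosec [eta C with i |-> fun y => h y *: s y]) x =
  h x * modular_fun (wedge_cosec [eta C with i |-> s]) x.
Proof.
move=> Cs hs ss; rewrite -modular_funZ //; last exact/smooth_wc/scos_with.
congr (modular_fun _ x); apply: lform_ext => y v; rewrite !wc_with.
exact: (multilinearZ (f := fun c => wedge_cov c v) _ _ _ _ (alternating_lin
    (wedge_cov_alt_cov v))).
Qed.

Lemma modular_fun_ext x C C' : (forall i, smooth_cosec (C i)) -> (forall i,
    smooth_cosec (C' i)) ->
  (forall i, C i x = C' i x) -> modular_fun (wedge_cosec C) x = modular_fun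
      (wedge_cosec C') x.
Proof.
move=> Cs Cs' CC'.
apply: (@tensorial_multi _ _ _ _ (dual_bundle A) x p (fun C => modular_fun
    (wedge_cosec C) x) C C') => //.
- move=> i v s t vs ss ts; apply: modular_fun_wedgeD.
  + by move=> j; exact/smooth_cosecP.
  + exact/smooth_cosecP.
  + exact/smooth_cosecP.
- move=> i v f s vs fs ss; apply: modular_fun_wedgeZ => //.
  + by move=> j; exact/smooth_cosecP.
  + exact/smooth_cosecP.
- by move=> i; exact/smooth_cosecP.
- by move=> i; exact/smooth_cosecP.
Qed.

Let es x (c : dualv (fib A x)) : smooth_cosec (ext_cov c).
Proof. exact: (ext_covP _).1. Qed.

Let ex x (c : dualv (fib A x)) : ext_cov c x = c.
Proof. exact: (ext_covP _).2. Qed.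

Lemma modular_mvE x C : (forall i, smooth_cosec (C i)) ->
  modular_mv x (fun i => C i x) = modular_fun (wedge_cosec C) x.
Proof. by move=> Cs; apply: modular_fun_ext => // i; exact: ex. Qed.

Lemma modular_mv_alt x : alternating (modular_mv x).
Proof.
split=> [i v a u w|i j v ij vij].
  pose C j := ext_cov (v j).
  have Cs j : smooth_cosec (C j) by exact: es.
  have S1 (u' : dualv (fib A x)) : modular_mv x [eta v with i |-> u'] = modular_fun
      (wedge_cosec [eta C with i |-> ext_cov u']) x.
    apply: modular_fun_ext => [j|j|j]; [exact: es|exact: scos_with|].
    by rewrite ex /=; case: eqP => _; rewrite ?/C ex.
  rewrite !S1 -(modular_fun_wedgeZ x i Cs (smooth_cst M a) (es u)).
  have as_ : smooth_cosec (fun y => a *: ext_cov u y).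
    by apply: (smooth_cosecZ (f := fun=> a)) => //; exact: smooth_cst.
  rewrite -modular_fun_wedgeD //; apply: modular_fun_ext => [j|j|j].
  - exact: scos_with.
  - by apply: scos_with => //; exact: smooth_cosecD.
  - by rewrite /=; case: eqP => _ //; rewrite !ex.
rewrite /modular_mv; set C := fun i => ext_cov (v i).
have Cs l : smooth_cosec (C l) by exact: es.
(* The wedge with a repeated covector field is identically zero; in this form [modular_funZ] shows
   that its modular function vanishes. *)
have -> : wedge_cosec C = fun y w => 0 * wedge_cosec C y w.
  apply: lform_ext => y w; rewrite mul0r.
  by apply: ((wedge_cov_alt_cov w).2 i j _ ij); rewrite /C vij.
by rewrite (modular_funZ x (smooth_cst M 0) (smooth_wc Cs)) mul0r.
Qed.

Lemma smooth_modular_mv : smooth_multivec modular_mv.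
Proof.
split=> [x|i J]; first exact: modular_mv_alt.
apply/(smooth_onP _ (@frame_dom_open _ _ _ _ A i)) => x ix.
have [b [bs b1 b0]] := exists_bump (@frame_dom_open _ _ _ _ A i) ix.
pose C j : cosec A := fun y => b y *: coframe i y (J j).
have Cs j : smooth_cosec (C j).
  apply/smooth_cosecP; apply: (@smooth_sec_cutoff _ _ _ _ (dual_bundle A) _ _ (fun y
      => coframe i y (J j)) bs b0) => y iy.
  have := @smooth_sec_at_frame _ _ _ _ (dual_bundle A) i (J j) y iy.
  by congr smooth_sec_at; apply: functional_extensionality_dep => z; rewrite
      tnth_mktuple.
have /smoothP/(_ x) := modular_fun_smooth (smooth_wc Cs).
apply: smooth_at_eq; apply: (@filterS _ (nbhs x) _ _ _ _ b1) => y by1.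
rewrite -modular_mvE //; congr (modular_mv y _); apply: funext => j.
by rewrite /C by1 scale1r.
Qed.

Lemma modular_mv_wedge_d f x : (forall i, smooth (f i)) ->
  modular_mv x (fun i => dfun A (f i) x) = div (ham f) x.
Proof.
move=> fs; rewrite (modular_mvE x (C := fun i => dfun A (f i))) => [|i]; last exact:
    smooth_dfun.
rewrite -[RHS]mul1r -(modular_fun_wedge_d _ (smooth_cst M 1) fs); congr (modular_fun
    _ x).
by apply: lform_ext => y v; rewrite mul1r.
Qed.

Lemma modular_multivecP (Mt : multivec A p) : modular_multivec Pi nu Mt <->
  smooth_multivec Mt /\ forall f x, (forall i, smooth (f i)) ->
    Mt x (fun i => dfun A (f i) x) = div (ham f) x.
Proof.
split=> -[Ms ME]; split=> // f.
  move=> x fs; apply/esym; apply: (divergence_unique hspan hnu) => [|v]; first exact: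
      smooth_ham.
  exact: ME.
move=> fs x v; rewrite ME // -(divergenceE hspan hnu) //; exact: smooth_ham.
Qed.

(** For uniqueness, two candidates agree on exact forms, hence by [form_ind] in the pairing with
    every smooth form; wedges of extended covectors then recover their values. *)
Lemma modular_multivec_exists : exists! Mt, modular_multivec Pi nu Mt.
Proof.
exists modular_mv; split=> [|Mt' /modular_multivecP[Ms' ME']].
  apply/modular_multivecP; split; first exact: smooth_modular_mv.
  by move=> f x fs; exact: modular_mv_wedge_d.
apply: functional_extensionality_dep => x; apply: funext => c.
have H (al : lform A p) : smooth_form al -> pairing (al x) (modular_mv x) = pairing
    (al x) (Mt' x).
  move: al; apply: (form_ind hspan (x := x)).
  - by move=> al be als bes ab; rewrite (nbhs_singleton ab).
  - by move=> al be als bes; rewrite !pairingD => -> ->.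
  - move=> h f hs fs; rewrite !pairingZ; congr (_ * _).
    rewrite !pairing_wedge_cov ?ME' ?modular_mv_wedge_d //.
      by have [] := Ms'.
    exact: modular_mv_alt.
have wx : wedge_cosec (fun i => ext_cov (c i)) x = wedge_cov c.
  by congr (wedge_cov _); apply: funext => i; exact: ex.
have := H _ (smooth_wc (fun i => es (c i))); rewrite wx !pairing_wedge_cov //.
  by have [] := Ms'.
exact: modular_mv_alt.
Qed.

End Existence.

(** * The cocycle and its cohomology class *)

Section Class.
Context (R : realType) (d : nat) (M : manifold R d) (m : nat).
Context (A : lie_algebroid M m) (hspan : locally_spanned_by_exact A).
Context (p : nat) (Pi : multivec A (p + 1)) (hPi : nambu Pi).
Implicit Types (h u : M -> R) (x y : M) (X Y Z : sec A) (f g : 'I_p -> M -> R).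

Lemma modular_cocycle (nu : lform A m) (Mt : multivec A p) :
  orientation_form nu -> modular_multivec Pi nu Mt ->
  is_cocycle Pi (modular_cochain Mt).
Proof.
move=> hnu /(modular_multivecP hspan hPi hnu) [Ms ME]; split; first split.
- move=> al als; exact: (smooth_eval_mv hspan hPi hnu Ms ME (als ord0)).
- move=> i al c be ga als bes gas x; rewrite /modular_cochain /= (ord1 i) eqxx.
  exact: pairing_comb.
move=> al als x; rewrite /d_leibniz /leibniz_diff.
(* The differential of a 1-cochain has two action terms and a single bracket term, [r = 0] and
   [s = 1]: the expression in [eval_mv_closed]. *)
under [X in _ + X]eq_bigr do rewrite big_mkcond.
rewrite !big_ord_recl !big_ord0 /= !addr0 !add0r expr0 expr1 mul1r !mulN1r.
have l1 : lift (lift ord0 ord0) ord0 = ord0 :> 'I_2 by apply: val_inj.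
rewrite -[RHS](eval_mv_closed hspan hPi hnu Ms ME x (als ord0) (als (lift ord0 ord0))).
congr (along _ _ _ - _ - _).
by rewrite /modular_cochain /eval_mv; congr (along _ _ _); apply: funext => y;
    rewrite l1.
Qed.

(** Top forms are proportional in each fibre; evaluated on a local frame, the ratio is a quotient of
    smooth functions. *)
Lemma orientation_ratio (nu nu' : lform A m) : orientation_form nu ->
    orientation_form nu' ->
  exists q : M -> R, [/\ smooth q, forall x, q x != 0 & forall x v, nu' x v = q x *
      nu x v].
Proof.
move=> hnu hnu'.
have qex x : exists q, forall v, nu' x v = q * nu x v.
  have [i ix] := frame_cover A x; have n0 := orientation_frame hnu ix.
  exists (nu' x (tnth (frame i x)) / nu x (tnth (frame i x))) => v.
  apply: (mulfI n0); rewrite (top_form v (frame_pair_frame ix) (hnu'.1.1 x) (hnu.1.1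
      x)).
  by field.
have [q qE] := choice qex; exists q; split=> //.
  apply/smoothP => x; have [i ix] := frame_cover A x.
  have sf (al : lform A m) : orientation_form al -> smooth_at x (fun y => al y (tnth
      (frame i y))).
    move=> [als _]; apply: (smooth_form_app_at (s := fun a y => tnth (frame i y) a)
        als) => a.
    exact: smooth_sec_at_frame.
  have n0 := orientation_frame hnu ix.
  apply: smooth_at_eq (smooth_atM (sf _ hnu') (smooth_atV n0 (sf _ hnu))).
  apply: (@filterS _ (nbhs x) _ _ _ _ (frame_dom_near ix)) => y iy.
  by rewrite qE mulfK // orientation_frame.
move=> x; apply/eqP => q0; have [v] := hnu'.2 x.
by rewrite qE q0 mul0r eqxx.
Qed.

Lemma divergence_ratio (nu nu' : lform A m) q X x : orientation_form nu ->
    orientation_form nu' ->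
  smooth q -> (forall x, q x != 0) -> (forall x v, nu' x v = q x * nu x v) ->
      smooth_sec X ->
  divergence nu' X x = divergence nu X x + along X q x / q x.
Proof.
move=> hnu hnu' qs q0 qE Xs; apply: (divergence_unique hspan hnu') => // v.
have -> : nu' = fun y w => q y * nu y w by apply: lform_ext.
have nus := smooth_form_ext v hnu.1.
have := divergenceE hspan hnu v Xs; rewrite /lie_form /along => L.
rewrite (tangentM (anchor_tangent _) qs nus) -addrA -mulr_sumr -mulrBr L.
have -> : nu x (fun i => ext (v i) x) = nu x v.
  by congr (nu x _); apply: funext => i; rewrite ext_at.
by have := q0 x => qx; field.
Qed.

Lemma modular_class (nu nu' : lform A m) (Mt Mt' : multivec A p) :
  orientation_form nu -> orientation_form nu' ->
  modular_multivec Pi nu Mt -> modular_multivec Pi nu' Mt' ->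
  exists2 th : M -> R, smooth th &
    forall (al : lform A p) x, smooth_form al ->
      pairing (al x) (Mt' x) - pairing (al x) (Mt x) = along (sharp Pi al) th x.
Proof.
move=> hnu hnu' /(modular_multivecP hspan hPi hnu) [Ms ME].
move=> /(modular_multivecP hspan hPi hnu') [Ms' ME'].
have [q [qs q0 qE]] := orientation_ratio hnu hnu'.
have q2 y : 0 < q y * q y by rewrite -expr2 lt_def sqr_ge0 expf_neq0.
have q2s : smooth (fun y => q y * q y) by exact: smoothM.
have ls : smooth (fun y => ln (q y * q y)) by exact: smooth_ln.
(* This is [ln |q|], written through the positive smooth function [q^2] because the sign of [q] is
   unknown and may vary between components. *)
exists (fun y => 2^-1 * ln (q y * q y)); first exact: smoothM (smooth_cst M _) ls.
move=> al x; move: al; apply: (form_ind hspan (x := x)).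
- move=> al be als bes ab; rewrite /along /sharp (nbhs_singleton ab); exact.
- move=> al be als bes; rewrite !pairingD /along sharpD anchorD => [<- <-|]; first by
    ring.
  exact: smoothM (smooth_cst M _) ls.
- move=> h f hs fs; have Hs := smooth_ham hPi fs.
  rewrite !pairingZ !pairing_wedge_cov; [|by have [] := Ms|by have [] := Ms'].
  rewrite ME // ME' // (divergence_ratio x hnu hnu' qs q0 qE Hs) /along sharpZ
      anchorZ; last exact: smoothM (smooth_cst M _) ls.
  have D := anchor_tangent (sharp Pi (wedge_d A f) x).
  rewrite (tangentZ D) // (tangent_ln D q2 q2s) (tangentM D) //.
  by have := q0 x => qx; rewrite /hamiltonian; field.
Qed.

(** A primitive of [xi - phi] becomes one of [xi - psi] by subtracting [th], and conversely by
    adding it; [lin] asks for exactly the linearity that these two shifts use. *)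
Lemma coh_class_eq k (phi psi : leibniz_map A p k.+1) (th : leibniz_map A p k) :
  is_cochain th ->
  (forall (t : leibniz_map A p k) c, is_cochain t ->
     is_cochain (fun a x => t a x + c * th a x) /\ forall al : 'I_k.+1 -> lform A p,
         (forall i, smooth_form (al i)) -> forall x,
     d_leibniz Pi (fun a x => t a x + c * th a x) al x =
     d_leibniz Pi t al x + c * d_leibniz Pi th al x) ->
  (forall al : 'I_k.+1 -> lform A p, (forall i, smooth_form (al i)) -> forall x,
     psi al x - phi al x = d_leibniz Pi th al x) ->
  coh_class Pi phi = coh_class Pi psi.
Proof.
move=> ths lin E; apply/seteqP; split=> xi [xic [t ts tE]]; split=> //.
  have [c1 c2] := lin t (-1) ts; exists (fun a x => t a x + -1 * th a x) => // al als x.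
  by rewrite c2 // -tE // -E //; ring.
have [c1 c2] := lin t 1 ts; exists (fun a x => t a x + 1 * th a x) => // al als x.
by rewrite c2 // -tE // -E //; ring.
Qed.

Lemma d_leibniz0 (t : leibniz_map A p 0) (al : 'I_1 -> lform A p) x :
  d_leibniz Pi t al x = along (sharp Pi (al ord0)) (t (fun i => al (lift ord0 i))) x.
Proof.
rewrite /d_leibniz /leibniz_diff !big_ord_recl !big_ord0 /= !addr0 expr0 mul1r.
by rewrite big_mkcond big_ord_recl big_ord0 /= !addr0.
Qed.

Lemma modular_coh_class (nu nu' : lform A m) (Mt Mt' : multivec A p) :
  orientation_form nu -> orientation_form nu' ->
  modular_multivec Pi nu Mt -> modular_multivec Pi nu' Mt' ->
  coh_class Pi (modular_cochain Mt) = coh_class Pi (modular_cochain Mt').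
Proof.
move=> hnu hnu' hM hM'; have [th ths thE] := modular_class hnu hnu' hM hM'.
apply: (@coh_class_eq 0 _ _ (fun _ => th)).
- by split=> // -[].
- move=> t c [ts _]; split.
    split=> [al als|[]//]; apply: smoothD; first exact: ts.
    by apply: smoothM => //; exact: smooth_cst.
  move=> al als x; rewrite !d_leibniz0 /along.
  have D := anchor_tangent (sharp Pi (al ord0) x).
  have tss : smooth (t (fun i => al (lift ord0 i))) by exact: ts.
  rewrite (tangentD D) // ?(tangentZ D) //.
  by apply: smoothM => //; exact: smooth_cst.
- by move=> al als x; rewrite d_leibniz0 -thE.
Qed.

End Class.

(** Unique existence makes the multisection attached to [nu] well defined, so that the clauses on
    the cocycle and on its class may be stated for any [Mt] with the defining property. *)
Theorem theorem3p18 (R : realType) (d : nat) (M : manifold R d) (m : nat)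
    (A : lie_algebroid M m) (p : nat) (hn : (p + 1 <= m)%N)
    (Pi : multivec A (p + 1)) (hPi : nambu Pi)
    (horient : orientable A) (hspan : locally_spanned_by_exact A) :
  (forall nu : lform A m, orientation_form nu ->
     exists! Mt : multivec A p, modular_multivec Pi nu Mt) /\
  (forall (nu : lform A m) (Mt : multivec A p),
     orientation_form nu -> modular_multivec Pi nu Mt ->
     is_cocycle Pi (modular_cochain Mt)) /\
  (forall (nu nu' : lform A m) (Mt Mt' : multivec A p),
     orientation_form nu -> orientation_form nu' ->
     modular_multivec Pi nu Mt -> modular_multivec Pi nu' Mt' ->
     coh_class Pi (modular_cochain Mt) = coh_class Pi (modular_cochain Mt')).
Proof.
split; [|split].
- by move=> nu hnu; exact: modular_multivec_exists.
- by move=> nu Mt; exact: modular_cocycle.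
- by move=> nu nu' Mt Mt'; exact: modular_coh_class.
Qed.
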